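(* Let $\mathbb{P}_n(1)$ be the complex projective space of complex dimension $n$ and holomorphic sectional curvature $c=1$, regarded as a torification of $\mathcal{P}_{n+1}^\times$. Then for every Kähler function $f$ on $\mathbb{P}_n(1)$ we have $\mathrm{Crit}(f)=\mathrm{spec}(f)$, where $\mathrm{Crit}(f)$ is the set of critical values of $f$ (the set of $\lambda\in\mathbb{R}$ for which there is $p$ with $f(p)=\lambda$ and $df_p=0$) and $\mathrm{spec}(f)$ is the spectrum of $f$.
   Context: $\mathcal{P}_{n+1}^\times$ is the set of functions $p:\Omega\to\mathbb{R}$ on the finite set $\Omega=\{x_1,\dots,x_{n+1}\}$ with $p(x)>0$ for all $x$ and $\sum_xp(x)=1$. It is an exponential family: $p_\theta(x)=\exp\big(\sum_{i=1}^n\theta_iF_i(x)-\psi(\theta)\big)$, $\theta\in\mathbb{R}^n$, $F_i(x_j)=\delta_{ij}$, $\psi(\theta)=\ln(1+\sum_ie^{\theta_i})$. The space $\mathcal{A}_{\mathcal{E}}$ spanned by $F_1,\dots,F_n,1$ is the space of all real functions on $\Omega$, and $F=(F_1,\dots,F_n)$ is injective. $\mathcal{P}_{n+1}$ denotes the set of all probability functions on $\Omega$, which is the closure of $\mathcal{P}^\times_{n+1}$ for pointwise convergence. $\mathbb{E}_p(X)=\sum_xX(x)p(x)$. General definitions. For an exponential family $\mathcal{E}=\{p_\theta\}_{\theta\in\mathbb{R}^n}$ over a finite set, with Fisher metric $(h_F)_{ij}(\theta)=\mathbb{E}_{p_\theta}(\partial_i\ln p_\theta\,\partial_j\ln p_\theta)$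 and the flat connection $\nabla^{(e)}$ having $\theta$ as affine coordinates, $T\mathcal{E}$ (coordinates $(\theta,\dot\theta)$ for $\sum\dot\theta_k\partial/\partial\theta_k|_{p_\theta}$) is Kähler with holomorphic coordinates $z_k=\theta_k+i\dot\theta_k$ and metric $\mathrm{diag}(h_F(\theta),h_F(\theta))$. A parallel lattice $L$ is the set of integer combinations of a frame $Y=(Y_1,\dots,Y_n)$ of $\nabla^{(e)}$-parallel vector fields (a generator); $\Gamma(L)$ is the group of translations $u\mapsto u+\sum k_iY_i$, $k_i\in\mathbb{Z}$, $\mathcal{E}_L=T\mathcal{E}/\Gamma(L)$ with quotient map $q_L$ and projection $\pi_L:\mathcal{E}_L\to\mathcal{E}$, with torus action $\Phi_Y([t],q_L(u))=q_L(u+\sum t_iY_i)$ of $\mathbb{T}^n=\mathbb{R}^n/\mathbb{Z}^n$. A connected Kähler manifold $N$ of complex dimension $n$ with effective holomorphic isometric $\mathbb{T}^n$-action $\Phi$, free locus $N^\circ$, is a torification of $\mathcal{E}$ if there are such $L,Y$ and an equivariant holomorphic isometric diffeomorphism $G:\mathcal{E}_L\to N^\circ$; it is regular if moreover $N$ is simply connected, complete, with real-analytic metric. The maps $\kappa=\pi_L\circ G^{-1}:N^\circ\to\mathcal{E}$ so obtained are the compatible projections; when $N$ is compact and regular each has a unique continuous extension $K:N\to\overline{\mathcal{E}}$ (its natural extension), $\overline{\mathcal{E}}$ being the closure of $\mathcal{E}$ in the set of all probability functions. $\mathbb{P}_n(1)$ carries the Fubini–Study metric of holomorphic sectional curvature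 $1$ and the action $\Phi([t],[z])=[e^{2i\pi t_1}z_1,\dots,e^{2i\pi t_n}z_n,z_{n+1}]$; it is a (regular) torification of $\mathcal{P}_{n+1}^\times$, and $K([z])(x_k)=|z_k|^2/(|z_1|^2+\dots+|z_{n+1}|^2)$ is the natural extension of a compatible projection. Kähler functions and spectrum. A smooth $f:N\to\mathbb{R}$ is Kähler if its Hamiltonian vector field is Killing. When $N$ is a Kähler toric manifold that is a regular torification of $\mathcal{E}$ and $F$ is injective, every Kähler function can be written $f(p)=\mathbb{E}_{K(\phi(p))}(X)$ for all $p\in N$, with $X\in\mathcal{A}_{\mathcal{E}}$, $\phi$ in the identity component of the group of holomorphic isometries of $N$, and $K$ the natural extension of a compatible projection; $\mathrm{spec}(f)$ is defined as the image of $X$, which does not depend on the choice of $K,\phi,X$. *)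

(* Defs.v *)
From HB Require Import structures.
From mathcomp Require Import all_boot all_order all_algebra.
From mathcomp Require Import complex.
From mathcomp Require Import all_classical all_reals all_analysis.

Set Implicit Arguments.
Unset Strict Implicit.
Unset Printing Implicit Defensive.

Import Order.TTheory GRing.Theory Num.Theory numFieldNormedType.Exports.
Local Open Scope classical_set_scope.
Local Open Scope ring_scope.
Local Open Scope complex_scope.

HB.instance Definition _ (R : realType) :=
  PseudoPointedMetric.copy R[i] (R[i] : numFieldType)^o.
HB.instance Definition _ (R : realType) :=
  NormedModule.copy R[i] (R[i] : numFieldType)^o.

Section real_calculus.
Variables (R : realType) (m : nat).
Implicit Types (w u : 'rV[R[i]]_m).

(* C^m is viewed as the real vector space R^2m: these are real directional
   derivatives. *)
Definition along (f : 'rV[R[i]]_m -> R) w u : R -> R :=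
  fun t => f (w + t%:C *: u).

Definition ddir (f : 'rV[R[i]]_m -> R) w u : R := derive1 (along f w u) 0.

Definition ddir_vec (X : 'rV[R[i]]_m -> 'rV[R[i]]_m) w u : 'rV[R[i]]_m :=
  \row_i (ddir (fun w' => complex.Re (X w' 0 i)) w u
          +i* ddir (fun w' => complex.Im (X w' 0 i)) w u).

Fixpoint is_Ck (k : nat) (f : 'rV[R[i]]_m -> R) : Prop :=
  continuous f /\
  if k is k'.+1 then
    forall u, (forall w, derivable (along f w u) 0 1) /\
              is_Ck k' (fun w => ddir f w u)
  else True.

Definition is_smooth (f : 'rV[R[i]]_m -> R) : Prop := forall k, is_Ck k f.

End real_calculus.

Section projective_space.
Variables (R : realType) (n : nat).
Local Notation C := R[i].

Definition cproj : Type := {U : {vspace 'rV[C]_n.+1} | \dim U == 1%N}.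

HB.instance Definition _ := SubChoice.on cproj.

Lemma dim_line0 : \dim <[(delta_mx 0 ord0 : 'rV[C]_n.+1)%R]>%VS == 1%N.
Proof.
rewrite dim_vline eqb1; apply/eqP => /matrixP /(_ 0 ord0) /eqP.
by rewrite !mxE !eqxx oner_eq0.
Qed.

(* The point [z]; a junk value for z = 0. *)
Definition pline (z : 'rV[C]_n.+1) : cproj :=
  insubd (exist (fun U => is_true (\dim U == 1%N)) _ dim_line0 : cproj) <[z]>%VS.

Definition hcoord (p : cproj) : 'rV[C]_n.+1 := vpick (val p).

Definition cproj_open : set_system cproj :=
  [set U | open [set z : 'rV[C]_n.+1 | z != 0 /\ U (pline z)]].

Lemma open_neq0 : open [set z : 'rV[C]_n.+1 | z != 0].
Proof.
rewrite (_ : mkset _ = ~` [set 0]); last first.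
  by apply/seteqP; split => z /= /eqP.
apply: closed_openC; apply: accessible_closed_set1.
exact/hausdorff_accessible/norm_hausdorff.
Qed.

Lemma cproj_openT : cproj_open setT.
Proof.
rewrite /cproj_open /= (_ : mkset _ = [set z | z != 0]); first exact: open_neq0.
by apply/seteqP; split => z /=; [case|].
Qed.

Lemma cproj_openI : setI_closed cproj_open.
Proof.
move=> U V oU oV; rewrite /cproj_open /=.
rewrite (_ : mkset _ = [set z | z != 0 /\ U (pline z)] `&`
                       [set z | z != 0 /\ V (pline z)]); first exact: openI.
by apply/seteqP; split => z /=; [case=> z0 []|case=> -[z0 Uz] [_ Vz]].
Qed.

Lemma cproj_open_bigU (I : Type) (F : I -> set cproj) :
  (forall i, cproj_open (F i)) -> cproj_open (\bigcup_i F i).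
Proof.
move=> oF; rewrite /cproj_open /=.
rewrite (_ : mkset _ = \bigcup_i [set z | z != 0 /\ F i (pline z)]).
  by apply: bigcup_open => i _; exact: oF.
apply/seteqP; split => z /=; first by case=> z0 [i _ Fi]; exists i.
by case=> i _ [z0 Fi]; split => //; exists i.
Qed.

(* Quotient topology of the open subset C^(n+1) \ {0}. *)
HB.instance Definition _ :=
  isOpenTopological.Build cproj cproj_openT cproj_openI cproj_open_bigU.

(* [affine_chart k] parametrizes {z_k <> 0} by C^n, with inverse
   [affine_coord k]. *)
Definition affine_chart (k : 'I_n.+1) (w : 'rV[C]_n) : cproj :=
  pline (\row_j oapp (fun i => w 0 i) 1 (unlift k j)).

Definition in_chart (k : 'I_n.+1) (p : cproj) : Prop := hcoord p 0 k != 0.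

Definition affine_coord (k : 'I_n.+1) (p : cproj) : 'rV[C]_n :=
  \row_i (hcoord p 0 (lift k i) / hcoord p 0 k).

Definition hdot (u v : 'rV[C]_n) : C := \sum_i u 0 i * conjc (v 0 i).

(* Fubini-Study metric of holomorphic sectional curvature c, in any affine
   chart: for n = 1 it is (4 / c) |dw|^2 / (1 + |w|^2)^2, the round metric of
   Gaussian curvature c. *)
Definition fs_metric (c : R) (w u v : 'rV[C]_n) : R :=
  4 / c * complex.Re
    (((1 + hdot w w) * hdot u v - hdot u w * hdot w v) / (1 + hdot w w) ^+ 2).

Definition fs_form (c : R) (w u v : 'rV[C]_n) : R :=
  fs_metric c w ((0 +i* 1) *: u) v.

Definition smooth_cproj (f : cproj -> R) : Prop :=
  forall k, is_smooth (f \o affine_chart k).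

Definition critical_point (f : cproj -> R) (p : cproj) : Prop :=
  forall k w, affine_chart k w = p -> forall u, ddir (f \o affine_chart k) w u = 0.

Definition critical_values (f : cproj -> R) : set R :=
  [set l | exists p, f p = l /\ critical_point f p].

(* A vector field on the projective space is given by its expressions X k in
   the charts; nondegeneracy of the symplectic form makes the Hamiltonian
   vector field unique. *)
Definition hamiltonian_field (c : R) (f : cproj -> R)
    (X : 'I_n.+1 -> 'rV[C]_n -> 'rV[C]_n) : Prop :=
  forall k w v, fs_form c w (X k w) v = ddir (f \o affine_chart k) w v.

(* The Lie derivative of the metric along X vanishes. *)
Definition killing_field (c : R)
    (X : 'I_n.+1 -> 'rV[C]_n -> 'rV[C]_n) : Prop :=
  forall k w u v,
    ddir (fun w' => fs_metric c w' u v) w (X k w)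
    + fs_metric c w (ddir_vec (X k) w u) v
    + fs_metric c w u (ddir_vec (X k) w v) = 0.

Definition kahler_function (c : R) (f : cproj -> R) : Prop :=
  smooth_cproj f /\
  exists X, hamiltonian_field c f X /\ killing_field c X.

(* G : C^n -> P_n is holomorphic and pulls the Fubini-Study metric back to g.
   Here 'd is the complex Frechet differential; continuity makes G stay in the
   affine chart j near z. *)
Definition holo_isometric (c : R)
    (g : 'rV[C]_n -> 'rV[C]_n -> 'rV[C]_n -> R) (G : 'rV[C]_n -> cproj) : Prop :=
  continuous G /\
  forall j z, in_chart j (G z) ->
    let F : 'rV[C]_n -> 'rV[C]_n := affine_coord j \o G in
    differentiable F z /\
    forall u v, fs_metric c (F z) ('d F z u) ('d F z v) = g z u v.

Definition holo_isometries (c : R) : set {compact-open, cproj -> cproj} :=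
  [set phi : cproj -> cproj | bijective phi /\
             forall k, holo_isometric c (fs_metric c) (phi \o affine_chart k)].

Definition holo_isometries0 (c : R) : set {compact-open, cproj -> cproj} :=
  connected_component (holo_isometries c) (id : cproj -> cproj).

End projective_space.

Section exponential_family.
Variables (R : realType) (n : nat).
Local Notation C := R[i].

(* Omega = {x_1, ..., x_(n+1)} is 'I_n.+1, with x_(n+1) = ord_max. *)
Definition Fstat (i : 'I_n) (x : 'I_n.+1) : R := (x == lift ord_max i)%:R.

Definition psi (theta : 'rV[R]_n) : R := ln (1 + \sum_i expR (theta 0 i)).

Definition ptheta (theta : 'rV[R]_n) : {ptws 'I_n.+1 -> R} :=
  fun x => expR (\sum_i theta 0 i * Fstat i x - psi theta).

Definition fin_expectation (p X : 'I_n.+1 -> R) : R := \sum_x X x * p x.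

Definition score (theta : 'rV[R]_n) (i : 'I_n) (x : 'I_n.+1) : R :=
  'D_(delta_mx 0 i) (fun theta' : 'rV[R]_n => ln (ptheta theta' x)) theta.

Definition fisher (theta : 'rV[R]_n) (i j : 'I_n) : R :=
  fin_expectation (ptheta theta) (fun x => score theta i x * score theta j x).

Definition re_vec (z : 'rV[C]_n) : 'rV[R]_n := map_mx (@complex.Re R) z.
Definition im_vec (z : 'rV[C]_n) : 'rV[R]_n := map_mx (@complex.Im R) z.

(* The tangent bundle of the family is C^n via z = theta + i thetadot. *)
Definition dombrowski_metric (z u v : 'rV[C]_n) : R :=
  \sum_i \sum_j fisher (re_vec z) i j *
    (re_vec u 0 i * re_vec v 0 j + im_vec u 0 i * im_vec v 0 j).

(* The rows of Y are the coordinates (constant in theta) of the parallel fields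
   Y_1, ..., Y_n; this is u |-> u + sum_i t_i Y_i. *)
Definition translate (Y : 'M[R]_n) (t : 'rV[R]_n) (z : 'rV[C]_n) : 'rV[C]_n :=
  z + map_mx (fun y : R => 0 +i* y) (t *m Y).

Definition int_vec (k : 'rV[int]_n) : 'rV[R]_n := map_mx intr k.

(* The torus R^n / Z^n acts through R^n. *)
Definition torus_act (t : 'rV[R]_n) (p : cproj R n) : cproj R n :=
  pline (\row_j (oapp (fun i => cos (2 * pi * t 0 i) +i* sin (2 * pi * t 0 i))
                      1 (unlift ord_max j)
                 * hcoord p 0 j)).

Definition free_locus : set (cproj R n) :=
  [set p | forall t, torus_act t p = p -> exists k, t = int_vec k].

(* An equivariant holomorphic isometric diffeomorphism from the quotient of the
   tangent bundle by Gamma(L), L generated by Y, onto the free locus; G is its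
   composition with the quotient map q_L. *)
Record torification_map (Y : 'M[R]_n) (G : 'rV[C]_n -> cproj R n) : Prop := {
  torif_frame : Y \in unitmx;
  torif_quotient : forall z z',
    G z = G z' <-> exists k, z' = translate Y (int_vec k) z;
  torif_onto : range G = free_locus;
  torif_equivariant : forall t z,
    G (translate Y t z) = torus_act t (G z);
  torif_holo_isometric : holo_isometric 1 dombrowski_metric G }.

(* On the free locus K is the compatible projection sending G z to p_(Re z). *)
Definition natural_extension (K : cproj R n -> {ptws 'I_n.+1 -> R}) : Prop :=
  exists Y G, [/\ torification_map Y G,
    forall z, K (G z) = ptheta (re_vec z),
    continuous K
    & forall p, closure (range ptheta) (K p)].

(* The image of X does not depend on the presentation of f as
   p |-> E_(K (phi p)) (X), so it is the union over all presentations. *)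
Definition spectrum (f : cproj R n -> R) : set R :=
  [set l | exists K phi X, [/\ natural_extension K,
    holo_isometries0 1 phi,
    forall p, f p = fin_expectation (K (phi p)) X
    & range X l]].

End exponential_family.

(* Main.v *)
(* In an affine chart, the Killing equation for the Hamiltonian field of f says
   that the Hessian of U(w) = (1 + |w|^2) f(w) is invariant under
   multiplication by i. By the symmetry of second derivatives, third
   derivatives of U vanish, hence U is a Hermitian polynomial and
   f([z]) = z A z^* / |z|^2 for a Hermitian matrix A. Critical values of f are
   eigenvalues of A, and a unitary diagonalisation of A (a holomorphic isometry,
   joined to the identity by unitary maps) presents f through the standard
   projection [z] |-> (|z_k|^2 / |z|^2)_k, with X the list of eigenvalues.

   Conversely, let K be any natural extension. The equivariance and isometry of
   its torification map G make K a moment map of the torus action, hence an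
   affine function of the standard projection, first on the dense free locus and
   then everywhere. As the supremum of p_theta(x) over theta is 1, K sends some
   coordinate point e_y to the vertex of the simplex at x. The standard
   projection is critical at e_y, so if f = E_(K o phi)(X) then X(x) is the
   value of f at its critical point phi^-1(e_y). *)

Require Import Defs.
From mathcomp Require Import all_boot all_order all_algebra.
From mathcomp Require Import complex.
From mathcomp Require Import all_classical all_reals all_analysis.
From mathcomp Require Import ring lra.

Set Implicit Arguments.
Unset Strict Implicit.
Unset Printing Implicit Defensive.

Import Order.TTheory GRing.Theory Num.Theory numFieldNormedType.Exports.
Local Open Scope classical_set_scope.
Local Open Scope ring_scope.
Local Open Scope complex_scope.

(** The Killing equation is compared at (u, v) and at (iu, iv). The metric is invariant under i, so
    the term that differentiates the metric cancels in the difference, and so does every part of dX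
    that is complex linear. For X written through U nothing but second derivatives of U is left.
    Third derivatives then vanish by parity: a factor i changes the sign of a symmetric trilinear
    form each time it moves to another slot, and it can go from one slot to another directly or
    through the third.

    For the converse, the torification map G is known only through its axioms. Equivariance
    determines dG on imaginary vectors, holomorphy carries this to real vectors, and isometry then
    equates the covariance under p_theta with (4 pi)^2 times a covariance under the standard
    projection q. These covariances are the derivatives of p and q, so p minus a linear image of q
    is constant. The factor (4 pi)^2 is the 4 of the metric at curvature 1 times the (2 pi)^2 of the
    torus action. *)

Lemma cvg_sumf (K : numFieldType) (V : normedModType K) (T : Type)
    (F : set_system T) {FF : Filter F} (I : finType) (f : I -> T -> V)
    (l : I -> V) :
  (forall i, f i t @[t --> F] --> l i) ->
  \sum_i f i t @[t --> F] --> \sum_i l i.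
Proof.
move=> fl; elim: (index_enum I) => [|i r ih].
  by rewrite big_nil; under eq_fun do rewrite big_nil; exact: cvg_cst.
rewrite big_cons; under eq_fun do rewrite big_cons.
by apply: cvgD.
Qed.

(** * Real and imaginary parts, squared modulus and limits in C *)

Section complex_numbers.
Variable R : realType.
Implicit Types (x y z : R[i]) (r : R).
Local Notation Re := (@complex.Re R).
Local Notation Im := (@complex.Im R).

Lemma complex_ext x y : Re x = Re y -> Im x = Im y -> x = y.
Proof. by case: x y => [a b] [c d] /= -> ->. Qed.

Lemma ReD x y : Re (x + y) = Re x + Re y.
Proof. by case: x y => [a b] [c d]. Qed.

Lemma ImD x y : Im (x + y) = Im x + Im y.
Proof. by case: x y => [a b] [c d]. Qed.

Lemma ReN x : Re (- x) = - Re x.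
Proof. by case: x. Qed.

Lemma ImN x : Im (- x) = - Im x.
Proof. by case: x. Qed.

Lemma ReM x y : Re (x * y) = Re x * Re y - Im x * Im y.
Proof. by case: x y => [a b] [c d]. Qed.

Lemma ImM x y : Im (x * y) = Re x * Im y + Im x * Re y.
Proof. by case: x y => [a b] [c d]. Qed.

Lemma ReJ x : Re (conjc x) = Re x.
Proof. by case: x. Qed.

Lemma ImJ x : Im (conjc x) = - Im x.
Proof. by case: x. Qed.

Definition ReImE := (ReD, ImD, ReN, ImN, ReM, ImM, ReJ, ImJ).

Lemma Re_sum (I : Type) (r : seq I) (P : pred I) (F : I -> R[i]) :
  Re (\sum_(i <- r | P i) F i) = \sum_(i <- r | P i) Re (F i).
Proof. exact: (big_morph Re ReD). Qed.

Lemma Im_sum (I : Type) (r : seq I) (P : pred I) (F : I -> R[i]) :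
  Im (\sum_(i <- r | P i) F i) = \sum_(i <- r | P i) Im (F i).
Proof. exact: (big_morph Im ImD). Qed.

Lemma ReRM r x : Re (r%:C * x) = r * Re x.
Proof. by rewrite ReM /= mul0r subr0. Qed.

Lemma ImRM r x : Im (r%:C * x) = r * Im x.
Proof. by rewrite ImM /= mul0r addr0. Qed.

(** The squared modulus as an element of [R]; the norm on [R[i]] itself takes values in [R[i]]. *)
Definition sqnc x : R := Re x ^+ 2 + Im x ^+ 2.

Lemma sqncE x : (sqnc x)%:C = x * conjc x.
Proof. by apply: complex_ext; rewrite !ReImE /= /sqnc; ring. Qed.

Lemma sqnc_ge0 x : 0 <= sqnc x.
Proof. by rewrite addr_ge0 ?sqr_ge0. Qed.

Lemma sqncM x y : sqnc (x * y) = sqnc x * sqnc y.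
Proof. by rewrite /sqnc !ReImE; ring. Qed.

Lemma sqnc_eq0 x : (sqnc x == 0) = (x == 0).
Proof.
by rewrite /sqnc paddr_eq0 ?sqr_ge0// !sqrf_eq0 eq_complex.
Qed.

Lemma sqnc_gt0 x : (0 < sqnc x) = (x != 0).
Proof. by rewrite lt_def sqnc_eq0 sqnc_ge0 andbT. Qed.

Lemma normc_sqnc x : `|x| = (Num.sqrt (sqnc x))%:C.
Proof. by rewrite normc_def. Qed.

Lemma normc_ge_Im x : `|Im x|%:C <= `|x|.
Proof.
have := normc_ge_Re (x * 'i%C); rewrite normrM ReM /= !(mulr0,mulr1,sub0r) normrN.
by rewrite (_ : `|'i%C| = 1) ?mulr1// normc_sqnc /sqnc/= expr0n/= add0r expr1n sqrtr1.
Qed.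

Lemma continuous_Re : continuous (Re : R[i] -> R).
Proof.
move=> x; apply/(@cvgrPdist_lt _ _ _ (nbhs x)) => e e0.
have : \forall y \near x, `|x - y| < e%:C.
  by apply/nbhs_ballP; exists e%:C => //=; rewrite ltcR.
apply: filterS => y xy; rewrite -ltcR; apply: le_lt_trans xy.
by rewrite -ReN -ReD normc_ge_Re.
Qed.

Lemma continuous_Im : continuous (Im : R[i] -> R).
Proof.
move=> x; apply/(@cvgrPdist_lt _ _ _ (nbhs x)) => e e0.
have : \forall y \near x, `|x - y| < e%:C.
  by apply/nbhs_ballP; exists e%:C => //=; rewrite ltcR.
apply: filterS => y xy; rewrite -ltcR; apply: le_lt_trans xy.
by rewrite -ImN -ImD normc_ge_Im.
Qed.

Lemma gt0_complexE (e : R[i]) : 0 < e -> e = (Re e)%:C /\ 0 < Re e.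
Proof. by case: e => a b; rewrite ltcE /= => /andP[/eqP-> ->]. Qed.

Lemma continuous_real_complex : continuous (real_complex R : R -> R[i]).
Proof.
move=> x; apply/(@cvgrPdist_lt _ _ _ (nbhs x)) => e /gt0_complexE[-> e0].
have : \forall y \near x, `|x - y| < Re e.
  by apply/nbhs_ballP; exists (Re e).
apply: filterS => y xy; rewrite -rmorphB normc_sqnc ltcR /sqnc /= expr0n/= addr0.
by rewrite sqrtr_sqr.
Qed.

Lemma cvg_complex (T : Type) (F : set_system T) {FF : Filter F} (f : T -> R[i])
    (l : R[i]) :
  Re (f t) @[t --> F] --> Re l -> Im (f t) @[t --> F] --> Im l ->
  f t @[t --> F] --> l.
Proof.
move=> fr fi; rewrite [X in _ --> X]complexE.
rewrite (_ : f = fun t => (Re (f t))%:C + 'i%C * (Im (f t))%:C); last first.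
  by apply/funext => t; rewrite -complexE.
have h (g : T -> R) (k : R) :
    g t @[t --> F] --> k -> (g t)%:C @[t --> F] --> k%:C.
  by move=> gk; exact: cvg_comp _ _ gk (@continuous_real_complex k).
by apply: cvgD; [exact: h|apply: cvgMl_tmp; exact: h].
Qed.



Lemma cvg_conjc (T : Type) (F : set_system T) {FF : Filter F} (f : T -> R[i])
    (l : R[i]) :
  f t @[t --> F] --> l -> conjc (f t) @[t --> F] --> conjc l.
Proof.
move=> fl; have fr := cvg_comp _ _ fl (@continuous_Re l).
have fi := cvg_comp _ _ fl (@continuous_Im l).
apply: cvg_complex; [rewrite ReJ; under eq_fun do rewrite ReJ|
  rewrite ImJ; under eq_fun do rewrite ImJ].
  exact: fr.
exact: cvgN.
Qed.

Lemma cvg_sqnc (T : Type) (F : set_system T) {FF : Filter F} (f : T -> R[i])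
    (l : R[i]) :
  f t @[t --> F] --> l -> sqnc (f t) @[t --> F] --> sqnc l.
Proof.
move=> fl; have fr := cvg_comp _ _ fl (@continuous_Re l).
have fi := cvg_comp _ _ fl (@continuous_Im l).
rewrite /sqnc expr2 [Im l ^+ 2]expr2; under eq_fun do rewrite expr2 [Im _ ^+ 2]expr2.
by apply: cvgD; apply: cvgM.
Qed.

Lemma cvg_row (T : Type) (F : set_system T) {FF : Filter F} m
    (f : T -> 'rV[R[i]]_m) (l : 'rV[R[i]]_m) :
  (forall i, f t 0 i @[t --> F] --> l 0 i) -> f t @[t --> F] --> l.
Proof.
move=> fl A [P lP PA]; rewrite /= /nbhs/=.
have : \forall t \near F, forall i, P 0 i (f t 0 i).
  apply: filter_forall => i; exact: (fl i _ (lP 0 i)).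
by apply: filterS => t ft; apply: PA => i j; rewrite ord1.
Qed.

End complex_numbers.

(** * Derivatives of real and complex functions of one real variable *)

Section real_curves.
Variable R : realType.
Implicit Types (a b c : R -> R[i]) (f g : R -> R) (x y t : R).
Local Notation Re := (@complex.Re R).
Local Notation Im := (@complex.Im R).

(** Componentwise, to match [ddir_vec], which differentiates real and imaginary parts separately. *)
Definition is_cderive (t : R) (c : R -> R[i]) (d : R[i]) : Prop :=
  is_derive t (1 : R) (fun s => Re (c s)) (Re d) /\
  is_derive t (1 : R) (fun s => Im (c s)) (Im d).

Lemma is_derive_ext t f g x : f =1 g -> is_derive t (1 : R) f x ->
  is_derive t (1 : R) g x.
Proof. by move=> /funext ->. Qed.

Lemma is_derive_val t f x y : is_derive t (1 : R) f x -> x = y ->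
  is_derive t (1 : R) f y.
Proof. by move=> + <-. Qed.

Lemma is_derive_uniq t f x y : is_derive t (1 : R) f x ->
  is_derive t (1 : R) f y -> x = y.
Proof. by move=> [_ <-] [_ <-]. Qed.

Lemma is_derive1E t f x : is_derive t (1 : R) f x -> derive1 f t = x.
Proof. by move=> [_ <-]; rewrite derive1E. Qed.

Lemma is_deriveMf t f g x y : is_derive t (1 : R) f x -> is_derive t (1 : R) g y ->
  is_derive t (1 : R) (fun s => f s * g s) (x * g t + f t * y).
Proof.
move=> fx gy; apply: (@is_derive_val _ _ _ _ (is_deriveM fx gy)).
by rewrite addrC; congr (_ + _); rewrite /GRing.scale /= mulrC.
Qed.

Lemma is_deriveDf t f g x y : is_derive t (1 : R) f x -> is_derive t (1 : R) g y ->
  is_derive t (1 : R) (fun s => f s + g s) (x + y).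
Proof. by move=> fx gy; exact: is_deriveD. Qed.

Lemma is_deriveBf t f g x y : is_derive t (1 : R) f x -> is_derive t (1 : R) g y ->
  is_derive t (1 : R) (fun s => f s - g s) (x - y).
Proof. by move=> fx gy; exact: is_deriveB. Qed.

Lemma is_deriveNf t f x : is_derive t (1 : R) f x ->
  is_derive t (1 : R) (fun s => - f s) (- x).
Proof. by move=> fx; exact: is_deriveN. Qed.

Lemma is_deriveCf t x : is_derive t (1 : R) (fun=> x) 0.
Proof. exact: is_derive_cst. Qed.

Lemma is_derive_idf t : is_derive t (1 : R) (fun s => s) 1.
Proof. exact: is_derive_id. Qed.

Lemma is_deriveVf t f x : f t != 0 -> is_derive t (1 : R) f x ->
  is_derive t (1 : R) (fun s => (f s)^-1) (- x / f t ^+ 2).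
Proof.
move=> f0 fx; apply: (@is_derive_val _ _ _ _ (is_deriveV f0 fx)).
by rewrite /GRing.scale /= mulNr mulrC mulNr.
Qed.

Lemma is_derive_sumf t (I : finType) (h : I -> R -> R) (dh : I -> R) :
  (forall i, is_derive t (1 : R) (h i) (dh i)) ->
  is_derive t (1 : R) (fun s => \sum_i h i s) (\sum_i dh i).
Proof.
move=> hd; elim: (index_enum I) => [|i r ih].
  rewrite big_nil; under [X in is_derive _ _ X]funext do rewrite big_nil.
  exact: is_deriveCf.
rewrite big_cons; under [X in is_derive _ _ X]funext do rewrite big_cons.
exact: is_deriveDf.
Qed.

Lemma is_derive_compf t f g x y : is_derive (g t) (1 : R) f x ->
  is_derive t (1 : R) g y -> is_derive t (1 : R) (fun s => f (g s)) (x * y).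
Proof. by move=> fx gy; exact: is_derive1_comp. Qed.

Lemma is_derive_lnf t f x : 0 < f t -> is_derive t (1 : R) f x ->
  is_derive t (1 : R) (fun s => ln (f s)) (x / f t).
Proof.
by move=> f0 fx; rewrite mulrC; apply: is_derive_compf => //; exact: is_derive1_ln.
Qed.

Lemma is_cderive_ext t a b (u : R[i]) :
  a =1 b -> is_cderive t a u -> is_cderive t b u.
Proof. by move=> /funext ->. Qed.

Lemma is_cderive_val t a (u v : R[i]) : is_cderive t a u -> u = v ->
  is_cderive t a v.
Proof. by move=> + <-. Qed.

Lemma is_cderive_uniq t a (u v : R[i]) : is_cderive t a u -> is_cderive t a v ->
  u = v.
Proof.
move=> [ur ui] [vr vi]; apply: complex_ext.
  exact: is_derive_uniq ur vr.
exact: is_derive_uniq ui vi.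
Qed.

Lemma is_cderiveC t (u : R[i]) : is_cderive t (fun=> u) 0.
Proof. by split; exact: is_deriveCf. Qed.

Lemma is_cderiveD t a b (u v : R[i]) : is_cderive t a u -> is_cderive t b v ->
  is_cderive t (fun s => a s + b s) (u + v).
Proof.
move=> [ur ui] [vr vi]; split; rewrite ReImE.
  by apply: is_derive_ext (is_deriveDf ur vr) => s; rewrite ReImE.
by apply: is_derive_ext (is_deriveDf ui vi) => s; rewrite ReImE.
Qed.

Lemma is_cderiveN t a (u : R[i]) : is_cderive t a u ->
  is_cderive t (fun s => - a s) (- u).
Proof.
move=> [ur ui]; split; rewrite ReImE.
  by apply: is_derive_ext (is_deriveNf ur) => s; rewrite ReImE.
by apply: is_derive_ext (is_deriveNf ui) => s; rewrite ReImE.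
Qed.

Lemma is_cderiveJ t a (u : R[i]) : is_cderive t a u ->
  is_cderive t (fun s => conjc (a s)) (conjc u).
Proof.
move=> [ur ui]; split; rewrite ReImE.
  by apply: is_derive_ext ur => s; rewrite ReImE.
by apply: is_derive_ext (is_deriveNf ui) => s; rewrite ReImE.
Qed.

Lemma is_cderiveM t a b (u v : R[i]) : is_cderive t a u -> is_cderive t b v ->
  is_cderive t (fun s => a s * b s) (u * b t + a t * v).
Proof.
move=> [ur ui] [vr vi]; split; rewrite !ReImE.
  apply: (@is_derive_val _ _ _ _ (is_derive_ext _
    (is_deriveBf (is_deriveMf ur vr) (is_deriveMf ui vi)))); last by ring.
  by move=> s; rewrite !ReImE.
apply: (@is_derive_val _ _ _ _ (is_derive_ext _
  (is_deriveDf (is_deriveMf ur vi) (is_deriveMf ui vr)))); last by ring.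
by move=> s; rewrite !ReImE.
Qed.

Lemma is_cderiveMl t a (u v : R[i]) : is_cderive t a u ->
  is_cderive t (fun s => v * a s) (v * u).
Proof.
move=> au; apply: (@is_cderive_val _ _ _ _ (is_cderiveM (is_cderiveC t v) au)).
by rewrite mul0r add0r.
Qed.

Lemma is_cderive_real t f x : is_derive t (1 : R) f x ->
  is_cderive t (fun s => (f s)%:C) x%:C.
Proof. by move=> fx; split => //=; exact: is_deriveCf. Qed.

Lemma is_cderive_sum t (I : finType) (h : I -> R -> R[i]) (dh : I -> R[i]) :
  (forall i, is_cderive t (h i) (dh i)) ->
  is_cderive t (fun s => \sum_i h i s) (\sum_i dh i).
Proof.
move=> hd; split.
  rewrite Re_sum; apply: is_derive_ext (is_derive_sumf (fun i => (hd i).1)) => s.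
  by rewrite Re_sum.
rewrite Im_sum; apply: is_derive_ext (is_derive_sumf (fun i => (hd i).2)) => s.
by rewrite Im_sum.
Qed.

Lemma is_cderive_sqnc t a (u : R[i]) : is_cderive t a u ->
  is_derive t (1 : R) (fun s => sqnc (a s)) (2 * Re (u * conjc (a t))).
Proof.
move=> [ur ui]; apply: (@is_derive_val _ _ _ _ (is_derive_ext _
  (is_deriveDf (is_deriveMf ur ur) (is_deriveMf ui ui)))).
  by move=> s; rewrite -!expr2.
by rewrite !ReImE; ring.
Qed.

(** Writing 1/z as conj z / |z|^2 reduces this to the product rule and the inverse of a real
    function. *)
Lemma is_cderiveV t a (u : R[i]) : a t != 0 -> is_cderive t a u ->
  is_cderive t (fun s => (a s)^-1) (- u / a t ^+ 2).
Proof.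
move=> a0 au.
have sq0 : sqnc (a t) != 0 by rewrite sqnc_eq0.
have invE (z : R[i]) : z^-1 = (sqnc z)^-1%:C * conjc z.
  have [->|z0] := eqVneq z 0; first by rewrite invr0 conjc0 mulr0.
  apply: (mulfI z0); rewrite divff// mulrCA -sqncE -rmorphM mulVf ?rmorph1//.
  by rewrite sqnc_eq0.
have h := is_cderiveM (is_cderive_real (@is_deriveVf _ (fun s => sqnc (a s)) _
  sq0 (is_cderive_sqnc au))) (is_cderiveJ au).
apply: (@is_cderive_val _ _ _ _ (is_cderive_ext _ h)); first by move=> s; rewrite invE.
have sE := sqncE (a t).
rewrite rmorphM rmorphN /= -[2 * _]/(2%:R * Re (u * conjc (a t))) rmorphM/=.
rewrite fmorphV rmorphXn/= sE !fmorphV/= sE.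
have -> : (2%:R : R)%:C * (Re (u * conjc (a t)))%:C = u * conjc (a t) + conjc u * a t.
  by rewrite -[_%:C]/(2%:R%:C) rmorph_nat -addcJ rmorphM /= conjcK.
have J0 : conjc (a t) != 0 by rewrite conjc_eq0.
by field; rewrite a0 J0.
Qed.

End real_curves.

(** * Homogeneous coordinates, charts and the quotient topology *)

Section projective_points.
Variables (R : realType) (n : nat).
Local Notation C := R[i].
Implicit Types (z : 'rV[C]_n.+1) (p : cproj R n) (w : 'rV[C]_n).

Lemma val_pline z : z != 0 -> val (pline z) = <[z]>%VS.
Proof. by move=> z0; rewrite /pline val_insubd dim_vline z0. Qed.

Lemma hcoord_neq0 p : hcoord p != 0.
Proof.
rewrite /hcoord vpick0; apply/eqP => p0.
by have := valP p; rewrite p0 dimv0.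
Qed.

Lemma hcoord_pline z : z != 0 -> exists2 l, l != 0 & hcoord (pline z) = l *: z.
Proof.
move=> z0; have := memv_pick (val (pline z)); rewrite {2}val_pline// => /vlineP[l hl].
exists l => //; apply: contraTneq (hcoord_neq0 (pline z)) => l0.
by rewrite /hcoord hl l0 scale0r eqxx.
Qed.

Lemma plineK p : pline (hcoord p) = p.
Proof.
apply: val_inj; rewrite val_pline ?hcoord_neq0//; apply/eqP.
rewrite eqEdim -memvE memv_pick /= dim_vline hcoord_neq0 /=.
by rewrite (eqP (valP p)).
Qed.

Lemma plineZ (l : C) z : l != 0 -> pline (l *: z) = pline z.
Proof.
move=> l0; have [->|z0] := eqVneq z 0; first by rewrite scaler0.
apply: val_inj; rewrite !val_pline ?scaler_eq0 ?negb_or ?l0//.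
apply/eqP; rewrite eqEdim !dim_vline scaler_eq0 negb_or l0 z0 /= andbT.
by rewrite -memvE memvZ ?memv_line.
Qed.

Lemma pline_eqP z z' : z != 0 -> z' != 0 -> pline z = pline z' ->
  exists2 l, l != 0 & z' = l *: z.
Proof.
move=> z0 z'0 /(congr1 val); rewrite !val_pline// => e.
have : z' \in <[z]>%VS by rewrite e memv_line.
move=> /vlineP[l zl]; exists l => //.
by apply: contraNneq z'0 => l0; rewrite zl l0 scale0r.
Qed.

(** The projection from C^(n+1) minus 0 is continuous and open: the saturation of an open set is the
    union of its preimages under the dilations by nonzero scalars. Limits at a point of projective
    space can therefore be computed on homogeneous coordinates. *)
Lemma nbhs_pline z (A : set (cproj R n)) : z != 0 ->
  nbhs (pline z) A <-> nbhs z (@pline R n @^-1` A).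
Proof.
move=> z0; split.
  rewrite nbhsE => -[B [oB Bz] BA].
  have : nbhs z [set z | z != 0 /\ B (pline z)] by apply: open_nbhs_nbhs; split.
  by apply: filterS => x [_ /BA].
move=> zA; rewrite nbhsE.
pose W : set 'rV[C]_n.+1 := interior (@pline R n @^-1` A) `&` [set x | x != 0].
have oW : open W by apply: openI; [exact: open_interior|exact: open_neq0].
exists (@pline R n @` W); last by move=> _ [x [/interior_subset /= Ax _] <-].
split; last by exists z => //; split.
suff : open [set x : 'rV[C]_n.+1 | x != 0 /\ (@pline R n @` W) (pline x)] by [].
rewrite (_ : [set _ | _] =
  \bigcup_(l in [set l : C | l != 0]) (fun x => l *: x) @^-1` W).
  apply: bigcup_open => l l0.
  apply: (open_comp _ oW) => x _; exact: scaler_continuous.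
apply/seteqP; split => x /=.
  move=> [x0 [y Wy yx]].
  have [l l0 yl] := pline_eqP x0 Wy.2 (esym yx); exists l; first exact: l0.
  by have := Wy; rewrite yl.
move=> [l l0 Wl]; split; last by exists (l *: x) => //; rewrite plineZ.
by case: Wl => _ /=; rewrite scaler_eq0 negb_or => /andP[].
Qed.

Lemma cvg_pline (T : Type) (F : set_system T) {FF : Filter F}
    (f : T -> 'rV[C]_n.+1) z : z != 0 ->
  f t @[t --> F] --> z -> pline (f t) @[t --> F] --> pline z.
Proof. by move=> z0 fz A /(nbhs_pline A z0); exact: fz. Qed.

Lemma cvg_at_pline (T : Type) (G : set_system T) (g : cproj R n -> T) z : z != 0 ->
  g (pline x) @[x --> z] --> G -> g p @[p --> pline z] --> G.
Proof. by move=> z0 gG A /gG gA; apply/nbhs_pline. Qed.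

Definition chart_vec (k : 'I_n.+1) w : 'rV[C]_n.+1 :=
  \row_j oapp (fun i => w 0 i) 1 (unlift k j).

Lemma chart_vec_lift k w i : chart_vec k w 0 (lift k i) = w 0 i.
Proof. by rewrite mxE liftK. Qed.

Lemma chart_vec_diag k w : chart_vec k w 0 k = 1.
Proof. by rewrite mxE unlift_none. Qed.

Lemma chart_vec_neq0 k w : chart_vec k w != 0.
Proof.
apply/eqP => /matrixP /(_ 0 k) /eqP.
by rewrite chart_vec_diag mxE oner_eq0.
Qed.

Lemma in_chart_pline k z : z != 0 -> in_chart k (pline z) <-> z 0 k != 0.
Proof.
move=> z0; rewrite /in_chart; have [l l0 ->] := hcoord_pline z0.
by rewrite mxE mulf_eq0 negb_or l0.
Qed.

Lemma affine_coord_pline k z : z != 0 ->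
  affine_coord k (pline z) = \row_i (z 0 (lift k i) / z 0 k).
Proof.
move=> z0; apply/rowP => i; rewrite !mxE; have [l l0 ->] := hcoord_pline z0.
by rewrite !mxE -mulf_div divff// mul1r.
Qed.

Lemma affine_chart_pline k z : z 0 k != 0 ->
  pline z = affine_chart k (\row_i (z 0 (lift k i) / z 0 k)).
Proof.
move=> zk; rewrite -(@plineZ (z 0 k)^-1) ?invr_neq0//; congr pline.
apply/rowP => j; rewrite !mxE; case: unliftP => [i|] -> /=.
  by rewrite mxE mulrC.
by rewrite mulVf.
Qed.

Lemma affine_coordK k p : in_chart k p -> affine_chart k (affine_coord k p) = p.
Proof. by move=> pk; rewrite -[RHS]plineK (affine_chart_pline pk). Qed.

Lemma row_neq0_ex z : z != 0 -> exists k, z 0 k != 0.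
Proof.
move=> /eqP z0; apply: contrapT => h; apply: z0; apply/rowP => k; rewrite mxE.
by apply/eqP; apply: contrapT => /negP zk; apply: h; exists k.
Qed.

Lemma in_chart_ex p : exists k, in_chart k p.
Proof. exact: row_neq0_ex (hcoord_neq0 p). Qed.

Lemma near_in_chart k p : in_chart k p -> \forall q \near p, in_chart k q.
Proof.
move=> pk; rewrite -[p]plineK; apply/nbhs_pline; first exact: hcoord_neq0.
have : \forall x \near hcoord p, (x : 'rV[C]_n.+1) 0 k != 0.
  have c : continuous (fun M : 'rV[C]_n.+1 => M 0 k) by exact: coord_continuous.
  have := cvgr_gt _ (cvg_sqnc (c (hcoord p))) _ (_ : 0 < sqnc (hcoord p 0 k)).
  rewrite sqnc_gt0 => /(_ (nbhs_filter _) (nbhs_filter _) pk).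
  by apply: filterS => x; rewrite sqnc_gt0.
apply: filterS => x xk; apply/in_chart_pline => //.
by apply: contraNneq xk => ->; rewrite mxE.
Qed.

(** A small positive multiple of [e], which is 1 exactly where the coordinate is zero, removes the
    zeros and leaves the other coordinates alone. Identities between continuous functions thus need
    a proof only on the free locus. *)
Lemma dense_coord_neq0 (U : set (cproj R n)) p : nbhs p U ->
  exists2 z : 'rV[C]_n.+1, (forall j, z 0 j != 0) & U (pline z).
Proof.
rewrite -{1}[p]plineK => /nbhs_pline Up.
pose e : 'rV[C]_n.+1 := \row_j (hcoord p 0 j == 0)%:R.
have c : hcoord p + (t : R)%:C *: e @[t --> (0 : R)] --> hcoord p + 0%:C *: e.
  apply: cvgD; first exact: cvg_cst.
  apply: cvgZr_tmp.
  exact: continuous_real_complex.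
rewrite scale0r addr0 in c.
have /c := Up (hcoord_neq0 p).
move=> /(@nbhs_ballP R)[r /= r0 rU].
exists (hcoord p + (r / 2)%:C *: e); last first.
  apply: rU; rewrite /ball /= sub0r normrN gtr0_norm ?divr_gt0//.
  by rewrite ltr_pdivrMr// ltr_pMr// ltr1n.
move=> j; rewrite !mxE; have [->|h] := eqVneq (hcoord p 0 j) 0.
  by rewrite add0r mulr1 fmorph_eq0 mulf_neq0 ?gt_eqF ?invr_gt0.
by rewrite mulr0 addr0.
Qed.

Lemma dense_continuous_eq (f g : cproj R n -> R) : continuous f -> continuous g ->
  (forall z : 'rV[C]_n.+1, (forall j, z 0 j != 0) -> f (pline z) = g (pline z)) ->
  f =1 g.
Proof.
move=> cf cg fg p; apply/eqP; rewrite -subr_eq0; apply: contrapT => /negP h.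
have c := cvgB (cf p) (cg p).
have /c := open_nbhs_nbhs (conj (@open_neq R 0) h).
move=> /dense_coord_neq0[z /fg e]; apply/negP; rewrite negbK; apply/eqP.
by rewrite -[LHS]/(f (pline z) - g (pline z)) e subrr.
Qed.

End projective_points.

(** * The Fubini-Study metric in homogeneous coordinates *)

Section hermitian_products.
Variables (R : realType) (n : nat).
Local Notation C := R[i].
Local Notation Re := (@complex.Re R).
Implicit Types (u v w : 'rV[C]_n) (a : C).

Lemma hdotDl u v w : hdot (u + v) w = hdot u w + hdot v w.
Proof.
by rewrite /hdot -big_split /=; apply: eq_bigr => i _; rewrite mxE mulrDl.
Qed.

Lemma hdotDr u v w : hdot w (u + v) = hdot w u + hdot w v.
Proof.
rewrite /hdot -big_split /=; apply: eq_bigr => i _.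
by rewrite mxE rmorphD mulrDr.
Qed.

Lemma hdotZl a u w : hdot (a *: u) w = a * hdot u w.
Proof. by rewrite /hdot mulr_sumr; apply: eq_bigr => i _; rewrite mxE mulrA. Qed.

Lemma hdotZr a u w : hdot w (a *: u) = conjc a * hdot w u.
Proof.
rewrite /hdot mulr_sumr; apply: eq_bigr => i _.
by rewrite mxE rmorphM/= mulrCA.
Qed.

Lemma hdotNl u w : hdot (- u) w = - hdot u w.
Proof. by rewrite -scaleN1r hdotZl mulN1r. Qed.

Lemma hdotC u v : hdot v u = conjc (hdot u v).
Proof.
rewrite /hdot rmorph_sum; apply: eq_bigr => i _.
by rewrite rmorphM/= conjcK mulrC.
Qed.

Definition sqnv u : R := \sum_i sqnc (u 0 i).

Lemma hdotxx u : hdot u u = (sqnv u)%:C.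
Proof. by rewrite /sqnv rmorph_sum; apply: eq_bigr => i _; rewrite /= sqncE. Qed.

Lemma sqnv_ge0 u : 0 <= sqnv u.
Proof. by apply: sumr_ge0 => i _; exact: sqnc_ge0. Qed.

Lemma sqnv_eq0 u : (sqnv u == 0) = (u == 0).
Proof.
rewrite psumr_eq0; last by move=> i _; exact: sqnc_ge0.
apply/allP/eqP => [h|-> i _]; last by rewrite mxE /= sqnc_eq0.
apply/rowP => i; rewrite mxE; apply/eqP; rewrite -sqnc_eq0.
exact: h (mem_index_enum i).
Qed.

Lemma hdotxx_neq0 u : u != 0 -> hdot u u != 0.
Proof. by move=> u0; rewrite hdotxx fmorph_eq0 sqnv_eq0. Qed.

(* Fubini-Study metric in homogeneous coordinates [z], for tangent vectors
   given by lifts [u], [v]. *)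
Definition hfs (c : R) (z u v : 'rV[C]_n) : R :=
  4 / c * Re ((hdot z z * hdot u v - hdot u z * hdot z v) / hdot z z ^+ 2).

(** The numerator <z,z><u,v> - <u,z><z,v> vanishes when u or v is a multiple of z, and under scaling
    by l it grows by |l|^4, as does <z,z>^2. Hence [hfs] depends only on the tangent vectors of
    projective space that u and v represent. *)
Lemma hfsZ c (l a b : C) z u v : z != 0 -> l != 0 ->
  hfs c (l *: z) (l *: u + a *: z) (l *: v + b *: z) = hfs c z u v.
Proof.
move=> z0 l0; congr (_ * Re _); have A0 := hdotxx_neq0 z0.
have l'0 : conjc l != 0 by rewrite conjc_eq0.
rewrite !(hdotDl, hdotDr, hdotZl, hdotZr).
by field; rewrite A0 l0 l'0.
Qed.

End hermitian_products.

Section charts_metric.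
Variables (R : realType) (n : nat).
Local Notation C := R[i].
Implicit Types (u v w : 'rV[C]_n) (z : 'rV[C]_n.+1) (k : 'I_n.+1).

(** The derivative of [chart_vec k] along [u]; the 0 stands where [chart_vec] is constantly 1. *)
Definition chart_dir k u : 'rV[C]_n.+1 :=
  \row_j oapp (fun i => u 0 i) 0 (unlift k j).

Lemma chart_dir_lift k u i : chart_dir k u 0 (lift k i) = u 0 i.
Proof. by rewrite mxE liftK. Qed.

Lemma chart_dir_diag k u : chart_dir k u 0 k = 0.
Proof. by rewrite mxE unlift_none. Qed.

Lemma hdot_lift k (z z' : 'rV[C]_n.+1) :
  hdot z z' = z 0 k * conjc (z' 0 k) +
    \sum_i z 0 (lift k i) * conjc (z' 0 (lift k i)).
Proof. by rewrite /hdot (bigD1_ord k). Qed.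

Lemma hdot_chart_vec k w v : hdot (chart_vec k w) (chart_vec k v) = 1 + hdot w v.
Proof.
rewrite (hdot_lift k) !chart_vec_diag conjc1 mulr1; congr (_ + _).
by apply: eq_bigr => i _; rewrite !chart_vec_lift.
Qed.

Lemma hdot_chart_dir_vec k u w : hdot (chart_dir k u) (chart_vec k w) = hdot u w.
Proof.
rewrite (hdot_lift k) chart_dir_diag mul0r add0r.
by apply: eq_bigr => i _; rewrite chart_vec_lift chart_dir_lift.
Qed.

Lemma hdot_chart_dir k u v : hdot (chart_dir k u) (chart_dir k v) = hdot u v.
Proof.
rewrite (hdot_lift k) chart_dir_diag mul0r add0r.
by apply: eq_bigr => i _; rewrite !chart_dir_lift.
Qed.

Lemma fs_metric_hfs c k w u v :
  fs_metric c w u v = hfs c (chart_vec k w) (chart_dir k u) (chart_dir k v).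
Proof.
rewrite /fs_metric /hfs hdot_chart_vec hdot_chart_dir hdot_chart_dir_vec.
by rewrite [hdot (chart_vec _ _) (chart_dir _ _)]hdotC hdot_chart_dir_vec -hdotC.
Qed.

(** [q] is the differential at z of the affine coordinates x_i / x_k, by the quotient rule. Its lift
    [chart_dir k (q x)] is x / z_k plus a multiple of z, so [hfsZ] applies. *)
Lemma fs_metric_quotient c k z (u v : 'rV[C]_n.+1) : z 0 k != 0 ->
  let q (x : 'rV[C]_n.+1) : 'rV[C]_n := \row_i
    (x 0 (lift k i) / z 0 k - z 0 (lift k i) * x 0 k / z 0 k ^+ 2) in
  fs_metric c (\row_i (z 0 (lift k i) / z 0 k)) (q u) (q v) = hfs c z u v.
Proof.
move=> zk q; have z0 : z != 0 by apply: contraNneq zk => ->; rewrite mxE.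
rewrite (fs_metric_hfs c k) -(@hfsZ _ _ c (z 0 k)^-1 (- (u 0 k / z 0 k ^+ 2))
  (- (v 0 k / z 0 k ^+ 2)) z u v) ?invr_neq0//.
have qE x : chart_dir k (q x) = (z 0 k)^-1 *: x + (- (x 0 k / z 0 k ^+ 2)) *: z.
  apply/rowP => j; rewrite !mxE; case: unliftP => [i|] -> /=.
    by rewrite mxE; field.
  by field.
rewrite !qE; congr hfs.
apply/rowP => j; rewrite !mxE; case: unliftP => [i|] -> /=.
  by rewrite mxE mulrC.
by rewrite mulVf.
Qed.

End charts_metric.

(** * Complex differentials along real lines, and holomorphic isometries given by lifts *)

Section holomorphic_curves.
Variable R : realType.
Local Notation C := R[i].
Local Notation Re := (@complex.Re R).
Local Notation Im := (@complex.Im R).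

Lemma cvg_real_complex_dnbhs : ((t : R)%:C @[t --> 0^'] --> (0 : C)^')%classic.
Proof.
move=> A /= [r /gt0_complexE[-> r0] rA]; exists (Re r) => // t tr t0.
apply: rA; last by rewrite fmorph_eq0.
have := tr; rewrite /= !sub0r !normrN normc_sqnc ltcR /sqnc/= expr0n addr0.
by rewrite sqrtr_sqr.
Qed.

(** The complex difference quotient is restricted to real increments. *)
Lemma differentiable_is_cderive m k (F : 'rV[C]_m -> 'rV[C]_k) z u i :
  differentiable F z ->
  is_cderive 0 (fun t : R => F (z + t%:C *: u) 0 i) ('d F z u 0 i).
Proof.
move=> dF; have dv : derivable F z u by exact: diff_derivable.
have h0 : h^-1 *: (F (h *: u + z) - F z) @[h --> 0^'] --> 'd F z u.
  by rewrite -deriveE//; exact: dv.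
have h1 := cvg_comp _ _ cvg_real_complex_dnbhs h0.
have h2 := cvg_comp _ _ h1 (@coord_continuous _ _ _ 0 i ('d F z u)).
have hr := cvg_comp _ _ h2 (@continuous_Re R _).
have hi := cvg_comp _ _ h2 (@continuous_Im R _).
have eR (r : R) (x : C) : Re (r%:C^-1 * x) = r^-1 * Re x by rewrite -fmorphV ReRM.
have eI (r : R) (x : C) : Im (r%:C^-1 * x) = r^-1 * Im x by rewrite -fmorphV ImRM.
split; apply: DeriveDef.
- apply/cvg_ex; exists (Re ('d F z u 0 i)); apply: cvg_trans hr.
  apply: near_eq_cvg; near=> t; rewrite /= !mxE eR ReD ReN.
  by rewrite scale0r addr0 [t%:A]mulr1 addr0 [_ + z]addrC.
- apply: cvg_lim => //; apply: cvg_trans hr.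
  apply: near_eq_cvg; near=> t; rewrite /= !mxE eR ReD ReN.
  by rewrite scale0r addr0 [t%:A]mulr1 addr0 [_ + z]addrC.
- apply/cvg_ex; exists (Im ('d F z u 0 i)); apply: cvg_trans hi.
  apply: near_eq_cvg; near=> t; rewrite /= !mxE eI ImD ImN.
  by rewrite scale0r addr0 [t%:A]mulr1 addr0 [_ + z]addrC.
- apply: cvg_lim => //; apply: cvg_trans hi.
  apply: near_eq_cvg; near=> t; rewrite /= !mxE eI ImD ImN.
  by rewrite scale0r addr0 [t%:A]mulr1 addr0 [_ + z]addrC.
Unshelve. all: by end_near. Qed.

Lemma differentiable_row m k (F : 'I_k -> 'rV[C]_m -> C) z :
  (forall i, differentiable (F i) z) ->
  differentiable (fun x => \row_i F i x : 'rV[C]_k) z.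
Proof.
move=> dF.
rewrite (_ : (fun x => _) = \sum_i (fun x => F i x *: (delta_mx 0 i : 'rV[C]_k))).
  by apply: differentiable_sum => i; exact: differentiableZl.
apply/funext => x; rewrite fct_sumE [LHS]row_sum_delta.
by apply: eq_bigr => i _; rewrite mxE.
Qed.

(** A holomorphic isometry can be checked on a nowhere zero lift to C^(n+1), without choosing charts
    in the target: in the chart j the coordinates are quotients Z_i / Z_j, whose differential is the
    map [q] of [fs_metric_quotient]. Both the unitary maps and the standard torification are treated
    this way. *)
Lemma holo_isometric_lift n (c : R) g (Z : 'rV[C]_n -> 'rV[C]_n.+1)
    (dZ : 'rV[C]_n -> 'rV[C]_n -> 'rV[C]_n.+1) :
  (forall z, Z z != 0) ->
  (forall z j, differentiable (fun x => Z x 0 j) z) ->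
  (forall z u j, is_cderive 0 (fun t : R => Z (z + t%:C *: u) 0 j) (dZ z u 0 j)) ->
  (forall z u v, hfs c (Z z) (dZ z u) (dZ z v) = g z u v) ->
  holo_isometric c g (fun z => pline (Z z)).
Proof.
move=> Z0 dif der iso; split.
  move=> z; apply: (@cvg_pline _ _ _ (nbhs z)) => //.
  apply: (@cvg_row _ _ (nbhs z)) => j.
  exact: differentiable_continuous (dif z j).
move=> j z /in_chart_pline - /(_ (Z0 z)) zj F.
have FE : F = fun x => \row_i (Z x 0 (lift j i) / Z x 0 j).
  by apply/funext => x; rewrite /F /= affine_coord_pline.
have dF : differentiable F z.
  rewrite FE; apply: differentiable_row => i.
  apply: differentiableM; first exact: dif.
  by apply: differentiableV => //; exact: dif.
split => // u v; rewrite -iso.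
have dFE x : 'd F z x = \row_i (dZ z x 0 (lift j i) / Z z 0 j -
    Z z 0 (lift j i) * dZ z x 0 j / Z z 0 j ^+ 2).
  apply/rowP => i; rewrite mxE.
  have h1 := differentiable_is_cderive x i dF.
  have zj' : Z (z + 0%:C *: x) 0 j != 0 by rewrite scale0r addr0.
  have h2 := is_cderiveM (der z x (lift j i))
    (@is_cderiveV _ _ (fun t : R => Z (z + t%:C *: x) 0 j) _ zj' (der z x j)).
  apply: (is_cderive_uniq h1); apply: is_cderive_val.
    by apply: is_cderive_ext h2 => t; rewrite FE mxE.
  by rewrite /= scale0r addr0 mulNr mulrN mulrA.
rewrite !dFE -(fs_metric_quotient c (dZ z u) (dZ z v) zj).
by rewrite FE.
Qed.

End holomorphic_curves.

(** * The unit circle *)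

Section circle.
Variable R : realType.
Local Notation C := R[i].
Local Notation Re := (@complex.Re R).
Local Notation Im := (@complex.Im R).

Definition cis (a : R) : C := cos a +i* sin a.

Lemma cis0 : cis 0 = 1.
Proof. by rewrite /cis cos0 sin0. Qed.

Lemma cisD a b : cis (a + b) = cis a * cis b.
Proof. by apply: complex_ext; rewrite ReImE /= ?cosD ?sinD; ring. Qed.

Lemma cisN a : cis (- a) = conjc (cis a).
Proof. by rewrite /cis cosN sinN. Qed.

Lemma sqnc_cis a : sqnc (cis a) = 1.
Proof. exact: cos2Dsin2. Qed.

Lemma cis_conj a : cis a * conjc (cis a) = 1.
Proof. by rewrite -sqncE sqnc_cis rmorph1. Qed.

Lemma cis_neq0 a : cis a != 0.
Proof. by rewrite -sqnc_eq0 sqnc_cis oner_eq0. Qed.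

Lemma cis_surj (z : C) : sqnc z = 1 -> exists a, z = cis a.
Proof.
case: z => x y; rewrite /sqnc /= => xy.
have y2 : y ^+ 2 = 1 - x ^+ 2 by rewrite -xy addrAC subrr add0r.
have xI : -1 <= x <= 1.
  have : x ^+ 2 <= 1 by rewrite -xy lerDl sqr_ge0.
  by move=> h; apply/andP; split; nra.
have cx : cos (acos x) = x by rewrite acosK// in_itv.
have [y0|y0] := leP 0 y.
  exists (acos x); rewrite /cis cx sin_acos// -y2 sqrtr_sqr ger0_norm//.
exists (- acos x); rewrite /cis cosN sinN cx sin_acos// -y2 sqrtr_sqr.
by rewrite ltr0_norm// opprK.
Qed.

Lemma cis_pi : cis pi = -1.
Proof. by apply: complex_ext; rewrite /= ?cospi ?sinpi ?oppr0. Qed.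

Lemma cis_int (k : int) : cis (2 * pi * k%:~R) = 1.
Proof.
have nat_case (m : nat) : cis (2 * pi * m%:R) = 1.
  elim: m => [|m ih]; first by rewrite mulr0 cis0.
  rewrite -[m.+1%:R]natr1 mulrDr mulr1 cisD ih mul1r mulr_natl.
  by rewrite /cis cos2pi sin2pi.
case: k => m; first exact: nat_case.
by rewrite NegzE mulrNz mulrN cisN -pmulrn nat_case conjc1.
Qed.

(** Subtracting a multiple of 2 pi leaves b in [0, 2 pi). On [0, pi] the cosine is injective, so b =
    0; beyond pi the sine cannot vanish. *)
Lemma cis_eq1 a : cis a = 1 -> exists k : int, a = 2 * pi * k%:~R.
Proof.
move=> a1; pose k : int := Num.floor (a / (2 * pi)).
have p0 : 0 < 2 * pi :> R by rewrite mulr_gt0 ?pi_gt0.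
have /andP[k1 k2] := floor_itv (a / (2 * pi)).
pose b := a - 2 * pi * k%:~R.
have b1 : cis b = 1 by rewrite cisD a1 cisN cis_int conjc1 mulr1.
exists k; apply/eqP; rewrite -subr_eq0 -/b; apply/eqP.
have b0 : 0 <= b by rewrite subr_ge0 mulrC -ler_pdivlMr.
have b2 : b < 2 * pi.
  move: k2; rewrite -/k intrD ltr_pdivrMr// /b => k2.
  by rewrite mulr1z in k2; lra.
case: b1 => cb sb.
have [bp|bp] := leP b pi.
  by apply: cos_inj; rewrite ?in_itv/= ?b0 ?lexx ?pi_ge0 ?cos0.
have : 0 < sin (2 * pi - b).
  by apply: sin_gt0_pi; rewrite subr_gt0 b2/= ltrBlDr mulr_natl mulr2n ltrD2l.
by rewrite mulr_natl addrC sinD2pi sinN sb oppr0 ltxx.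
Qed.

Lemma cvg_cis (T : Type) (F : set_system T) {FF : Filter F} (f : T -> R) (l : R) :
  f t @[t --> F] --> l -> cis (f t) @[t --> F] --> cis l.
Proof.
move=> fl; apply: cvg_complex.
  exact: cvg_comp _ _ fl (@continuous_cos R l).
exact: cvg_comp _ _ fl (@continuous_sin R l).
Qed.

End circle.

(** * Unitary maps act by isometries in the identity component *)

Section unitary_maps.
Variables (R : realType) (n : nat).
Local Notation C := R[i].
Implicit Types (V : 'M[C]_n.+1) (z : 'rV[C]_n.+1) (p : cproj R n).
Local Open Scope sesquilinear_scope.

Definition proj_map V p : cproj R n := pline (hcoord p *m V).

Lemma mulmx_neq0 V z : V \in unitmx -> z != 0 -> z *m V != 0.
Proof.
move=> Vu; apply: contraNneq => zV; rewrite -[z](mulmxK Vu) zV mul0mx.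
by [].
Qed.

Lemma proj_map_pline V z : z != 0 -> proj_map V (pline z) = pline (z *m V).
Proof.
move=> z0; rewrite /proj_map; have [l l0 ->] := hcoord_pline z0.
by rewrite -scalemxAl plineZ.
Qed.

Lemma proj_mapM V W p : V \in unitmx ->
  proj_map W (proj_map V p) = proj_map (V *m W) p.
Proof.
move=> Vu; rewrite {2}/proj_map proj_map_pline ?mulmx_neq0 ?hcoord_neq0//.
by rewrite -mulmxA.
Qed.

Lemma proj_map1 p : proj_map 1%:M p = p.
Proof. by rewrite /proj_map mulmx1 plineK. Qed.

Lemma proj_map_bij V : V \in unitmx -> bijective (proj_map V).
Proof.
move=> Vu; exists (proj_map (invmx V)) => p.
  by rewrite proj_mapM// mulmxV// proj_map1.
by rewrite proj_mapM ?unitmx_inv// mulVmx// proj_map1.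
Qed.

Lemma hdotE m (u v : 'rV[C]_m) : hdot u v = (u *m v ^t*) 0 0.
Proof. by rewrite !mxE; apply: eq_bigr => i _; rewrite !mxE. Qed.

Lemma hdot_unitary V (u v : 'rV[C]_n.+1) : V \is unitarymx ->
  hdot (u *m V) (v *m V) = hdot u v.
Proof.
move=> Vu; rewrite !hdotE trmx_mul map_mxM mulmxA -[u *m V *m _]mulmxA.
by rewrite (unitarymxP Vu) mulmx1.
Qed.

Lemma is_cderive_affine (t : R) (a b : C) :
  is_cderive t (fun s : R => a + s%:C * b) b.
Proof.
apply: (@is_cderive_val _ _ _ _ _ (is_cderiveD (is_cderiveC t a)
  (is_cderiveM (is_cderive_real (is_derive_idf t)) (is_cderiveC t b)))).
by rewrite mulr0 addr0 add0r rmorph1 mul1r.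
Qed.

Lemma chart_vecD (k : 'I_n.+1) (w u : 'rV[C]_n) (l : C) :
  chart_vec k (w + l *: u) = chart_vec k w + l *: chart_dir k u.
Proof.
apply/rowP => j; rewrite !mxE; case: unliftP => [i|] _ /=; first by rewrite !mxE.
by rewrite mulr0 addr0.
Qed.

Lemma differentiable_chart_vec (k j : 'I_n.+1) (w : 'rV[C]_n) :
  differentiable (fun x : 'rV[C]_n => chart_vec k x 0 j) w.
Proof.
case: (unliftP k j) => [i|] ->.
  rewrite (_ : (fun x => _) = fun x : 'rV[C]_n => x 0 i).
    exact: differentiable_coord.
  by apply/funext => x; rewrite chart_vec_lift.
rewrite (_ : (fun x => _) = cst 1); first exact: differentiable_cst.
by apply/funext => x; rewrite chart_vec_diag.
Qed.

(** The lift w -> [chart_vec k w *m V] is affine in w, and [hfs] is built from [hdot] alone, which V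
    preserves. *)
Lemma unitary_holo_isometry (c : R) V : V \is unitarymx ->
  holo_isometries (n := n) c (proj_map V).
Proof.
move=> Vu; split; first exact/proj_map_bij/unitarymx_unit.
move=> k.
rewrite (_ : proj_map V \o _ = fun w => pline (chart_vec k w *m V)); last first.
  by apply/funext => w; rewrite /= proj_map_pline ?chart_vec_neq0.
apply: (@holo_isometric_lift _ _ _ _ _ (fun _ u => chart_dir k u *m V)).
- by move=> w; rewrite mulmx_neq0 ?chart_vec_neq0// unitarymx_unit.
- move=> w j.
  rewrite (_ : (fun x => _) =
    \sum_l (fun x : 'rV[C]_n => chart_vec k x 0 l * V l j)); last first.
    by apply/funext => x; rewrite mxE fct_sumE.
  apply: differentiable_sum => l; apply: differentiableM.
    exact: differentiable_chart_vec.
  exact: differentiable_cst.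
- move=> w u j; apply: is_cderive_ext (is_cderive_affine _ _ _) => t.
  by rewrite chart_vecD mulmxDl -scalemxAl [RHS]mxE [X in _ = _ + X]mxE.
- move=> w u v; rewrite (fs_metric_hfs c k) /hfs.
  by rewrite !hdot_unitary.
Qed.

(** The representative whose coordinate j is 1. It varies continuously on the chart j, whereas
    [hcoord] is an arbitrary choice of representative. *)
Definition sec (j : 'I_n.+1) p : 'rV[C]_n.+1 := (hcoord p 0 j)^-1 *: hcoord p.

Lemma sec_pline j z : z != 0 -> sec j (pline z) = (z 0 j)^-1 *: z.
Proof.
move=> z0; rewrite /sec; have [l l0 ->] := hcoord_pline z0.
by rewrite mxE scalerA invfM mulrAC mulVf// mul1r.
Qed.

Lemma cvg_sec j p : in_chart j p -> sec j q @[q --> p] --> sec j p.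
Proof.
rewrite -[p]plineK; set z := hcoord p; have z0 : z != 0 := hcoord_neq0 p.
move=> /(in_chart_pline _ z0) zj; apply: cvg_at_pline => //.
rewrite sec_pline//.
have h : ((x : 'rV[C]_n.+1) 0 j)^-1 *: x @[x --> z] --> (z 0 j)^-1 *: z.
  apply: (@cvgZ _ _ _ (nbhs z)); last exact: cvg_id.
  by apply: (@cvgV _ _ (nbhs z)) => //; exact: coord_continuous.
apply: cvg_trans h; apply: (@near_eq_cvg _ _ (nbhs z)).
have : nbhs z [set x : 'rV[C]_n.+1 | x != 0].
  by apply: open_nbhs_nbhs; split => //; exact: open_neq0.
by apply: (@filterS _ (nbhs z)) => x x0; rewrite sec_pline.
Qed.

(** Joint continuity is what currying requires to produce a continuous path in the compact-open
    topology. *)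
Lemma continuous_proj_map_family (V : R -> 'M[C]_n.+1) :
  (forall t, V t \in unitmx) ->
  (forall i j, continuous (fun t => V t i j)) ->
  continuous (fun tp : R * cproj R n => proj_map (V tp.1) tp.2).
Proof.
move=> Vu cV [t p]; have [j pj] := in_chart_ex p.
have h : pline (sec j tp.2 *m V tp.1) @[tp --> (t, p)] -->
    pline (sec j p *m V t).
  apply: (@cvg_pline _ _ _ (nbhs (t, p))).
    rewrite mulmx_neq0// /sec scaler_eq0 negb_or hcoord_neq0 andbT.
    by rewrite invr_eq0.
  apply: (@cvg_row _ _ (nbhs (t, p))) => k.
  rewrite mxE; under eq_fun do rewrite mxE.
  apply: (@cvg_sumf _ _ _ (nbhs (t, p))) => l; apply: cvgM.
    have h1 : sec j tp.2 @[tp --> (t, p)] --> sec j p.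
      exact: cvg_comp _ _ cvg_snd (cvg_sec pj).
    exact: cvg_comp _ _ h1 (@coord_continuous _ _ _ 0 l (sec j p)).
  have h1 : tp.1 @[tp --> (t, p)] --> t by exact: cvg_fst.
  exact: (@cvg_comp _ _ _ fst (fun s => V s l k) _ _ _ h1 (cV l k t)).
have e q W : in_chart j q -> pline (sec j q *m W) = proj_map W q.
  by move=> qj; rewrite /sec -scalemxAl plineZ ?invr_eq0.
rewrite (e _ _ pj) in h.
apply: cvg_trans h; apply: (@near_eq_cvg _ _ (nbhs (t, p))).
have near_j : \forall tp \near (t, p), in_chart j (tp : R * cproj R n).2.
  exact: cvg_snd (near_in_chart pj).
by apply: (@filterS _ (nbhs (t, p))) near_j => -[s q] /= qj; rewrite e.
Qed.

Lemma diag_unitary (d : 'rV[C]_n.+1) :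
  (forall i, d 0 i * conjc (d 0 i) = 1) -> diag_mx d \is unitarymx.
Proof.
move=> h; apply/unitarymxP/matrixP => i j; rewrite mxE (bigD1 i)//= big1.
  rewrite !mxE eqxx mulr1n addr0 [j == i]eq_sym; case: eqVneq => [->|_] /=.
    by rewrite mulr1n h.
  by rewrite mulr0n rmorph0 mulr0.
by move=> l li; rewrite !mxE eq_sym (negbTE li) mulr0n mul0r.
Qed.

(** A unitary matrix is normal, hence V = Q^-1 diag(exp(i a_j)) Q with Q unitary and, by unitarity,
    eigenvalues on the circle. Multiplying the angles a_j by t gives the path. *)
Lemma unitary_path V : V \is unitarymx -> exists W : R -> 'M[C]_n.+1,
  [/\ forall t, W t \is unitarymx, W 0 = 1%:M, W 1 = V
    & forall i j, continuous (fun t => W t i j)].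
Proof.
move=> Vu; have Vu' := unitarymx_unit Vu.
have Vn : V \is normalmx.
  apply/normalmxP; rewrite (unitarymxP Vu) -(invmx_unitary Vu).
  by rewrite mulVmx.
have := orthomx_spectralP Vn; set Q := spectralmx V; set d := spectral_diag V => VE.
have Qu : Q \is unitarymx := spectral_unitarymx V.
have Qu' := unitarymx_unit Qu.
have QVu : invmx Q \is unitarymx by rewrite (invmx_unitary Qu) trmxC_unitary.
have Du : diag_mx d \is unitarymx.
  have -> : diag_mx d = Q *m V *m invmx Q.
    by rewrite [in RHS]VE !mulmxA mulmxV// mul1mx mulmxK.
  exact: mul_unitarymx (mul_unitarymx Qu Vu) QVu.
have d1 i : d 0 i * conjc (d 0 i) = 1.
  have := unitarymxP Du => /matrixP /(_ i i); rewrite !mxE (bigD1 i)//= big1.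
    by rewrite !mxE eqxx !mulr1n addr0.
  by move=> l li; rewrite !mxE eq_sym (negbTE li) mulr0n mul0r.
have /choice[a da] : forall i, exists a, d 0 i = cis a.
  move=> i; apply: cis_surj; apply: (@complexI R).
  by rewrite sqncE d1 rmorph1.
pose D (t : R) : 'rV[C]_n.+1 := \row_i cis (t * a i).
exists (fun t => invmx Q *m diag_mx (D t) *m Q); split.
- move=> t; have Dt : diag_mx (D t) \is unitarymx.
    by apply: diag_unitary => i; rewrite mxE cis_conj.
  exact: mul_unitarymx (mul_unitarymx QVu Dt) Qu.
- have -> : diag_mx (D 0) = 1%:M.
    rewrite -diag_const_mx; congr diag_mx; apply/rowP => i.
    by rewrite !mxE mul0r cis0.
  by rewrite mulmx1 (mulVmx Qu').
- rewrite [RHS]VE; have -> : D 1 = d by apply/rowP => i; rewrite mxE mul1r da.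
  by [].
- move=> i j t.
  rewrite (_ : (fun t => _) = fun t =>
    \sum_l (\sum_k invmx Q i k * (D t 0 k *+ (k == l))) * Q l j); last first.
    apply/funext => s; rewrite mxE; apply: eq_bigr => l _; congr (_ * _).
    by rewrite mxE; apply: eq_bigr => k _; rewrite mxE.
  apply: (@cvg_sumf _ _ _ (nbhs t)) => l; apply: cvgMr_tmp.
  apply: (@cvg_sumf _ _ _ (nbhs t)) => k; apply: cvgMl_tmp.
  have c : D s 0 k @[s --> t] --> D t 0 k.
    rewrite mxE; under eq_fun do rewrite mxE.
    apply: (@cvg_cis _ _ (nbhs t)); apply: cvgMr_tmp; exact: cvg_id.
  case: (k == l); rewrite ?mulr1n ?mulr0n.
    by under eq_fun do rewrite mulr1n.
  under eq_fun do rewrite mulr0n.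
  exact: cvg_cst.
Qed.

(** The image of the real line under the curried path is a connected set of isometries; it contains
    the identity at t = 0 and the given map at t = 1. *)
Lemma unitary_holo_isometries0 (c : R) V : V \is unitarymx ->
  holo_isometries0 (n := n) c (proj_map V).
Proof.
move=> Vu; have [W [Wu W0 W1 cW]] := unitary_path Vu.
pose f (tp : R * cproj R n) := proj_map (W tp.1) tp.2.
have cf : continuous f.
  by apply: continuous_proj_map_family => // t; exact: unitarymx_unit.
pose g (t : R) : {compact-open, cproj R n -> cproj R n} := fun p => f (t, p).
have cg : continuous g by exact: continuous_curry_fun cf.
exists (g @` setT); last by exists 1 => //; rewrite /g /f /= W1.
split.
- by exists 0 => //; apply/funext => p; rewrite /g /f /= W0 proj_map1.
- by move=> _ [t _ <-]; exact: (unitary_holo_isometry c (Wu t)).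
- apply: connected_continuous_connected; last exact: continuous_subspaceT.
  by apply/connected_intervalP => x y _ _ z _.
Qed.

End unitary_maps.

(** * Fisher metric of the family and its Hermitian form *)

Lemma derive_line (R : realType) (V : normedModType R) (f : V -> R) (a v : V) :
  'D_v f a = 'D_(1 : R) (fun s : R => f (a + s *: v)) 0.
Proof.
pose F := fun h : R => h^-1 *: (f (h *: v + a) - f a).
pose G := fun h : R => h^-1 *: (f (a + (h * 1 + 0) *: v) - f (a + 0 *: v)).
suff FG : F = G by rewrite -[LHS]/(lim (F @ 0^')) FG.
apply/funext => h; rewrite /F /G scale0r addr0 mulr1 addr0.
by rewrite [_ + a]addrC.
Qed.

Section exponential_family.
Variables (R : realType) (n : nat).
Local Notation C := R[i].
Implicit Types (th u v : 'rV[R]_n).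

(** The partition function, of which [psi] is the logarithm. *)
Definition psum th : R := 1 + \sum_i expR (th 0 i).

Lemma psum_gt0 th : 0 < psum th.
Proof. by rewrite ltr_pwDl ?sumr_ge0// => i _; exact: expR_ge0. Qed.

Lemma Fstat_lift (i j : 'I_n) : Fstat R i (lift ord_max j) = (j == i)%:R.
Proof. by rewrite /Fstat (inj_eq lift_inj). Qed.

Lemma Fstat_max (i : 'I_n) : Fstat R i ord_max = 0.
Proof. by rewrite /Fstat (negbTE (neq_lift _ _)). Qed.

Lemma sum_mul_delta (a : 'I_n -> R) (j : 'I_n) : \sum_i a i * (j == i)%:R = a j.
Proof.
rewrite (bigD1 j)//= eqxx mulr1 big1 ?addr0// => i ij.
by rewrite eq_sym (negbTE ij) mulr0.
Qed.

Lemma expR_psi th : expR (- psi th) = (psum th)^-1.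
Proof. by rewrite expRN /psi lnK// posrE psum_gt0. Qed.

Lemma ptheta_lift th i : ptheta th (lift ord_max i) = expR (th 0 i) / psum th.
Proof.
rewrite /ptheta expRD expR_psi; congr (expR _ / _).
by rewrite -[RHS](sum_mul_delta (fun i => th 0 i)); apply: eq_bigr => j _; rewrite Fstat_lift.
Qed.

Lemma ptheta_max th : ptheta th ord_max = (psum th)^-1.
Proof.
rewrite /ptheta expRD expR_psi big1 ?expR0 ?mul1r// => i _.
by rewrite Fstat_max mulr0.
Qed.

Lemma ptheta_gt0 th x : 0 < ptheta th x.
Proof. exact: expR_gt0. Qed.

Lemma sum_ptheta th : \sum_x ptheta th x = 1.
Proof.
rewrite (bigD1_ord ord_max)//= ptheta_max; under eq_bigr do rewrite ptheta_lift.
by rewrite -mulr_suml -{1}[_^-1]mul1r -mulrDl divff// gt_eqF ?psum_gt0.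
Qed.

Lemma is_derive_psi th v t :
  is_derive t (1 : R) (fun s => psi (th + s *: v))
    (\sum_i v 0 i * ptheta (th + t *: v) (lift ord_max i)).
Proof.
have dl i : is_derive t (1 : R) (fun s => (th + s *: v) 0 i) (v 0 i).
  apply: (@is_derive_val _ _ _ _ _ (is_derive_ext _ (is_deriveDf (is_deriveCf t (th 0 i))
    (is_deriveMf (is_derive_idf t) (is_deriveCf t (v 0 i)))))).
    by move=> s; rewrite !mxE.
  by rewrite add0r mul1r mulr0 addr0.
have de i : is_derive t (1 : R) (fun s => expR ((th + s *: v) 0 i))
    (expR ((th + t *: v) 0 i) * v 0 i).
  by apply: (@is_derive1_comp _ expR) => //; exact: is_derive_expR.
have ds := is_deriveDf (is_deriveCf t 1) (is_derive_sumf de).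
apply: (@is_derive_val _ _ _ _ _ (@is_derive_lnf _ t
  (fun s => psum (th + s *: v)) _ (psum_gt0 _) ds)).
rewrite add0r mulr_suml; apply: eq_bigr => i _; rewrite ptheta_lift.
by rewrite [_ * v 0 i]mulrC mulrA.
Qed.

Lemma is_derive_ptheta th v t x :
  is_derive t (1 : R) (fun s => ptheta (th + s *: v) x)
    (ptheta (th + t *: v) x * (\sum_i v 0 i * Fstat R i x -
      \sum_i v 0 i * ptheta (th + t *: v) (lift ord_max i))).
Proof.
have dl : is_derive t (1 : R) (fun s => \sum_i (th + s *: v) 0 i * Fstat R i x)
    (\sum_i v 0 i * Fstat R i x).
  apply: is_derive_sumf => i.
  apply: (@is_derive_val _ _ _ _ _ (is_derive_ext _
    (is_deriveDf (is_deriveCf t (th 0 i * Fstat R i x))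
    (is_deriveMf (is_derive_idf t) (is_deriveCf t (v 0 i * Fstat R i x)))))).
    by move=> s; rewrite !mxE mulrDl mulrA.
  by rewrite add0r mul1r mulr0 addr0.
have h := is_deriveBf dl (is_derive_psi th v t).
by apply: (@is_derive1_comp _ expR) => //; exact: is_derive_expR.
Qed.

Lemma scoreE th i x : score th i x = Fstat R i x - ptheta th (lift ord_max i).
Proof.
pose e : 'rV[R]_n := delta_mx 0 i.
have sE (a : 'I_n -> R) : \sum_j e 0 j * a j = a i.
  rewrite -[RHS](sum_mul_delta a); apply: eq_bigr => j _.
  by rewrite !mxE eqxx /= mulrC eq_sym.
have dl : is_derive (0 : R) (1 : R) (fun s => ln (ptheta (th + s *: e) x))
    (Fstat R i x - ptheta th (lift ord_max i)).
  have p0 := ptheta_gt0 (th + 0 *: e) x.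
  apply: (@is_derive_val _ _ _ _ _ (@is_derive_lnf _ 0
    (fun s => ptheta (th + s *: e) x) _ p0 (is_derive_ptheta th e 0 x))).
  by rewrite mulrAC divff ?gt_eqF// mul1r !sE scale0r addr0.
by case: dl => _ <-; rewrite /score derive_line.
Qed.

Lemma sum_Fstat i (a : 'I_n.+1 -> R) :
  \sum_x Fstat R i x * a x = a (lift ord_max i).
Proof.
rewrite (bigD1_ord ord_max)//= Fstat_max mul0r add0r.
rewrite -[RHS](sum_mul_delta (fun i => a (lift ord_max i)) i).
by apply: eq_bigr => j _; rewrite Fstat_lift mulrC eq_sym.
Qed.

(** The score is F_i minus its mean, so this is the covariance of the indicators F_i and F_j, whose
    product is F_i if i = j and 0 otherwise. *)
Lemma fisherE th i j : fisher th i j =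
  ptheta th (lift ord_max i) * (i == j)%:R -
  ptheta th (lift ord_max i) * ptheta th (lift ord_max j).
Proof.
rewrite /fisher /fin_expectation.
under eq_bigr do rewrite !scoreE.
set pi := ptheta th (lift ord_max i); set pj := ptheta th (lift ord_max j).
rewrite (eq_bigr (fun x => Fstat R i x * (Fstat R j x * ptheta th x) -
  pj * (Fstat R i x * ptheta th x) - pi * (Fstat R j x * ptheta th x) +
  pi * pj * ptheta th x)); last by move=> x _; ring.
rewrite !big_split /= !sumrN -!mulr_sumr sum_ptheta.
rewrite !sum_Fstat -/pi -/pj Fstat_lift.
by ring.
Qed.

Lemma fisher_form th u v : \sum_i \sum_j fisher th i j * (u 0 i * v 0 j) =
  \sum_i ptheta th (lift ord_max i) * (u 0 i * v 0 i) -
  (\sum_i ptheta th (lift ord_max i) * u 0 i) *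
  (\sum_i ptheta th (lift ord_max i) * v 0 i).
Proof.
rewrite mulr_suml -sumrB; apply: eq_bigr => i _.
rewrite (eq_bigr (fun j => ptheta th (lift ord_max i) * u 0 i * v 0 j * (i == j)%:R -
  ptheta th (lift ord_max i) * u 0 i * (ptheta th (lift ord_max j) * v 0 j))).
  by rewrite sumrB -mulr_sumr (sum_mul_delta (fun j => _ * v 0 j)) mulrA.
by move=> j _; rewrite fisherE; ring.
Qed.

(** The metric as the real part of a Hermitian covariance under p, the shape that [fs_metric_log]
    gives to the Fubini-Study metric with q in place of p. *)
Lemma dombrowski_metricE (z u v : 'rV[C]_n) : dombrowski_metric z u v =
  let p i := ptheta (re_vec z) (lift ord_max i) in
  complex.Re (\sum_i (p i)%:C * (u 0 i * conjc (v 0 i)) -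
    (\sum_i (p i)%:C * u 0 i) * (\sum_i (p i)%:C * conjc (v 0 i))).
Proof.
rewrite /dombrowski_metric.
rewrite (eq_bigr (fun i => \sum_j fisher (re_vec z) i j * (re_vec u 0 i * re_vec v 0 j)
 + \sum_j fisher (re_vec z) i j * (im_vec u 0 i * im_vec v 0 j))); last first.
  by move=> i _; rewrite -big_split /=; apply: eq_bigr => j _; rewrite mulrDr.
rewrite big_split /= !fisher_form ReD ReN ReM !Re_sum !Im_sum.
under [in RHS]eq_bigr do rewrite ReRM ReM ReJ ImJ.
under [X in _ - (X * _ - _)]eq_bigr do rewrite ReRM.
under [X in _ - (_ * X - _)]eq_bigr do rewrite ReRM ReJ.
under [X in _ - (_ - X * _)]eq_bigr do rewrite ImRM.
under [X in _ - (_ - _ * X)]eq_bigr do rewrite ImRM ImJ mulrN.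
rewrite [X in _ - (_ - _ * X)]sumrN.
rewrite [X in _ = X - _](eq_bigr (fun i => ptheta (re_vec z) (lift ord_max i) *
  (re_vec u 0 i * re_vec v 0 i) + ptheta (re_vec z) (lift ord_max i) *
  (im_vec u 0 i * im_vec v 0 i))); last by move=> i _; rewrite !mxE; ring.
rewrite big_split /=.
under [X in _ - X * _ + _]eq_bigr do rewrite mxE.
under [X in _ - _ * X + _]eq_bigr do rewrite mxE.
under [X in _ + (_ - X * _)]eq_bigr do rewrite mxE.
under [X in _ + (_ - _ * X)]eq_bigr do rewrite mxE.
by ring.
Qed.

(* For [w = exp zeta], [row_i a_i * w_i] is the image of the tangent vector [a]. *)
Lemma fs_metric_log (c : R) (w a b : 'rV[C]_n) :
  let q i := sqnc (w 0 i) / (1 + sqnv w) in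
  fs_metric c w (\row_i (a 0 i * w 0 i)) (\row_i (b 0 i * w 0 i)) =
  4 / c * complex.Re (\sum_i (q i)%:C * (a 0 i * conjc (b 0 i)) -
    (\sum_i (q i)%:C * a 0 i) * (\sum_i (q i)%:C * conjc (b 0 i))).
Proof.
move=> q; congr (_ * complex.Re _).
have P0 : 1 + sqnv w != 0 by rewrite gt_eqF// ltr_pwDl ?sqnv_ge0.
have [P PE] : exists P, P = (1 + sqnv w)%:C by eexists.
have PC0 : P != 0 by rewrite PE fmorph_eq0.
have qE i : (q i)%:C = P^-1 * (w 0 i * conjc (w 0 i)).
  by rewrite /q rmorphM fmorphV /= sqncE mulrC PE.
have e1 : hdot (\row_i (a 0 i * w 0 i)) (\row_i (b 0 i * w 0 i)) =
    P * \sum_i (q i)%:C * (a 0 i * conjc (b 0 i)).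
  rewrite mulr_sumr; apply: eq_bigr => i _; rewrite !mxE rmorphM qE /=.
  by field.
have e2 : hdot (\row_i (a 0 i * w 0 i)) w =
    P * \sum_i (q i)%:C * a 0 i.
  by rewrite mulr_sumr; apply: eq_bigr => i _; rewrite !mxE qE; field.
have e3 : hdot w (\row_i (b 0 i * w 0 i)) =
    P * \sum_i (q i)%:C * conjc (b 0 i).
  by rewrite mulr_sumr; apply: eq_bigr => i _; rewrite !mxE rmorphM qE /=; field.
have hP : 1 + hdot w w = P by rewrite PE hdotxx rmorphD rmorph1.
rewrite hP e1 e2 e3.
by field.
Qed.

End exponential_family.

(** * The complex exponential is holomorphic *)

Section complex_exponential.
Variable R : realType.
Local Notation C := R[i].
Local Notation Re := (@complex.Re R).
Local Notation Im := (@complex.Im R).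
Implicit Types z : C.

Definition cexp z : C := (expR (Re z))%:C * cis (Im z).

Lemma cexpD z z' : cexp (z + z') = cexp z * cexp z'.
Proof. by rewrite /cexp ReD ImD expRD cisD rmorphM; ring. Qed.

Lemma cexp_imag (a : R) : cexp (0 +i* a) = cis a.
Proof. by rewrite /cexp /= expR0 mul1r. Qed.

Lemma cexp_neq0 z : cexp z != 0.
Proof. by rewrite mulf_neq0 ?cis_neq0// fmorph_eq0 gt_eqF ?expR_gt0. Qed.

Lemma sqnc_cexp z : sqnc (cexp z) = expR (2 * Re z).
Proof.
rewrite sqncM sqnc_cis mulr1 /sqnc /= expr0n addr0 expr2 -expRD.
by rewrite -mulr2n mulr_natl.
Qed.

Lemma cexp_surj (c : C) : c != 0 -> exists z, cexp z = c.
Proof.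
move=> c0; pose r := Num.sqrt (sqnc c).
have r0 : 0 < r by rewrite sqrtr_gt0 sqnc_gt0.
have [|a ca] := @cis_surj R (r^-1%:C * c).
  rewrite sqncM {1}/sqnc /= expr0n addr0 exprVn sqr_sqrtr ?sqnc_ge0//.
  by rewrite mulVf ?sqnc_eq0.
exists (ln r +i* a); rewrite /cexp /= lnK// -ca mulrA -rmorphM divff ?mul1r//.
by rewrite gt_eqF.
Qed.

Lemma cexp_eqP z z' : cexp z = cexp z' ->
  exists k : int, z' = z + (0 +i* (2 * pi * k%:~R)).
Proof.
move=> e; have er : Re z' = Re z.
  have := congr1 (@sqnc R) e; rewrite !sqnc_cexp => /expR_inj.
  by move=> /mulfI -> //; rewrite pnatr_eq0.
have : cis (Im z' - Im z) = 1.
  have e0 : (expR (Re z))%:C != 0 by rewrite fmorph_eq0 gt_eqF ?expR_gt0.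
  have := e; rewrite /cexp er => /(mulfI e0) ez.
  by rewrite cisD cisN -ez cis_conj.
move=> /cis_eq1[k ke]; exists k; apply: complex_ext; rewrite ?ReD ?ImD /=.
  by rewrite addr0.
by rewrite -ke addrC subrK.
Qed.

Lemma is_derive_cisf (t : R) (f : R -> R) (x : R) : is_derive t (1 : R) f x ->
  is_cderive t (fun s => cis (f s)) ((0 +i* x) * cis (f t)).
Proof.
move=> fx; split; rewrite !ReImE /=.
  apply: (@is_derive_val _ _ _ _ _ (is_derive_compf (is_derive_cos _) fx)).
  by ring.
apply: (@is_derive_val _ _ _ _ _ (is_derive_compf (is_derive_sin _) fx)).
by ring.
Qed.

Lemma is_cderive_cexp (t : R) (a : R -> C) (u : C) : is_cderive t a u ->
  is_cderive t (fun s => cexp (a s)) (u * cexp (a t)).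
Proof.
move=> [ur ui]; have h := is_cderiveM
  (is_cderive_real (is_derive_compf (is_derive_expR _) ur)) (is_derive_cisf ui).
apply: (is_cderive_val h); rewrite /cexp rmorphM /=.
by rewrite [u in RHS]complexE; apply: complex_ext; rewrite !ReImE /=; ring.
Qed.

(** The slope functions of exp, cos and sin at 0 give exp h - 1 - h = (Re h) P(h) + (Im h) Q(h) with
    P and Q tending to 0. Dividing by h keeps both terms small, since |Re h| and |Im h| are at most
    |h|. *)
Lemma cexp_quotient : h^-1 * (cexp h - 1) @[h --> (0 : C)^'] --> (1 : C).
Proof.
have [gA [gAE gAc gA0]] := (is_derive1_caratheodory (@expR R) 0 (expR 0)).1
  (is_derive_expR 0).
have [gC [gCE gCc gC0]] := (is_derive1_caratheodory (@cos R) 0 (- sin 0)).1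
  (is_derive_cos 0).
have [gS [gSE gSc gS0]] := (is_derive1_caratheodory (@sin R) 0 (cos 0)).1
  (is_derive_sin 0).
pose P (h : C) : C := (gA (Re h))%:C * cis (Im h) - 1.
pose Q (h : C) : C := (gC (Im h) +i* gS (Im h)) - 'i%C.
have e h : cexp h - 1 - h = (Re h)%:C * P h + (Im h)%:C * Q h.
  have := gAE (Re h); rewrite expR0 subr0 => /eqP; rewrite subr_eq => /eqP eA.
  have := gCE (Im h); rewrite cos0 subr0 => /eqP; rewrite subr_eq => /eqP eC.
  have := gSE (Im h); rewrite sin0 !subr0 => eS.
  have eci : cis (Im h) = 1 + (Im h)%:C * (gC (Im h) +i* gS (Im h)).
    by apply: complex_ext; rewrite !ReImE /= ?eC ?eS; ring.
  rewrite /cexp eA rmorphD rmorphM /= mulrDl rmorph1 mul1r {2}eci /P /Q.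
  by move: (complexE h); move: (Re h) (Im h) => a b ->; ring.
have [F [FF FE idF]] : exists F : set_system C,
    [/\ Filter F, (0 : C)^' = F & (id : C -> C) h @[h --> F] --> (0 : C)].
  by exists (0 : C)^'; split => //; [exact: dnbhs_filter|exact: cvg_within].
have hr := cvg_comp _ _ idF (@continuous_Re R 0).
have hi := cvg_comp _ _ idF (@continuous_Im R 0).
have cP : P h @[h --> F] --> (0 : C).
  have P0 : P 0 = 0 by rewrite /P /= gA0 expR0 cis0 mulr1 subrr.
  rewrite -[X in _ --> X]P0 /P; apply: cvgB; last exact: cvg_cst.
  apply: cvgM; last exact: cvg_cis.
  exact: cvg_comp _ _ (cvg_comp _ _ hr gAc) (@continuous_real_complex R _).
have cQ : Q h @[h --> F] --> (0 : C).
  have Q0 : Q 0 = 0 by rewrite /Q /= gC0 gS0 sin0 cos0 oppr0 subrr.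
  rewrite -[X in _ --> X]Q0 /Q; apply: cvgB; last exact: cvg_cst.
  by apply: cvg_complex => /=; [exact: cvg_comp _ _ hi gCc|exact: cvg_comp _ _ hi gSc].
have neq0 : \forall h \near F, h != 0 by rewrite -FE; exact: nbhs_dnbhs_neq.
rewrite FE; apply/cvgrPdist_lt => eps eps0.
have eps20 : 0 < eps / 2 by rewrite divr_gt0.
have nP : \forall h \near F, `|P h| < eps / 2 by apply: cvgr0_norm_lt eps20.
have nQ : \forall h \near F, `|Q h| < eps / 2 by apply: cvgr0_norm_lt eps20.
near=> h.
have h0 : h != 0 by near: h.
have -> : 1 - h^-1 * (cexp h - 1) = - (((Re h)%:C / h) * P h + ((Im h)%:C / h) * Q h).
  transitivity (- (h^-1 * (cexp h - 1 - h))); last by rewrite e; ring.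
  by field.
rewrite normrN; apply: le_lt_trans (ler_normD _ _) _.
rewrite !normrM !normfV [eps]splitr.
have le1 (x : R) (y p : C) : `|x|%:C <= `|y| -> y != 0 ->
    `|x%:C| / `|y| * `|p| <= `|p|.
  move=> xy y0; rewrite ler_piMl// ler_pdivrMr ?normr_gt0// mul1r.
  by rewrite normc_sqnc /sqnc /= expr0n addr0 sqrtr_sqr.
apply: ltrD.
  apply: le_lt_trans (le1 _ _ _ (normc_ge_Re h) h0) _.
  by near: h.
apply: le_lt_trans (le1 _ _ _ (normc_ge_Im h) h0) _.
by near: h.
Unshelve. all: by end_near. Qed.

Lemma differentiable_cexp z : differentiable cexp z.
Proof.
apply/derivable1_diffP/cvg_ex; exists (cexp z * 1).
have hM : cexp z * (h^-1 * (cexp h - 1)) @[h --> (0 : C)^'] --> cexp z * 1.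
  by apply: cvgM; [exact: cvg_cst|exact: cexp_quotient].
apply: cvg_trans hM; apply: near_eq_cvg; near=> h.
rewrite /= [h%:A]mulr1 cexpD /GRing.scale /=.
by ring.
Unshelve. all: by end_near. Qed.

End complex_exponential.

(** * The standard projection is a natural extension *)

Section standard_torification.
Variables (R : realType) (n : nat).
Local Notation C := R[i].
Implicit Types (z u v : 'rV[C]_n) (Z : 'rV[C]_n.+1) (p : cproj R n).

Lemma cvg_ptws (T : Type) (F : set_system T) {FF : Filter F} (I : Type)
    (f : T -> {ptws I -> R}) (l : {ptws I -> R}) :
  (forall i, f t i @[t --> F] --> l i) -> f t @[t --> F] --> l.
Proof.
move=> fl; apply/cvg_sup => i A; rewrite nbhsE => -[B [[W oW <-] Wl] BA].
have : F [set t | W (f t i)] by apply: (fl i); exact: open_nbhs_nbhs.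
suff WA : F [set t | W (f t i)] -> F [set t | A (f t)] by [].
by apply: filterS => t Wt; exact: BA.
Qed.

Lemma torus_act_pline (t : 'rV[R]_n) Z : Z != 0 -> torus_act t (pline Z) =
  pline (\row_j (oapp (fun i => cis (2 * pi * t 0 i)) 1 (unlift ord_max j) *
    Z 0 j)).
Proof.
move=> Z0; rewrite /torus_act; have [l l0 ->] := hcoord_pline Z0.
rewrite -[RHS](@plineZ _ _ l)//; congr pline; apply/rowP => j.
by rewrite !mxE mulrCA.
Qed.

Lemma torus_row_neq0 (t : 'rV[R]_n) Z : Z != 0 ->
  \row_j (oapp (fun i => cis (2 * pi * t 0 i)) 1 (unlift ord_max j) * Z 0 j) != 0
    :> 'rV[C]_n.+1.
Proof.
move=> /row_neq0_ex[k zk]; apply/eqP => /rowP /(_ k); rewrite !mxE => /eqP.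
rewrite mulf_eq0 (negbTE zk) orbF; case: unliftP => [i|] _ /=.
  by rewrite (negbTE (cis_neq0 _)).
by rewrite oner_eq0.
Qed.

(** Where a coordinate vanishes, some half turn is a nontrivial stabiliser. Where none does, a fixed
    line has its scalar determined by the last coordinate, on which the torus acts trivially, so all
    rotation factors are 1. *)
Lemma free_locusP Z : Z != 0 ->
  free_locus (pline Z) <-> (forall j, Z 0 j != 0).
Proof.
move=> Z0; split.
  move=> fr j; apply/negP => /eqP Zj.
  have half_int (t : 'rV[R]_n) i : t 0 i = 2^-1 ->
      torus_act t (pline Z) = pline Z -> False.
    move=> ti /fr[k /rowP /(_ i)]; rewrite ti mxE => /(congr1 ( *%R 2)).
    rewrite divff// => /eqP.
    rewrite -[2]/(2%:~R) -intrM -[1]/(1%:~R) eqr_int => /eqP /(congr1 (fun x => (x %% 2)%Z)).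
    by rewrite mulrC modzMl.
  case: (unliftP ord_max j) => [i ji|jm].
    (* A half turn in the coordinate j alone does nothing, this coordinate being zero. *)
    apply: (half_int (2^-1 *: delta_mx 0 i) i); first by rewrite !mxE !eqxx mulr1.
    rewrite torus_act_pline//; congr pline; apply/rowP => l; rewrite !mxE.
    case: unliftP => [i'|] li /=; last by rewrite mul1r.
    rewrite !mxE eqxx /=; case: eqVneq => [ii'|_] /=.
      by rewrite li ii' -ji Zj mulr0.
    by rewrite !mulr0 cis0 mul1r.
  have [k Zk] := row_neq0_ex Z0.
  have [i ki] : exists i, k = lift ord_max i.
    case: (unliftP ord_max k) => [i ->|km]; first by exists i.
    by move: Zk; rewrite km -jm Zj eqxx.
  (* Half turns in all coordinates but the last amount to the scalar -1, as the last coordinate is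
     zero. The nonzero coordinate k was needed to have an index i at all: there is none if n = 0. *)
  apply: (half_int (const_mx 2^-1) i); first by rewrite mxE.
  rewrite torus_act_pline// -[RHS](@plineZ _ _ (-1)) ?oppr_eq0 ?oner_eq0//.
  congr pline; apply/rowP => l; rewrite !mxE.
  case: unliftP => [i'|] li /=.
    by rewrite mxE mulrAC divff// mul1r cis_pi.
  by rewrite li -jm Zj !mulr0.
move=> Zj t; rewrite torus_act_pline// => /esym h.
have [l l0 /rowP hl] := pline_eqP Z0 (torus_row_neq0 t Z0) h.
have l1 : l = 1.
  have := hl ord_max; rewrite !mxE unlift_none /= => /(mulIf (Zj _)) <-.
  by [].
have /choice[k tk] : forall i, exists k : int, t 0 i = k%:~R.
  move=> i; have := hl (lift ord_max i); rewrite !mxE liftK /= l1.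
  move=> /(mulIf (Zj _)) /cis_eq1[k /mulfI tk]; exists k; apply: tk.
  by rewrite mulf_neq0 ?gt_eqF ?pi_gt0.
by exists (\row_i k i); apply/rowP => i; rewrite tk !mxE.
Qed.

(** Halving z gives |w_i|^2 = exp(Re z_i), so that the normalised squared moduli are p_theta. The
    same 1/2, squared, cancels the constant 4 of [fs_metric 1]. *)
Definition std_lift z : 'rV[C]_n.+1 := chart_vec ord_max (\row_i cexp (z 0 i / 2)).

Definition std_torif z : cproj R n := pline (std_lift z).

(** The function exp(z / 2) has period 4 pi i. *)
Definition std_frame : 'M[R]_n := (4 * pi) *: 1%:M.

(** The standard moment map of the torus action, with values in the simplex; by [std_ext_pline] any
    homogeneous coordinates may replace [hcoord]. *)
Definition std_ext p : {ptws 'I_n.+1 -> R} :=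
  fun x => sqnc (hcoord p 0 x) / sqnv (hcoord p).

Lemma std_ext_pline Z x : Z != 0 -> std_ext (pline Z) x = sqnc (Z 0 x) / sqnv Z.
Proof.
move=> Z0; rewrite /std_ext; have [l l0 ->] := hcoord_pline Z0.
have -> : sqnv (l *: Z) = sqnc l * sqnv Z.
  by rewrite /sqnv mulr_sumr; apply: eq_bigr => i _; rewrite mxE sqncM.
by rewrite mxE sqncM -mulf_div divff ?mul1r// sqnc_eq0.
Qed.

Lemma sqnc_std_lift z i :
  sqnc (std_lift z 0 (lift ord_max i)) = expR (re_vec z 0 i).
Proof.
rewrite chart_vec_lift !mxE sqnc_cexp; congr expR.
have -> : z 0 i / 2 = (2^-1)%:C * z 0 i by rewrite fmorphV rmorph_nat mulrC.
by rewrite ReRM mulrA divff// mul1r.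
Qed.

Lemma sqnv_std_lift z : sqnv (std_lift z) = psum (re_vec z).
Proof.
rewrite /sqnv (bigD1_ord ord_max)//= chart_vec_diag /psum.
congr (_ + _); first by rewrite /sqnc /= expr0n addr0 expr1n.
by apply: eq_bigr => i _; rewrite sqnc_std_lift.
Qed.

Lemma std_ext_torif z : std_ext (std_torif z) = ptheta (re_vec z).
Proof.
apply/funext => x; rewrite std_ext_pline ?chart_vec_neq0// sqnv_std_lift.
case: (unliftP ord_max x) => [i|] ->; first by rewrite sqnc_std_lift ptheta_lift.
by rewrite chart_vec_diag ptheta_max /sqnc /= expr0n addr0 expr1n mul1r.
Qed.

Lemma continuous_std_ext x : continuous (fun p => std_ext p x).
Proof.
move=> p; rewrite -[p]plineK; have h0 := hcoord_neq0 p.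
apply: cvg_at_pline => //; rewrite std_ext_pline//.
have co i : (Z : 'rV[C]_n.+1) 0 i @[Z --> hcoord p] --> hcoord p 0 i.
  exact: coord_continuous.
have h : sqnc ((Z : 'rV[C]_n.+1) 0 x) / sqnv Z @[Z --> hcoord p] -->
    sqnc (hcoord p 0 x) / sqnv (hcoord p).
  apply: (@cvgM _ _ (nbhs (hcoord p))).
    by apply: (@cvg_sqnc _ _ (nbhs (hcoord p))).
  apply: (@cvgV _ _ (nbhs (hcoord p))); first by rewrite sqnv_eq0.
  apply: (@cvg_sumf _ _ _ (nbhs (hcoord p))) => i.
  by apply: (@cvg_sqnc _ _ (nbhs (hcoord p))).
apply: cvg_trans h; apply: (@near_eq_cvg _ _ (nbhs (hcoord p))).
have : nbhs (hcoord p) [set Z : 'rV[C]_n.+1 | Z != 0].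
  by apply: open_nbhs_nbhs; split => //; exact: open_neq0.
by apply: (@filterS _ (nbhs (hcoord p))) => Z Z0; rewrite std_ext_pline.
Qed.

Lemma std_torif_onto : range std_torif = @free_locus R n.
Proof.
apply/seteqP; split => [_ [z _ <-]|p].
  apply/free_locusP => [|j]; first exact: chart_vec_neq0.
  case: (unliftP ord_max j) => [i|] ->; last by rewrite chart_vec_diag oner_eq0.
  by rewrite chart_vec_lift mxE cexp_neq0.
rewrite -[p]plineK => /(free_locusP (hcoord_neq0 p)) h.
rewrite (affine_chart_pline (h ord_max)).
have /choice[a ha] : forall i, exists a,
    cexp a = hcoord p 0 (lift ord_max i) / hcoord p 0 ord_max.
  by move=> i; apply: cexp_surj; rewrite mulf_neq0 ?invr_eq0.
exists (\row_i (2 * a i)) => //; congr (pline (chart_vec _ _)); apply/rowP => i.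
by rewrite !mxE mulrAC divff// mul1r ha.
Qed.

Lemma translate_std (t : 'rV[R]_n) z i :
  translate std_frame t z 0 i = z 0 i + (0 +i* (4 * pi * t 0 i)).
Proof. by rewrite /translate /std_frame -scalemxAr mulmx1 !mxE. Qed.

(** The derivative of w_i = exp(z_i / 2) along u is (u_i / 2) w_i, which is the form of tangent
    vector that [fs_metric_log] expects; the two covariances then agree because q = p_theta. *)
Lemma std_holo_isometric :
  holo_isometric 1 (@dombrowski_metric R n) std_torif.
Proof.
have d2 (a b : C) (t : R) : (a + t%:C * b) / 2 = a / 2 + t%:C * (b / 2) by ring.
have c2 (x : C) : conjc (2^-1 * x) = 2^-1 * conjc x.
  by rewrite rmorphM fmorphV rmorph_nat.
apply: (@holo_isometric_lift _ _ _ _ std_lift (fun z u =>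
  chart_dir ord_max (\row_i (u 0 i / 2 * (\row_k cexp (z 0 k / 2) : 'rV[C]_n) 0 i)))).
- by move=> z; exact: chart_vec_neq0.
- move=> z j; case: (unliftP ord_max j) => [i|] ->.
    rewrite (_ : (fun x => _) = cexp (R := R) \o (fun x : 'rV[C]_n => x 0 i * 2^-1)).
      apply: differentiable_comp; last exact: differentiable_cexp.
      apply: differentiableM; first exact: differentiable_coord.
      exact: differentiable_cst.
    by apply/funext => x; rewrite chart_vec_lift mxE.
  rewrite (_ : (fun x => _) = cst 1); first exact: differentiable_cst.
  by apply/funext => x; rewrite chart_vec_diag.
- move=> z u j; case: (unliftP ord_max j) => [i|] ->; last first.
    rewrite chart_dir_diag; apply: is_cderive_ext (is_cderiveC 0 1) => t.
    by rewrite chart_vec_diag.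
  rewrite chart_dir_lift !mxE.
  apply: (@is_cderive_val _ _ _ _ _ (is_cderive_ext _
    (is_cderive_cexp (is_cderive_affine 0 (z 0 i / 2) (u 0 i / 2))))).
    by move=> t; rewrite chart_vec_lift !mxE d2.
  by rewrite mul0r addr0.
- move=> z u v; rewrite -fs_metric_hfs.
  rewrite (_ : (\row_i (u 0 i / 2 * _)) = \row_i ((2^-1 *: u) 0 i *
    (\row_k cexp (z 0 k / 2) : 'rV[C]_n) 0 i)); last first.
    by apply/rowP => i; rewrite !mxE [u 0 i / 2]mulrC.
  rewrite (_ : (\row_i (v 0 i / 2 * _)) = \row_i ((2^-1 *: v) 0 i *
    (\row_k cexp (z 0 k / 2) : 'rV[C]_n) 0 i)); last first.
    by apply/rowP => i; rewrite !mxE [v 0 i / 2]mulrC.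
  rewrite fs_metric_log dombrowski_metricE /=.
  set w := \row_k _.
  have sw i : sqnc (w 0 i) / (1 + sqnv w) = ptheta (re_vec z) (lift ord_max i).
    rewrite -std_ext_torif std_ext_pline ?chart_vec_neq0//.
    rewrite chart_vec_lift [sqnv (std_lift z)]/sqnv (bigD1_ord ord_max)//=.
    rewrite chart_vec_diag.
    congr (_ / (_ + _)); first by rewrite /sqnc /= expr0n addr0 expr1n.
    by apply: eq_bigr => k _; rewrite chart_vec_lift.
  rewrite (eq_bigr (fun i => 4^-1 * ((ptheta (re_vec z) (lift ord_max i))%:C *
    (u 0 i * conjc (v 0 i))))); last first.
    by move=> i _; rewrite sw !mxE c2; field.
  rewrite [X in (_ - X * _)](eq_bigr (fun i => 2^-1 *
    ((ptheta (re_vec z) (lift ord_max i))%:C * u 0 i))); last first.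
    by move=> i _; rewrite sw !mxE mulrCA.
  rewrite [X in (_ - _ * X)](eq_bigr (fun i => 2^-1 *
    ((ptheta (re_vec z) (lift ord_max i))%:C * conjc (v 0 i)))); last first.
    by move=> i _; rewrite sw !mxE c2 mulrCA.
  rewrite -!mulr_sumr divr1 -ReRM; congr complex.Re.
  by rewrite rmorph_nat; field.
Qed.

Lemma std_torification : torification_map std_frame std_torif.
Proof.
split.
- rewrite /std_frame unitmxZ ?unitmx1// unitfE.
  by rewrite mulf_neq0 ?gt_eqF ?pi_gt0.
- move=> z z'; split.
    move=> /(pline_eqP (chart_vec_neq0 _ _) (chart_vec_neq0 _ _))[l l0 /rowP e].
    have l1 : l = 1.
      have := e ord_max; rewrite [in RHS]mxE !chart_vec_diag mulr1.
      by move=> <-.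
    have /choice[k zk] : forall i, exists k : int,
        z' 0 i = z 0 i + (0 +i* (4 * pi * k%:~R)).
      move=> i; have := e (lift ord_max i).
      rewrite [in RHS]mxE !chart_vec_lift !mxE l1 mul1r => /esym /cexp_eqP[k ek].
      exists k; have := congr1 ( *%R^~ 2) ek.
      rewrite /= mulfVK// mulrDl mulfVK// => ->; congr (_ + _).
      by apply: complex_ext; rewrite !ReImE /=; ring.
    exists (\row_i k i); apply/rowP => i.
    by rewrite translate_std zk !mxE.
  move=> [k ->]; rewrite /std_torif; congr (pline (chart_vec _ _)); apply/rowP => i.
  rewrite [LHS]mxE [RHS]mxE translate_std mulrDl cexpD.
  rewrite (_ : (0 +i* _) / 2 = 0 +i* (2 * pi * (k 0 i)%:~R)).
    by rewrite cexp_imag cis_int mulr1.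
  apply: (mulIf (_ : 2 != 0 :> C)); first by rewrite pnatr_eq0.
  rewrite mulfVK ?pnatr_eq0// mxE.
  by apply: complex_ext; rewrite !ReImE /=; ring.
- exact: std_torif_onto.
- move=> t z; rewrite torus_act_pline ?chart_vec_neq0//; congr pline.
  apply/rowP => j; rewrite [RHS]mxE.
  case: (unliftP ord_max j) => [i|] -> /=; last first.
    by rewrite !chart_vec_diag mulr1.
  rewrite !chart_vec_lift [LHS]mxE [X in _ = _ * X]mxE translate_std.
  rewrite mulrDl cexpD mulrC -cexp_imag.
  congr (cexp _ * _); apply: (mulIf (_ : 2 != 0 :> C)); first by rewrite pnatr_eq0.
  rewrite mulfVK ?pnatr_eq0//.
  by apply: complex_ext; rewrite !ReImE /=; ring.
- exact: std_holo_isometric.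
Qed.

(** The values lie in the closure of the family because the free locus, where they are some p_theta,
    is dense. *)
Lemma std_natural_extension : natural_extension std_ext.
Proof.
have cont : continuous std_ext.
  by move=> p; apply: (@cvg_ptws _ (nbhs p)) => i; exact: continuous_std_ext.
exists std_frame, std_torif; split => //.
- exact: std_torification.
- exact: std_ext_torif.
- move=> p A /cont /dense_coord_neq0[Z Zj /= AZ].
  have Z0 : Z != 0 by apply: contraNneq (Zj ord0) => ->; rewrite mxE.
  have : range std_torif (pline Z) by rewrite std_torif_onto; apply/free_locusP.
  move=> [z _ zZ]; exists (std_ext (pline Z)); split => //.
  by exists (re_vec z) => //; rewrite -std_ext_torif zZ.
Qed.

End standard_torification.

(** * Calculus with directional derivatives and symmetry of second derivatives *)

Lemma dist_half_le (R : realType) (x y z e : R) :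
  `|z - x| < e / 2 -> `|z - y| < e / 2 -> `|x - y| <= e.
Proof.
move=> zx zy; rewrite [e]splitr ltW//.
by apply: le_lt_trans (ler_distD z _ _) _; rewrite distrC ltrD.
Qed.

Section directional_calculus.
Variables (R : realType) (m : nat).
Local Notation C := R[i].
Local Notation E := 'rV[C]_m.
Local Notation Re := (@complex.Re R).
Local Notation Im := (@complex.Im R).
Implicit Types (f g : E -> R) (w u v a b : E) (t : R).

Lemma ddir_eq f w u (x : R) :
  is_derive (0 : R) (1 : R) (along f w u) x -> ddir f w u = x.
Proof. exact: is_derive1E. Qed.

Lemma is_derive_ddir f w u : derivable (along f w u) 0 1 ->
  is_derive (0 : R) (1 : R) (along f w u) (ddir f w u).
Proof. by move=> /derivableP; rewrite /ddir derive1E. Qed.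

(** [ddir] differentiates at the parameter 0 only; moving the base point along the line gives the
    other parameters. *)
Lemma is_derive_along f u w t : (forall w, derivable (along f w u) 0 1) ->
  is_derive t (1 : R) (along f w u) (ddir f (w + t%:C *: u) u).
Proof.
move=> df; have d0 := is_derive_ddir (df (w + t%:C *: u)).
rewrite -(subrr t) in d0.
have h := @is_derive_compf _ t _ (fun s => s - t) _ _ d0
  (is_deriveBf (is_derive_idf t) (is_deriveCf t t)).
apply: (@is_derive_val _ _ _ _ _ (is_derive_ext _ h)); last first.
  by rewrite subr0 mulr1.
move=> s; rewrite /along -addrA -scalerDl -rmorphD; congr (f (_ + _%:C *: _)).
by rewrite addrC subrK.
Qed.

Lemma is_Ck_continuous k f : is_Ck k f -> continuous f.
Proof. by case: k => [|k] []. Qed.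

Lemma is_Ck_derivable k f u w : is_Ck k.+1 f -> derivable (along f w u) 0 1.
Proof. by move=> [_ /(_ u)[]]. Qed.

Lemma is_Ck_ddir k f u : is_Ck k.+1 f -> is_Ck k (fun w => ddir f w u).
Proof. by move=> [_ /(_ u)[]]. Qed.

Lemma is_CkW k f : is_Ck k.+1 f -> is_Ck k f.
Proof.
elim: k f => [|k ih] f; first by move=> [].
move=> [cf df]; split => // u; have [du ddu] := df u.
by split => //; exact: ih.
Qed.

Lemma ddirD f g w u : derivable (along f w u) 0 1 -> derivable (along g w u) 0 1 ->
  is_derive (0 : R) (1 : R) (along (fun x => f x + g x) w u)
    (ddir f w u + ddir g w u).
Proof. by move=> /is_derive_ddir df /is_derive_ddir dg; exact: is_deriveDf. Qed.

Lemma ddirM f g w u : derivable (along f w u) 0 1 -> derivable (along g w u) 0 1 ->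
  is_derive (0 : R) (1 : R) (along (fun x => f x * g x) w u)
    (ddir f w u * g w + f w * ddir g w u).
Proof.
move=> /is_derive_ddir df /is_derive_ddir dg.
apply: (@is_derive_val _ _ _ _ _ (is_deriveMf df dg)).
by rewrite /along scale0r addr0.
Qed.

Lemma is_Ck_cst k (x : R) : is_Ck k (fun _ : E => x).
Proof.
have c (y : R) : continuous (fun _ : E => y).
  by move=> w A; exact: (@cvg_cst _ y _ (nbhs w)).
elim: k x => [|k ih] x; split => //.
have h w u : is_derive (0 : R) (1 : R) (along (fun _ : E => x) w u) 0.
  exact: is_deriveCf.
move=> u; split; first by move=> w; case: (h w u).
rewrite (_ : (fun w => _) = fun=> 0) //; apply/funext => w.
exact: ddir_eq.
Qed.

Lemma is_CkD k f g : is_Ck k f -> is_Ck k g -> is_Ck k (fun x => f x + g x).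
Proof.
elim: k f g => [|k ih] f g [cf df] [cg dg].
  by split => // w; have h := cvgD (cf w) (cg w); exact: h.
split; first by move=> w; have h := cvgD (cf w) (cg w); exact: h.
move=> u; have [fu dfu] := df u; have [gu dgu] := dg u; split.
  by move=> w; case: (ddirD (fu w) (gu w)).
rewrite (_ : (fun w => _) = fun w => ddir f w u + ddir g w u); first exact: ih.
by apply/funext => w; exact/ddir_eq/ddirD.
Qed.

Lemma is_CkM k f g : is_Ck k f -> is_Ck k g -> is_Ck k (fun x => f x * g x).
Proof.
elim: k f g => [|k ih] f g kf kg; have cf := is_Ck_continuous kf;
  have cg := is_Ck_continuous kg.
  by split => // w; have h := cvgM (cf w) (cg w); exact: h.
split; first by move=> w; have h := cvgM (cf w) (cg w); exact: h.
move=> u; have fu w := is_Ck_derivable (u := u) (w := w) kf.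
have gu w := is_Ck_derivable (u := u) (w := w) kg.
split; first by move=> w; case: (ddirM (fu w) (gu w)).
rewrite (_ : (fun w => _) = fun w => ddir f w u * g w + f w * ddir g w u).
  apply: is_CkD; apply: ih.
  - exact: is_Ck_ddir.
  - exact: is_CkW.
  - exact: is_CkW.
  - exact: is_Ck_ddir.
by apply/funext => w; exact/ddir_eq/ddirM.
Qed.

Lemma is_Ck_sum k (I : finType) (f : I -> E -> R) : (forall i, is_Ck k (f i)) ->
  is_Ck k (fun w => \sum_i f i w).
Proof.
move=> fk; elim: (index_enum I) => [|i r ih].
  by under [X in is_Ck k X]funext do rewrite big_nil; exact: is_Ck_cst.
by under [X in is_Ck k X]funext do rewrite big_cons; exact: is_CkD.
Qed.

Lemma is_cderive_line t w u i :
  is_cderive t (fun s : R => (w + s%:C *: u) 0 i) (u 0 i).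
Proof.
by apply: is_cderive_ext (is_cderive_affine t (w 0 i) (u 0 i)) => s; rewrite !mxE.
Qed.

Lemma is_Ck_Re k i : is_Ck k (fun w => Re (w 0 i)).
Proof.
have c : continuous (fun w : E => Re (w 0 i)).
  move=> w; have h : (x : E) 0 i @[x --> w] --> w 0 i by exact: coord_continuous.
  exact: cvg_comp _ _ h (@continuous_Re R _).
case: k => [|k]; split => // u.
have h w : is_derive (0 : R) (1 : R) (along (fun w => Re (w 0 i)) w u) (Re (u 0 i)).
  exact: (is_cderive_line 0 w u i).1.
split; first by move=> w; case: (h w).
rewrite (_ : (fun w => _) = fun=> Re (u 0 i)); first exact: is_Ck_cst.
by apply/funext => w; exact: ddir_eq.
Qed.

Lemma is_Ck_Im k i : is_Ck k (fun w => Im (w 0 i)).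
Proof.
have c : continuous (fun w : E => Im (w 0 i)).
  move=> w; have h : (x : E) 0 i @[x --> w] --> w 0 i by exact: coord_continuous.
  exact: cvg_comp _ _ h (@continuous_Im R _).
case: k => [|k]; split => // u.
have h w : is_derive (0 : R) (1 : R) (along (fun w => Im (w 0 i)) w u) (Im (u 0 i)).
  exact: (is_cderive_line 0 w u i).2.
split; first by move=> w; case: (h w).
rewrite (_ : (fun w => _) = fun=> Im (u 0 i)); first exact: is_Ck_cst.
by apply/funext => w; exact: ddir_eq.
Qed.

Lemma is_Ck_sqnv k : is_Ck k (@sqnv R m).
Proof.
apply: is_Ck_sum => i; apply: is_CkD.
  by apply: (is_CkM (is_Ck_Re k i) (is_Ck_Re k i)).
by apply: (is_CkM (is_Ck_Im k i) (is_Ck_Im k i)).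
Qed.

Lemma is_derive_sqnv t w u : is_derive t (1 : R) (along (@sqnv R m) w u)
  (2 * Re (hdot u (w + t%:C *: u))).
Proof.
have h := is_derive_sumf (fun i => is_cderive_sqnc (is_cderive_line t w u i)).
apply: (is_derive_val h); rewrite /hdot Re_sum mulr_sumr.
by [].
Qed.

Lemma MVT_derive (h dh : R -> R) (s : R) : 0 < s ->
  (forall x, is_derive x (1 : R) h (dh x)) ->
  exists2 x, 0 < x < s & h s - h 0 = dh x * s.
Proof.
move=> s0 hd; have [] := @MVT R h dh 0 s s0.
  apply: continuous_subspaceT => x.
  by apply/differentiable_continuous/derivable1_diffP; case: (hd x).
by move=> x; rewrite in_itv /= subr0 => xs ->; exists x.
Qed.

(** The mean value theorem is applied to the difference of f along two parallel lines of direction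
    a, then to its a-derivative along b. *)
Lemma second_difference f a b w (s : R) : is_Ck 2 f -> 0 < s ->
  exists x y : R, [/\ 0 < x < s, 0 < y < s &
    f (w + s%:C *: a + s%:C *: b) - f (w + s%:C *: a) - f (w + s%:C *: b) + f w =
    s ^+ 2 * ddir (fun v => ddir f v a) (w + x%:C *: a + y%:C *: b) b].
Proof.
move=> f2 s0.
have fa w' := is_Ck_derivable (u := a) (w := w') f2.
have fab w' := is_Ck_derivable (u := b) (w := w') (is_Ck_ddir a f2).
pose h x := along f (w + s%:C *: b) a x - along f w a x.
have hd x : is_derive x (1 : R) h
    (ddir f (w + s%:C *: b + x%:C *: a) a - ddir f (w + x%:C *: a) a).
  by apply: is_deriveBf; exact: is_derive_along.
have [x xs hx] := MVT_derive s0 hd.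
have kd y : is_derive y (1 : R) (along (fun v => ddir f v a) (w + x%:C *: a) b)
    (ddir (fun v => ddir f v a) (w + x%:C *: a + y%:C *: b) b).
  exact: is_derive_along.
have [y ys ky] := MVT_derive s0 kd.
exists x, y; split => //.
move: hx ky; rewrite /h /along !scale0r !addr0 => hx ky.
have -> : w + s%:C *: a + s%:C *: b = w + s%:C *: b + s%:C *: a by rewrite addrAC.
have e : w + s%:C *: b + x%:C *: a = w + x%:C *: a + s%:C *: b by rewrite addrAC.
rewrite e ky in hx.
rewrite (_ : _ + f w = f (w + s%:C *: b + s%:C *: a) - f (w + s%:C *: a) -
  (f (w + s%:C *: b) - f w)); last by ring.
by rewrite hx; ring.
Qed.

Lemma near_plane f a b w (e : R) : continuous f -> 0 < e -> exists2 r : R, 0 < r &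
  forall x y, 0 < x < r -> 0 < y < r ->
    `|f (w + x%:C *: a + y%:C *: b) - f w| < e.
Proof.
move=> cf e0.
have h : w + (xy : R * R).1%:C *: a + xy.2%:C *: b @[xy --> ((0, 0) : R * R)] -->
    w + 0%:C *: a + 0%:C *: b.
  apply: (@cvgD _ _ _ (nbhs ((0, 0) : R * R))).
    apply: (@cvgD _ _ _ (nbhs ((0, 0) : R * R))); first exact: cvg_cst.
    apply: cvgZr_tmp.
    exact: cvg_comp _ _ (cvg_fst (F := nbhs (0 : R)) (G := nbhs (0 : R))) (@continuous_real_complex R 0).
  apply: cvgZr_tmp.
  exact: cvg_comp _ _ (cvg_snd (F := nbhs (0 : R)) (G := nbhs (0 : R))) (@continuous_real_complex R 0).
rewrite !scale0r !addr0 in h.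
have fh := cvg_comp _ _ h (cf w).
have /= := @cvgr_dist_lt _ _ _ (nbhs ((0, 0) : R * R)) (nbhs_filter _) _ _ fh _ e0.
move=> /nbhs_ballP[r /= r0 hr]; exists r => // x y /andP[x0 xr] /andP[y0 yr].
rewrite distrC; apply: (hr (x, y)); split; rewrite /ball /= sub0r normrN gtr0_norm//.
Qed.

(** The second difference is symmetric in a and b. Divided by s^2 it is a mixed derivative at a
    nearby point, in either order, and both points tend to w with s; continuity of the second
    derivatives concludes. *)
Lemma ddir_symmetric f a b w : is_Ck 2 f ->
  ddir (fun v => ddir f v a) w b = ddir (fun v => ddir f v b) w a.
Proof.
move=> f2; apply/eqP; rewrite -subr_eq0 -normr_le0.
apply/ler_addgt0Pl => e e0; rewrite addr0.
have e20 : 0 < e / 2 by rewrite divr_gt0.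
have [r r0 hr] := near_plane a b w (is_Ck_continuous
  (is_Ck_ddir b (is_Ck_ddir a f2))) e20.
have [q q0 hq] := near_plane b a w (is_Ck_continuous
  (is_Ck_ddir a (is_Ck_ddir b f2))) e20.
pose s := Num.min r q; have s0 : 0 < s by rewrite lt_min r0.
have sr : s <= r by rewrite ge_min lexx.
have sq : s <= q by rewrite ge_min lexx orbT.
have [x [y [/andP[x0 xs] /andP[y0 ys] e1]]] := second_difference a b w f2 s0.
have [x' [y' [/andP[x'0 x's] /andP[y'0 y's] e2]]] := second_difference b a w f2 s0.
have ee : ddir (fun v => ddir f v a) (w + x%:C *: a + y%:C *: b) b =
    ddir (fun v => ddir f v b) (w + x'%:C *: b + y'%:C *: a) a.
  have s20 : s ^+ 2 != 0 by rewrite expf_neq0 ?gt_eqF.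
  apply: (mulfI s20); apply: etrans (esym e1) _; apply: etrans _ e2.
  have -> : w + s%:C *: b + s%:C *: a = w + s%:C *: a + s%:C *: b by rewrite addrAC.
  by rewrite -!addrA; congr (_ + _); rewrite addrCA.
have bnd (l c t : R) : 0 < t -> t < l -> l <= c -> 0 < t < c.
  by move=> t0 tl lc; rewrite t0 (lt_le_trans tl lc).
have h1 := hr x y (bnd _ _ _ x0 xs sr) (bnd _ _ _ y0 ys sr).
have h2 := hq x' y' (bnd _ _ _ x'0 x's sq) (bnd _ _ _ y'0 y's sq).
rewrite ee in h1.
exact: dist_half_le h1 h2.
Qed.

End directional_calculus.

(** * Real linear forms on C^n and their gradients *)

Section real_linearity.
Variables (R : realType) (n : nat).
Local Notation C := R[i].
Local Notation E := 'rV[C]_n.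
Local Notation Re := (@complex.Re R).
Local Notation Im := (@complex.Im R).
Implicit Types (L : E -> R) (w u v a b : E).

Definition real_linear L : Prop :=
  (forall a b, L (a + b) = L a + L b) /\ (forall (r : R) a, L (r%:C *: a) = r * L a).

Lemma real_linear0 L : real_linear L -> L 0 = 0.
Proof. by move=> [_ h]; rewrite -(scale0r 0) -(rmorph0 (real_complex R)) h mul0r. Qed.

Lemma real_linearN L a : real_linear L -> L (- a) = - L a.
Proof.
by move=> [_ h]; rewrite -scaleN1r -(rmorph1 (real_complex R)) -rmorphN h mulN1r.
Qed.

Lemma real_linear_sum L (I : finType) (F : I -> E) : real_linear L ->
  L (\sum_i F i) = \sum_i L (F i).
Proof.
by move=> Ll; apply: (big_morph L Ll.1); exact: real_linear0.
Qed.

Definition ebase (i : 'I_n) : E := delta_mx 0 i.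

Lemma ebaseE v : v = \sum_i ((Re (v 0 i))%:C *: ebase i +
  (Im (v 0 i))%:C *: ('i%C *: ebase i)).
Proof.
apply/rowP => j; rewrite summxE (bigD1 j)//= big1 ?addr0.
  by rewrite !mxE !eqxx !mulr1 {1}[v 0 j]complexE [_ * 'i%C]mulrC.
by move=> i ij; rewrite !mxE eq_sym (negbTE ij) !mulr0 addr0.
Qed.

Lemma real_linear_ebase L v : real_linear L ->
  L v = \sum_i (Re (v 0 i) * L (ebase i) + Im (v 0 i) * L ('i%C *: ebase i)).
Proof.
move=> Ll; rewrite {1}[v]ebaseE real_linear_sum//; apply: eq_bigr => i _.
by rewrite Ll.1 !Ll.2.
Qed.

(** The Riesz vector of L for the real inner product Re <., .> on C^n = R^2n. *)
Definition rgrad L : E := \row_i (L (ebase i) +i* L ('i%C *: ebase i)).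

Lemma rgradP L v : real_linear L -> Re (hdot (rgrad L) v) = L v.
Proof.
move=> Ll; rewrite (real_linear_ebase v Ll) Re_sum; apply: eq_bigr => i _.
by rewrite mxE !ReImE /=; ring.
Qed.

Lemma hdot_ebase v i : hdot v (ebase i) = v 0 i.
Proof.
rewrite /hdot (bigD1 i)//= big1 ?addr0; first by rewrite !mxE !eqxx conjc1 mulr1.
by move=> j ji; rewrite !mxE (negbTE ji) andbF conjc0 mulr0.
Qed.

Lemma rgrad_uniq L v : (forall u, L u = Re (hdot v u)) -> rgrad L = v.
Proof.
move=> Lv; apply/rowP => i; rewrite mxE !Lv hdotZr hdot_ebase.
by apply: complex_ext; rewrite !ReImE /=; ring.
Qed.

End real_linearity.

(** * Symmetries and inversion of the metric *)

Section fs_metric_algebra.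
Variables (R : realType) (n : nat).
Local Notation C := R[i].
Local Notation E := 'rV[C]_n.
Local Notation Re := (@complex.Re R).
Implicit Types (w u v a b : E).

Lemma fs_metricC (c : R) w u v : fs_metric c w u v = fs_metric c w v u.
Proof.
rewrite /fs_metric; congr (_ * _); rewrite -[in RHS]ReJ; congr Re.
have Jw : conjc (hdot w w) = hdot w w by rewrite -hdotC.
rewrite rmorphM fmorphV rmorphXn rmorphB !rmorphM rmorphD rmorph1 /= Jw -!hdotC.
by congr (_ / _); rewrite [hdot u w * _]mulrC.
Qed.

Lemma fs_metricDl (c : R) w u v a : fs_metric c w (u + v) a =
  fs_metric c w u a + fs_metric c w v a.
Proof.
rewrite /fs_metric -mulrDr -ReD; congr (_ * Re _); rewrite !hdotDl -mulrDl.
by congr (_ / _); ring.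
Qed.

Lemma fs_metric_real_linear (c : R) w u : real_linear (fs_metric c w u).
Proof.
split; first by move=> a b; rewrite fs_metricC fs_metricDl !(fs_metricC c w u).
move=> r a; rewrite /fs_metric [RHS]mulrCA -[r * _]ReRM; congr (_ * Re _).
by rewrite !hdotZr conjc_real; ring.
Qed.

Lemma fs_metric_rot (c : R) w u v :
  fs_metric c w ('i%C *: u) ('i%C *: v) = fs_metric c w u v.
Proof.
have ii : 'i%C * conjc 'i%C = 1 :> C by apply: complex_ext; rewrite !ReImE /=; ring.
rewrite /fs_metric; congr (_ * Re (_ / _)); rewrite !hdotZl !hdotZr.
rewrite ['i%C * (_ * hdot u v)]mulrA ii mul1r; congr (_ - _).
by rewrite mulrACA ii mul1r.
Qed.

(* [a |-> (1 + |w|^2) (a + <a, w> w)] is, up to the factor [4], the inverse of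
   the metric. *)
Lemma fs_metric_dual w a v :
  fs_metric 1 w (a + hdot a w *: w) v = 4 / (1 + sqnv w) * Re (hdot a v).
Proof.
have P0 : 1 + sqnv w != 0 by rewrite gt_eqF// ltr_pwDl ?sqnv_ge0.
have [P PE] : exists P, P = (1 + sqnv w)%:C by eexists.
have PC0 : P != 0 by rewrite PE fmorph_eq0.
rewrite /fs_metric divr1 -mulrA; congr (_ * _); rewrite -ReRM fmorphV /= -PE.
congr Re; rewrite hdotDl hdotZl hdotDl hdotZl.
have -> : hdot w w = P - 1 by rewrite PE rmorphD rmorph1 hdotxx addrC addKr.
by field.
Qed.

(** Put P = 1 + |w|^2. Testing on e_j and i e_j gives 4 (P u_j - <u,w> w_j) = P^2 a_j. Pairing with
    w yields 4 <u,w> = P^2 <a,w>, because P - |w|^2 = 1, and this eliminates <u,w>. *)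
Lemma fs_metric_repr w u a : (forall v, fs_metric 1 w u v = Re (hdot a v)) ->
  4%:R *: u = (1 + sqnv w)%:C *: (a + hdot a w *: w).
Proof.
move=> h.
have P0 : 1 + sqnv w != 0 by rewrite gt_eqF// ltr_pwDl ?sqnv_ge0.
have [P PE] : exists P, P = (1 + sqnv w)%:C by eexists.
have PC0 : P != 0 by rewrite PE fmorph_eq0.
have wP : hdot w w = P - 1 by rewrite PE rmorphD rmorph1 hdotxx addrC addKr.
have hj j : 4 * (P * u 0 j - hdot u w * w 0 j) = P ^+ 2 * a 0 j.
  have e1 := h (ebase R j); have e2 := h ('i%C *: ebase R j).
  move: e1 e2; rewrite /fs_metric divr1 !hdotZr !hdot_ebase wP.
  have -> : 1 + (P - 1) = P by ring.
  have -> : (P * (conjc 'i%C * u 0 j) - hdot u w * (conjc 'i%C * w 0 j)) / P ^+ 2 =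
    conjc 'i%C * ((P * u 0 j - hdot u w * w 0 j) / P ^+ 2) by ring.
  set q := (_ / P ^+ 2) => e1 e2.
  have qa : 4%:R%:C * q = a 0 j.
    apply: complex_ext; first by rewrite ReRM -e1.
    by rewrite ImRM; move: e2; rewrite !ReImE /= !(mul0r, mulN1r, sub0r, opprK).
  by rewrite -qa /q rmorph_nat; field.
have uw : 4 * hdot u w = P ^+ 2 * hdot a w.
  have -> : 4 * hdot u w = 4 * (P * hdot u w - hdot u w * hdot w w).
    by rewrite wP; ring.
  rewrite {1 3}/hdot [X in _ - X]mulr_sumr mulr_sumr -sumrB !mulr_sumr.
  by apply: eq_bigr => j _; rewrite [RHS]mulrA -hj; ring.
rewrite -PE; apply/rowP => j; rewrite !mxE; apply: (mulfI PC0).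
have -> : P * (4%:R * u 0 j) = 4 * (P * u 0 j - hdot u w * w 0 j) +
  4 * hdot u w * w 0 j by ring.
by rewrite hj uw; ring.
Qed.

End fs_metric_algebra.

(** * The Killing equation in a chart and the vanishing of third derivatives *)

Lemma derive_quadratic (R : realType) (h h1 : R -> R) (m : R) :
  (forall t, is_derive t (1 : R) h (h1 t)) ->
  (forall t, is_derive t (1 : R) h1 m) -> h 1 = h 0 + h1 0 + m / 2.
Proof.
move=> dh dh1.
have e1 t : h1 t = h1 0 + t * m.
  have d s : is_derive s (1 : R) (fun s => h1 s - s * m) 0.
    apply: (@is_derive_val _ _ _ _ _ (is_deriveBf (dh1 s)
      (is_deriveMf (is_derive_idf s) (is_deriveCf s m)))).
    by rewrite mul1r mulr0 addr0 subrr.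
  by have := is_derive_0_is_cst t 0 d; lra.
have d s : is_derive s (1 : R) (fun s => h s - (s * h1 0 + s * s * (m / 2))) 0.
  apply: (@is_derive_val _ _ _ _ _ (is_deriveBf (dh s) (is_deriveDf
    (is_deriveMf (is_derive_idf s) (is_deriveCf s (h1 0)))
    (is_deriveMf (is_deriveMf (is_derive_idf s) (is_derive_idf s))
      (is_deriveCf s (m / 2)))))).
  by rewrite e1; field.
by have := is_derive_0_is_cst 1 0 d; lra.
Qed.

Section kahler_chart.
Variables (R : realType) (n : nat).
Local Notation C := R[i].
Local Notation E := 'rV[C]_n.
Local Notation Re := (@complex.Re R).
Local Notation Im := (@complex.Im R).
Local Notation I := ('i%C : C).
Variables (g : E -> R) (X : E -> E).
Hypothesis gk : is_smooth g.
Hypothesis ham : forall w v, fs_form 1 w (X w) v = ddir g w v.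
Hypothesis kil : forall w u v,
  ddir (fun w' => fs_metric 1 w' u v) w (X w)
  + fs_metric 1 w (ddir_vec X w u) v + fs_metric 1 w u (ddir_vec X w v) = 0.
Implicit Types (w u v a b : E).

(** Smoothness treats one direction at a time; linearity in the direction is read off the
    Hamiltonian equation, whose left side is real linear in v. *)
Lemma ddir_linear_ham w : real_linear (ddir g w).
Proof.
have h := fs_metric_real_linear 1 w (I *: X w).
by split=> [a b|r a]; rewrite -!ham; [exact: h.1|exact: h.2].
Qed.

(* The Kaehler functions are exactly the [f] for which [(1 + |w|^2) f] is a
   polynomial of bidegree at most [(1, 1)]. *)
Definition potential w : R := (1 + sqnv w) * g w.
Local Notation U := potential.

Lemma is_Ck_potential k : is_Ck k U.
Proof.
by apply: is_CkM; [apply: is_CkD; [exact: is_Ck_cst|exact: is_Ck_sqnv]|exact: gk].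
Qed.

Lemma ddir_potential w v :
  ddir U w v = 2 * Re (hdot v w) * g w + (1 + sqnv w) * ddir g w v.
Proof.
have h1 : is_derive (0 : R) (1 : R) (along (fun x : E => 1 + sqnv x) w v)
    (2 * Re (hdot v w)).
  apply: (@is_derive_val _ _ _ _ _ (is_deriveDf (is_deriveCf 0 1)
    (is_derive_sqnv 0 w v))).
  by rewrite add0r scale0r addr0.
have d1 : derivable (along (fun x : E => 1 + sqnv x) w v) 0 1 by case: h1.
have d2 : derivable (along g w v) 0 1 := is_Ck_derivable (gk 1).
by rewrite (ddir_eq (ddirM d1 d2)) (ddir_eq h1).
Qed.

Lemma ddir_potential_linear w : real_linear (ddir U w).
Proof.
have h := ddir_linear_ham w; split=> [a b|r a]; rewrite !ddir_potential.
  by rewrite h.1 hdotDl ReD; ring.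
by rewrite h.2 hdotZl ReRM; ring.
Qed.

Local Notation B w := (rgrad (ddir U w)).

(** Inverting the metric gives 4iX = P (a + <a,w> w) with a the gradient of g and P = 1 + |w|^2. The
    gradient of U = P g is 2 g w + P a, so U absorbs the factor P. *)
Lemma hamiltonian_fieldE w :
  4%:R *: (I *: X w) = B w + hdot (B w) w *: w - (2 * U w)%:C *: w.
Proof.
pose a := rgrad (ddir g w).
have BE : B w = (2 * g w)%:C *: w + (1 + sqnv w)%:C *: a.
  apply: rgrad_uniq => u; rewrite hdotDl !hdotZl ReD !ReRM.
  rewrite (rgradP u (ddir_linear_ham w)) ddir_potential [hdot u w]hdotC ReJ.
  by ring.
rewrite (@fs_metric_repr _ _ w (I *: X w) a); last first.
  by move=> v; rewrite (rgradP v (ddir_linear_ham w)) -ham.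
rewrite BE hdotDl !hdotZl hdotxx /potential.
apply/rowP => j; rewrite !mxE !rmorphM !rmorphD /= !rmorph1.
by ring.
Qed.

(* Locked, as unifying two such terms would otherwise unfold the limits. *)
Definition hess := locked (fun w u v => ddir (fun x => ddir U x v) w u).
Local Notation M := hess.

Lemma hessE w u v : M w u v = ddir (fun x => ddir U x v) w u.
Proof. by rewrite /hess -lock. Qed.

Lemma hessC w u v : M w u v = M w v u.
Proof. rewrite !hessE; exact: ddir_symmetric (is_Ck_potential 2). Qed.

Lemma derivable_ddir_potential w u v : derivable (along (fun x => ddir U x v) w u) 0 1.
Proof. exact: is_Ck_derivable (is_Ck_ddir v (is_Ck_potential 2)). Qed.
Arguments derivable_ddir_potential : clear implicits.

Lemma hess_linear w u : real_linear (M w u).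
Proof.
split=> [a b|r a].
  rewrite !hessE -(ddir_eq (ddirD (derivable_ddir_potential w u a)
    (derivable_ddir_potential w u b))).
  suff -> : (fun x => ddir U x (a + b)) = (fun x => ddir U x a + ddir U x b) by [].
  by apply/funext => x; rewrite (ddir_potential_linear x).1.
have h := is_derive_ddir (derivable_ddir_potential w u a).
have h2 := is_deriveMf (is_deriveCf 0 r) h.
rewrite !hessE; apply: ddir_eq; apply: (@is_derive_val _ _ _ _ _ (is_derive_ext _ h2)).
  by move=> t; rewrite /along (ddir_potential_linear _).2.
by rewrite mul0r add0r.
Qed.

Local Notation S w u := (rgrad (M w u)).

Lemma is_cderive_rgrad w u j :
  is_cderive 0 (fun t : R => B (w + t%:C *: u) 0 j) (S w u 0 j).
Proof.
rewrite mxE !hessE; split => /=.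
  apply: is_derive_ext (is_derive_ddir (derivable_ddir_potential w u (ebase R j))).
  by move=> t; rewrite /along mxE.
apply: is_derive_ext (is_derive_ddir (derivable_ddir_potential w u (I *: ebase R j))).
by move=> t; rewrite /along mxE.
Qed.

Lemma ddir_vecE (Y : E -> E) w u (d : E) :
  (forall j, is_cderive 0 (fun t : R => Y (w + t%:C *: u) 0 j) (d 0 j)) ->
  ddir_vec Y w u = d.
Proof.
move=> h; apply/rowP => j; rewrite mxE; have [hr hi] := h j.
by apply: complex_ext => /=; exact: ddir_eq.
Qed.

Local Notation kappa := ((4 * I)^-1 : C).

(** The part of 4i dX(u) without second derivatives of U. Its complex linearity in u is what makes
    it drop out of [killing_defect]. *)
Definition linear_part w u : E :=
  hdot (B w) w *: u - hdot u (B w) *: w - (2 * U w)%:C *: u.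

Lemma ddir_hamiltonian_field w u : ddir_vec X w u =
  kappa *: (S w u + hdot (S w u) w *: w + linear_part w u).
Proof.
have k0 : 4 * I != 0 :> C.
  by rewrite mulf_neq0 ?pnatr_eq0// eq_complex /= oner_eq0 andbF.
have U2 x : (2 * U x)%:C = 2 * (U x)%:C by rewrite rmorphM rmorph_nat.
have XE x : X x = kappa *: (B x + hdot (B x) x *: x - (2 * (U x)%:C) *: x).
  by rewrite -U2 -hamiltonian_fieldE !scalerA -mulrA mulVf// scale1r.
apply: ddir_vecE => j.
have dw i := is_cderive_line 0 w u i.
have dh : is_cderive 0 (fun t : R => hdot (B (w + t%:C *: u)) (w + t%:C *: u))
    (hdot (S w u) w + hdot (B w) u).
  have := is_cderive_sum (fun i => is_cderiveM (is_cderive_rgrad w u i)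
    (is_cderiveJ (dw i))).
  move=> /is_cderive_val; apply.
  by rewrite big_split /= !scale0r !addr0.
have dU := is_cderive_real (is_derive_ddir
  (is_Ck_derivable (w := w) (u := u) (is_Ck_potential 1))).
have := is_cderiveMl kappa (is_cderiveD (is_cderiveD (is_cderive_rgrad w u j)
  (is_cderiveM dh (dw j))) (is_cderiveN (is_cderiveM (is_cderiveMl 2 dU) (dw j)))).
move=> /(@is_cderive_ext _ _ _ (fun t : R => X (w + t%:C *: u) 0 j)) h.
apply: (is_cderive_val (h _)); first by move=> t; rewrite XE !mxE.
(* The conjugate linear term <B,u> w, from differentiating <B,w> w, cancels against one half of 2
   dU(u) w; what remains is complex linear in u. *)
have e : 2 * (ddir U w u)%:C = hdot (B w) u + hdot u (B w).
  rewrite [hdot u _]hdotC addcJ -(rgradP u (ddir_potential_linear w)).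
  by [].
rewrite /linear_part /along scale0r addr0 e U2.
move: (S w u) (B w) (U w) => s b r.
by rewrite !mxE; ring.
Qed.

Lemma linear_part_rot w u : linear_part w (I *: u) = I *: linear_part w u.
Proof.
rewrite /linear_part hdotZl; apply/rowP => j; rewrite !mxE; ring.
Qed.

(** Subtracting the value at (iu, iv) removes the complex linear part of dX, the metric being
    invariant under i. On the part a + <a,w> w, with a a second derivative of U, the metric is the
    plain pairing divided by 1 + |w|^2 ([fs_metric_dual]), and 1/i turns v into iv. *)
Lemma killing_defect w u v :
  fs_metric 1 w (ddir_vec X w u) v - fs_metric 1 w (ddir_vec X w (I *: u)) (I *: v)
  = (M w u (I *: v) + M w (I *: u) v) / (1 + sqnv w).
Proof.
have main a x : fs_metric 1 w (kappa *: (a + hdot a w *: w)) x =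
    Re (hdot a (I *: x)) / (1 + sqnv w).
  have -> : kappa *: (a + hdot a w *: w) = (kappa *: a) + hdot (kappa *: a) w *: w.
    by rewrite scalerDr hdotZl scalerA.
  rewrite fs_metric_dual mulrAC; congr (_ / _); rewrite hdotZl hdotZr.
  rewrite -[LHS]ReRM mulrA rmorph_nat; congr Re; congr (_ * _).
  rewrite invfM mulrA divff ?pnatr_eq0// mul1r.
  apply: (mulfI (_ : I != 0)); first by rewrite eq_complex /= oner_eq0 andbF.
  rewrite divff; last by rewrite eq_complex /= oner_eq0 andbF.
  by apply: complex_ext; rewrite !ReImE /=; ring.
have II x : I *: (I *: x) = - x :> E.
  rewrite scalerA (_ : I * I = -1) ?scaleN1r//.
  by apply: complex_ext; rewrite !ReImE /=; ring.
have main2 a l x : fs_metric 1 w (kappa *: (a + hdot a w *: w + l)) x =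
    Re (hdot a (I *: x)) / (1 + sqnv w) + fs_metric 1 w (kappa *: l) x.
  by rewrite scalerDr fs_metricDl main.
rewrite !ddir_hamiltonian_field linear_part_rot !main2.
rewrite [kappa *: (I *: _)]scalerA [kappa * I]mulrC -scalerA fs_metric_rot.
rewrite !rgradP; try exact: hess_linear.
rewrite II (real_linearN _ (hess_linear w _)).
move: (fs_metric _ _ _ _) (M w u _) (M w (I *: u) _) (1 + sqnv w)^-1 => A1 A2 A3 A4.
by ring.
Qed.

(** The Killing equations at (u, v) and (iu, iv) share the derivative of the metric. Their
    difference is the sum of the defects for (u, v) and (v, u), which coincide by symmetry of the
    Hessian, so each is zero. *)
Lemma hess_rot w u v : M w u (I *: v) = - M w (I *: u) v.
Proof.
have k1 := kil w u v; have k2 := kil w (I *: u) (I *: v).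
have e : (fun w' => fs_metric 1 w' (I *: u) (I *: v)) =
    (fun w' => fs_metric 1 w' u v).
  by apply/funext => x; rewrite fs_metric_rot.
rewrite e in k2.
have := killing_defect w u v; have := killing_defect w v u.
rewrite (hessC w v (I *: u)) (hessC w (I *: v) u).
rewrite (fs_metricC 1 w u) in k1.
rewrite (fs_metricC 1 w (I *: u) (ddir_vec X w (I *: v))) in k2.
move: k1 k2; set D := ddir _ _ _ => k1 k2 d1 d2.
have P0 : 1 + sqnv w != 0 by rewrite gt_eqF// ltr_pwDl ?sqnv_ge0.
have s0 : (M w (I *: u) v + M w u (I *: v)) / (1 + sqnv w) = 0 by lra.
move: s0 => /eqP; rewrite mulf_eq0 invr_eq0 (negbTE P0) orbF addr_eq0.
by move=> /eqP ->; rewrite opprK.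
Qed.

(** T is symmetric, and by [hess_rot] moving i between slots costs a sign. From the last slot to the
    middle one the direct way costs one sign and the way through the first slot two. So T vanishes
    as soon as a slot carries i, and a = i (-i a). *)
Lemma third_derivative w a b c : ddir (fun x => M x a b) w c = 0.
Proof.
have ME x y : (fun q => M q x y) = (fun q => ddir (fun p => ddir U p y) q x).
  by apply/funext => q; rewrite hessE.
have [T TE] : exists T : E -> E -> E -> R,
    forall c a b, T c a b = ddir (fun x => M x a b) w c by eexists.
have T12 x y z : T x y z = T y x z.
  rewrite !TE !ME; exact: ddir_symmetric (is_Ck_ddir z (is_Ck_potential 3)).
have T23 x y z : T x y z = T x z y.
  rewrite !TE; suff -> : (fun q => M q y z) = (fun q => M q z y) by [].
  by apply/funext => q; rewrite hessC.
have TJ x y z : T x y (I *: z) = - T x (I *: y) z.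
  have h : is_derive (0 : R) (1 : R) (along (fun q => M q (I *: y) z) w x)
      (ddir (fun q => M q (I *: y) z) w x).
    apply: is_derive_ddir; rewrite ME.
    exact: is_Ck_derivable (is_Ck_ddir (I *: y) (is_Ck_ddir z (is_Ck_potential 3))).
  rewrite !TE; apply: ddir_eq.
  by apply: is_derive_ext (is_deriveNf h) => t; rewrite /along hess_rot.
have T0 x y z : T x (I *: y) z = 0.
  have e1 : T x y (I *: z) = - T x (I *: y) z := TJ x y z.
  have e2 : T x y (I *: z) = T x (I *: y) z.
    rewrite [LHS]T12 TJ [T y _ z]T23 [T y z _]T12 TJ opprK.
    by rewrite [LHS]T23 [LHS]T12 [LHS]T23.
  by rewrite e2 in e1; lra.
have := T0 c (- I *: a) b; rewrite TE scalerA.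
rewrite (_ : I * - I = 1) ?scale1r//.
by apply: complex_ext; rewrite !ReImE /=; ring.
Qed.

Lemma hess_cst w a b : M w a b = M 0 a b.
Proof.
have ME : (fun q => M q a b) = (fun q => ddir (fun p => ddir U p b) q a).
  by apply/funext => q; rewrite hessE.
have M1 : is_Ck 1 (fun q => M q a b).
  rewrite ME; exact: is_Ck_ddir a (is_Ck_ddir b (is_Ck_potential 3)).
have d x := is_derive_along (f := fun x => M x a b) (u := w) 0 x
  (fun y => is_Ck_derivable M1).
have := @is_derive_0_is_cst _ (along (fun x => M x a b) 0 w) 1 0.
rewrite /along !scale0r addr0 rmorph1 scale1r add0r; apply => t.
by apply: (is_derive_val (d t)); exact: third_derivative.
Qed.

Lemma potential_taylor w : U w = U 0 + ddir U 0 w + M 0 w w / 2.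
Proof.
have d1 t := is_derive_along (f := U) (u := w) 0 t
  (fun y => is_Ck_derivable (is_Ck_potential 1)).
have d2 t : is_derive t (1 : R) (along (fun x => ddir U x w) 0 w) (M 0 w w).
  rewrite -(hess_cst (0 + t%:C *: w)) hessE.
  apply: is_derive_along => y; exact: derivable_ddir_potential.
have := derive_quadratic d1 d2.
by rewrite /along rmorph1 !scale1r !scale0r !add0r.
Qed.

End kahler_chart.

(** * Kähler functions are Rayleigh quotients of Hermitian matrices *)

Section hermitian_representation.
Variables (R : realType) (n : nat).
Local Notation C := R[i].
Local Notation E := 'rV[C]_n.
Local Notation Re := (@complex.Re R).
Local Notation Im := (@complex.Im R).
Local Notation I := ('i%C : C).

(** A symmetric real bilinear form invariant under i is the real part of a Hermitian form. Expanding
    on e_i and i e_i, invariance reduces the four kinds of coefficients to the real and imaginary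
    parts of one matrix. *)
Lemma hess_form (g : E -> R) (X : E -> E) (gk : is_smooth g)
    (ham : forall w v, fs_form 1 w (X w) v = ddir g w v)
    (kil : forall w u v, ddir (fun w' => fs_metric 1 w' u v) w (X w)
      + fs_metric 1 w (ddir_vec X w u) v + fs_metric 1 w u (ddir_vec X w v) = 0)
    (w : E) :
  hess g 0 w w = \sum_l \sum_i Re (w 0 i * (hess g 0 (ebase R i) (ebase R l) +i*
    hess g 0 (ebase R i) (I *: ebase R l)) * conjc (w 0 l)).
Proof.
have lin u := hess_linear gk ham 0 u.
have sym u v := hessC gk 0 u v.
have rot u v := hess_rot gk ham kil 0 u v.
have II (x : E) : I *: (I *: x) = - x.
  rewrite scalerA (_ : I * I = -1) ?scaleN1r//.
  by apply: complex_ext; rewrite !ReImE /=; ring.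
rewrite (real_linear_ebase w (lin w)); apply: eq_bigr => l _.
rewrite !(sym w) (real_linear_ebase w (lin (ebase R l))).
rewrite (real_linear_ebase w (lin (I *: ebase R l))) !mulr_sumr -big_split /=.
apply: eq_bigr => i _.
have e1 : hess g 0 (ebase R l) (ebase R i) = hess g 0 (ebase R i) (ebase R l) by [].
have e2 : hess g 0 (ebase R l) (I *: ebase R i) =
    - hess g 0 (ebase R i) (I *: ebase R l) by rewrite rot sym.
have e3 : hess g 0 (I *: ebase R l) (ebase R i) =
    hess g 0 (ebase R i) (I *: ebase R l) by [].
have e4 : hess g 0 (I *: ebase R l) (I *: ebase R i) =
    hess g 0 (ebase R i) (ebase R l).
  by rewrite rot II sym (real_linearN _ (lin _)) opprK.
rewrite e1 e2 e3 e4 !ReImE /=.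
by move: (hess _ _ _ _) (hess _ _ _ _) => s t; ring.
Qed.

Lemma chart_hermitian (g : E -> R) (X : E -> E) (gk : is_smooth g)
    (ham : forall w v, fs_form 1 w (X w) v = ddir g w v)
    (kil : forall w u v, ddir (fun w' => fs_metric 1 w' u v) w (X w)
      + fs_metric 1 w (ddir_vec X w u) v + fs_metric 1 w u (ddir_vec X w v) = 0) :
  exists2 A : 'M[C]_n.+1, (forall i j, A i j = conjc (A j i)) &
    forall w, (1 + sqnv w) * g w =
      Re (hdot (chart_vec ord_max w *m A) (chart_vec ord_max w)).
Proof.
pose b := rgrad (ddir (potential g) 0).
pose S i l : C := hess g 0 (ebase R i) (ebase R l) +i*
  hess g 0 (ebase R i) (I *: ebase R l).
have SJ i l : S i l = conjc (S l i).
  apply: complex_ext; rewrite ReImE /=; first exact: hessC.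
  by rewrite (hess_rot gk ham kil) (hessC gk).
have c2 (x : C) : conjc (2^-1 * x) = 2^-1 * conjc x.
  by rewrite rmorphM fmorphV rmorph_nat.
(* The Taylor polynomial of U at 0, homogenised by the last coordinate: U(0) in the corner, half of
   the gradient in each border, as the linear term occurs there with its conjugate, and half of the
   Hessian in the main block. *)
pose A : 'M[C]_n.+1 := \matrix_(j, k)
  match unlift ord_max j, unlift ord_max k with
  | Some i, Some l => 2^-1 * S i l
  | Some i, None => 2^-1 * conjc (b 0 i)
  | None, Some l => 2^-1 * b 0 l
  | None, None => (potential g 0)%:C
  end.
exists A.
  move=> j k; rewrite !mxE; case: (unlift _ j) => [i|]; case: (unlift _ k) => [l|].
  - by rewrite c2 -SJ.
  - by rewrite c2.
  - by rewrite c2 conjcK.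
  - by rewrite conjc_real.
move=> w; rewrite -[LHS]/(potential g w) (potential_taylor gk ham kil).
rewrite (hdot_lift ord_max) chart_vec_diag conjc1 mulr1.
have row_max : (chart_vec ord_max w *m A) 0 ord_max =
    (potential g 0)%:C + 2^-1 * hdot w b.
  rewrite mxE (bigD1_ord ord_max)//= chart_vec_diag mul1r.
  rewrite [A _ _]mxE unlift_none; congr (_ + _).
  rewrite /hdot mulr_sumr; apply: eq_bigr => i _.
  by rewrite chart_vec_lift [A _ _]mxE liftK unlift_none mulrCA.
have row_lift l : (chart_vec ord_max w *m A) 0 (lift ord_max l) =
    2^-1 * b 0 l + \sum_i 2^-1 * (w 0 i * S i l).
  rewrite mxE (bigD1_ord ord_max)//= chart_vec_diag mul1r.
  rewrite [A _ _]mxE unlift_none liftK; congr (_ + _).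
  by apply: eq_bigr => i _; rewrite chart_vec_lift [A _ _]mxE !liftK mulrCA.
rewrite row_max.
have -> : \sum_i (chart_vec ord_max w *m A) 0 (lift ord_max i) *
    conjc (chart_vec ord_max w 0 (lift ord_max i)) =
    2^-1 * hdot b w + 2^-1 * \sum_l \sum_i w 0 i * S i l * conjc (w 0 l).
  rewrite /hdot !mulr_sumr -big_split /=; apply: eq_bigr => l _.
  rewrite row_lift chart_vec_lift mulrDl mulrA; congr (_ + _).
  by rewrite mulr_suml mulr_sumr; apply: eq_bigr => i _; rewrite !mulrA.
rewrite (hess_form gk ham kil) !ReD /=.
have h2 (x : C) : Re (2^-1 * x) = 2^-1 * Re x.
  by rewrite -ReRM fmorphV rmorph_nat.
rewrite !h2 (hdotC b w) ReJ -(rgradP w (ddir_potential_linear gk ham 0)) -/b.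
have -> : Re (\sum_l \sum_i w 0 i * S i l * conjc (w 0 l)) =
    \sum_l \sum_i Re (w 0 i * S i l * conjc (w 0 l)).
  by rewrite Re_sum; apply: eq_bigr => l _; rewrite Re_sum.
by move: (\sum_l _) (Re _) => s r; field.
Qed.

Lemma continuous_smooth_cproj (f : cproj R n -> R) :
  smooth_cproj f -> continuous f.
Proof.
move=> sf p; rewrite -[p]plineK; set z := hcoord p.
have z0 : z != 0 := hcoord_neq0 p; have [k zk] := row_neq0_ex z0.
have co i : (x : 'rV[C]_n.+1) 0 i @[x --> z] --> z 0 i by exact: coord_continuous.
pose q (x : 'rV[C]_n.+1) : E := \row_i (x 0 (lift k i) / x 0 k).
have cq : q x @[x --> z] --> q z.
  apply: (@cvg_row _ _ (nbhs z)) => i; rewrite mxE; under eq_fun do rewrite mxE.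
  apply: (@cvgM _ _ (nbhs z)); first exact: co.
  by apply: (@cvgV _ _ (nbhs z)) => //; exact: co.
have cf := is_Ck_continuous (sf k 0%N).
have := cvg_comp _ _ cq (cf (q z)); rewrite /= -affine_chart_pline// => h.
apply: cvg_at_pline => //; apply: cvg_trans h.
apply: (@near_eq_cvg _ _ (nbhs z)).
have h := cvgr_gt _ (cvg_sqnc (co k)) 0.
have : nbhs z [set x : 'rV[C]_n.+1 | 0 < sqnc (x 0 k)].
  by apply: h; rewrite sqnc_gt0.
apply: (@filterS _ (nbhs z)) => x /=; rewrite sqnc_gt0 => xk.
by rewrite /= -affine_chart_pline.
Qed.

Lemma hdot_mulmxZ (A : 'M[C]_n.+1) (l : C) (z : 'rV[C]_n.+1) :
  Re (hdot ((l *: z) *m A) (l *: z)) = sqnc l * Re (hdot (z *m A) z).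
Proof.
by rewrite -scalemxAl hdotZl hdotZr mulrA -sqncE ReRM.
Qed.

Lemma sqnvZ m (l : C) (z : 'rV[C]_m) : sqnv (l *: z) = sqnc l * sqnv z.
Proof. by rewrite /sqnv mulr_sumr; apply: eq_bigr => i _; rewrite mxE sqncM. Qed.

Lemma sqnv_chart_vec k (w : E) : sqnv (chart_vec k w) = 1 + sqnv w.
Proof.
by apply: (@complexI R); rewrite -hdotxx hdot_chart_vec hdotxx rmorphD rmorph1.
Qed.

Lemma continuous_rayleigh (A : 'M[C]_n.+1) :
  continuous (fun p : cproj R n => Re (hdot (hcoord p *m A) (hcoord p)) /
    sqnv (hcoord p)).
Proof.
move=> p; rewrite -[p]plineK; set z := hcoord p; have z0 : z != 0 := hcoord_neq0 p.
have rE (x : 'rV[C]_n.+1) : x != 0 ->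
    Re (hdot (hcoord (pline x) *m A) (hcoord (pline x))) / sqnv (hcoord (pline x)) =
    Re (hdot (x *m A) x) / sqnv x.
  move=> x0; have [l l0 ->] := hcoord_pline x0.
  by rewrite hdot_mulmxZ sqnvZ -mulf_div divff ?mul1r// sqnc_eq0.
apply: cvg_at_pline => //; rewrite rE//.
have co i : (x : 'rV[C]_n.+1) 0 i @[x --> z] --> z 0 i by exact: coord_continuous.
have h : Re (hdot ((x : 'rV[C]_n.+1) *m A) x) / sqnv x @[x --> z] -->
    Re (hdot (z *m A) z) / sqnv z.
  apply: (@cvgM _ _ (nbhs z)); last first.
    apply: (@cvgV _ _ (nbhs z)); first by rewrite sqnv_eq0.
    by apply: (@cvg_sumf _ _ _ (nbhs z)) => i; apply: (@cvg_sqnc _ _ (nbhs z)).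
  have hc : hdot ((x : 'rV[C]_n.+1) *m A) x @[x --> z] --> hdot (z *m A) z.
    apply: (@cvg_sumf _ _ _ (nbhs z)) => i; apply: (@cvgM _ _ (nbhs z)).
      rewrite mxE; under eq_fun do rewrite mxE.
      apply: (@cvg_sumf _ _ _ (nbhs z)) => j; apply: (@cvgM _ _ (nbhs z)) => //.
      exact: cvg_cst.
    exact: cvg_conjc (co i).
  exact: cvg_comp _ _ hc (@continuous_Re R _).
apply: cvg_trans h; apply: (@near_eq_cvg _ _ (nbhs z)).
have : nbhs z [set x : 'rV[C]_n.+1 | x != 0].
  by apply: open_nbhs_nbhs; split => //; exact: open_neq0.
by apply: (@filterS _ (nbhs z)) => x x0; rewrite rE.
Qed.

(** The formula comes from the last affine chart and extends to the hyperplane at infinity by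
    density and continuity of both sides. *)
Lemma kahler_hermitian (f : cproj R n -> R) : kahler_function 1 f ->
  exists2 A : 'M[C]_n.+1, (forall i j, A i j = conjc (A j i)) &
    forall z, z != 0 -> f (pline z) = Re (hdot (z *m A) z) / sqnv z.
Proof.
move=> [sf [X [ham kil]]].
have [A AJ AE] := chart_hermitian (sf ord_max) (ham ord_max) (kil ord_max).
exists A => // z z0.
have rE (x : 'rV[C]_n.+1) : x != 0 ->
    Re (hdot (hcoord (pline x) *m A) (hcoord (pline x))) / sqnv (hcoord (pline x)) =
    Re (hdot (x *m A) x) / sqnv x.
  move=> x0; have [l l0 ->] := hcoord_pline x0.
  by rewrite hdot_mulmxZ sqnvZ -mulf_div divff ?mul1r// sqnc_eq0.
rewrite -rE//; set q := fun p : cproj R n => Re (hdot (hcoord p *m A) (hcoord p)) /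
  sqnv (hcoord p).
apply: (@dense_continuous_eq _ _ f q).
- exact: continuous_smooth_cproj.
- exact: continuous_rayleigh.
move=> x xj; have x0 : x != 0 by apply: contraNneq (xj ord0) => ->; rewrite mxE.
rewrite (affine_chart_pline (xj ord_max)) /q rE ?chart_vec_neq0//.
rewrite sqnv_chart_vec -AE mulrC mulKf//.
by rewrite gt_eqF// ltr_pwDl ?sqnv_ge0.
Qed.

End hermitian_representation.

(** * Critical values belong to the spectrum *)

Section critical_in_spectrum.
Variables (R : realType) (n : nat).
Local Notation C := R[i].
Local Notation Re := (@complex.Re R).
Local Notation Im := (@complex.Im R).
Local Notation I := ('i%C : C).
Implicit Types (f : cproj R n -> R) (A : 'M[C]_n.+1) (z u v : 'rV[C]_n.+1).

Lemma hdot_hermitian A u v : (forall i j, A i j = conjc (A j i)) ->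
  hdot (u *m A) v = hdot u (v *m A).
Proof.
move=> AJ; rewrite /hdot.
under eq_bigr do rewrite mxE mulr_suml.
rewrite exchange_big /=; apply: eq_bigr => j _.
rewrite mxE rmorph_sum mulr_sumr; apply: eq_bigr => k _.
by rewrite rmorphM /= -AJ; ring.
Qed.

Lemma is_cderive_hdot m (a b c d : 'rV[C]_m) :
  is_cderive 0 (fun t : R => hdot (a + t%:C *: b) (c + t%:C *: d))
    (hdot b c + hdot a d).
Proof.
have h := is_cderive_sum (fun i => is_cderiveM (is_cderive_line 0 a b i)
  (is_cderiveJ (is_cderive_line 0 c d i))).
by apply: (is_cderive_val h); rewrite big_split /= !scale0r !addr0.
Qed.

(** The vector y = zA - f(p) z is orthogonal to z, since f(p) is the Rayleigh quotient and <zA,z> is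
    real. Criticality makes Re <y, .> vanish on the directions of the chart; these are stable under
    i, so only the coordinate k of y could survive, and it equals <y,z> = 0. *)
Lemma critical_eigenvector f A p : (forall i j, A i j = conjc (A j i)) ->
  (forall z : 'rV[C]_n.+1, z != 0 -> f (pline z) = Re (hdot (z *m A) z) / sqnv z) ->
  smooth_cproj f -> critical_point f p ->
  exists2 z : 'rV[C]_n.+1, z != 0 & z *m A = (f p)%:C *: z.
Proof.
move=> AJ fA sf cp; have [k pk] := in_chart_ex p.
pose w := affine_coord k p; have wp : affine_chart k w = p := affine_coordK pk.
pose z := chart_vec k w; have z0 : z != 0 := chart_vec_neq0 k w.
have nz (u : 'rV[C]_n) (x : C) : z + x *: chart_dir k u != 0.
  by rewrite -chart_vecD chart_vec_neq0.
exists z => //.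
pose y := z *m A - (f p)%:C *: z.
suff y0 : y = 0 by apply/eqP; rewrite -subr_eq0 -/y y0.
have reA : Re (hdot (z *m A) z) = f p * sqnv z.
  by rewrite -wp fA// divfK// sqnv_eq0.
have yz : hdot y z = 0.
  rewrite hdotDl hdotNl hdotZl hdotxx -rmorphM -reA.
  apply: complex_ext; first by rewrite ReD ReN /= subrr.
  rewrite ImD ImN /= subr0.
  have : hdot (z *m A) z = conjc (hdot (z *m A) z) by rewrite -hdotC -hdot_hermitian.
  by move=> /(congr1 Im); rewrite ImJ; lra.
have ydir (u : 'rV[C]_n) : Re (hdot y (chart_dir k u)) = 0.
  have d0 := is_derive_ddir (is_Ck_derivable (w := w) (u := u) (sf k 1%N)).
  rewrite (cp k w wp u) in d0.
  have dS := is_derive_sqnv 0 z (chart_dir k u).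
  have dN := (is_cderive_hdot (z *m A) (chart_dir k u *m A) z (chart_dir k u)).1.
  (* Differentiating the product f |z|^2 = Re <zA,z> avoids the derivative of a quotient. *)
  have e t : along (f \o affine_chart k) w u t * along (@sqnv R _) z (chart_dir k u) t
      = Re (hdot (z *m A + t%:C *: (chart_dir k u *m A)) (z + t%:C *: chart_dir k u)).
    rewrite /along /= -[affine_chart _ _]/(pline (chart_vec k _)) chart_vecD fA ?nz//.
    by rewrite divfK ?sqnv_eq0 ?nz// mulmxDl -scalemxAl.
  have := is_derive_uniq (is_derive_ext e (is_deriveMf d0 dS)) dN.
  rewrite /along /= !scale0r !addr0 mul0r add0r wp.
  rewrite (hdot_hermitian (chart_dir k u) z AJ) [hdot _ (z *m A)]hdotC.
  rewrite [hdot _ z]hdotC ReD !ReJ /y hdotDl hdotNl hdotZl ReD ReN ReRM.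
  by lra.
have ylift i : y 0 (lift k i) = 0.
  have h (x : C) : hdot y (chart_dir k (x *: ebase R i)) = conjc x * y 0 (lift k i).
    rewrite (hdot_lift k) chart_dir_diag conjc0 mulr0 add0r.
    under eq_bigr do rewrite chart_dir_lift.
    have := hdot_ebase (\row_l y 0 (lift k l)) i; rewrite mxE => <-.
    by rewrite -hdotZr; apply: eq_bigr => l _; rewrite !mxE.
  have h1 := ydir (1 *: ebase R i); have h2 := ydir (I *: ebase R i).
  move: h1 h2; rewrite !h conjc1 mul1r => h1 h2.
  apply: complex_ext => //; move: h2; rewrite !ReImE /=.
  by rewrite h1; lra.
apply/rowP => j; rewrite [RHS]mxE; case: (unliftP k j) => [i|] ->; first exact: ylift.
move: yz; rewrite (hdot_lift k) big1 => [|i _]; last by rewrite ylift mul0r.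
by rewrite chart_vec_diag conjc1 mulr1 addr0.
Qed.

Local Open Scope sesquilinear_scope.

Lemma hdot_diag (d y : 'rV[C]_n.+1) :
  hdot (y *m diag_mx d) y = \sum_x d 0 x * (sqnc (y 0 x))%:C.
Proof.
rewrite /hdot; apply: eq_bigr => x _; rewrite sqncE mul_mx_diag mxE.
by ring.
Qed.

Lemma critical_values_sub f : kahler_function 1 f ->
  critical_values f `<=` spectrum f.
Proof.
move=> kf l [p [fp cp]]; have [A AJ fA] := kahler_hermitian kf.
have [z z0 zA] := critical_eigenvector AJ fA kf.1 cp.
have Ah : A \is hermsymmx.
  by apply/is_hermitianmxP; rewrite expr0 scale1r; apply/matrixP => i j; rewrite !mxE AJ.
have := orthomx_spectralP (hermitian_normalmx Ah).
set P := spectralmx A; set d := spectral_diag A => AE.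
have dR x : d 0 x = (Re (d 0 x))%:C.
  by have /mxOverP/(_ 0 x)/RRe_real := hermitian_spectral_diag_real Ah.
have Pu : P \is unitarymx := spectral_unitarymx A.
have Pu' := unitarymx_unit Pu.
(* Vectors are rows and A = P^-1 D P, so the coordinates of y in the eigenbasis are y P^-1. *)
pose V := invmx P.
have Vu : V \is unitarymx by rewrite /V (invmx_unitary Pu) trmxC_unitary.
have Vu' : V \in unitmx := unitarymx_unit Vu.
have PV : P *m V = 1%:M by rewrite mulmxV.
exists (@std_ext R n), (proj_map V), (fun x => Re (d 0 x)); split.
- exact: std_natural_extension.
- exact: unitary_holo_isometries0.
- move=> q; rewrite -[q]plineK; set y := hcoord q.
  have y0 : y != 0 := hcoord_neq0 q.
  have yV : y *m V != 0 := mulmx_neq0 Vu' y0.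
  rewrite proj_map_pline// fA// /fin_expectation.
  have -> : hdot (y *m A) y = hdot (y *m V *m diag_mx d) (y *m V).
    rewrite -(hdot_unitary (y *m A) y Vu) [in LHS]AE -/V.
    by rewrite !mulmxA -[_ *m P *m V]mulmxA PV mulmx1.
  have -> : sqnv y = sqnv (y *m V).
    by apply: (@complexI R); rewrite -!hdotxx hdot_unitary.
  rewrite hdot_diag Re_sum mulr_suml; apply: eq_bigr => x _.
  by rewrite std_ext_pline// dR -rmorphM /= mulrA.
(* In the eigenbasis z is an eigenvector of D for l, so D has the entry l at each index where z has
   a nonzero coordinate. *)
- pose y := z *m V; have y0 : y != 0 := mulmx_neq0 Vu' z0.
  have [x yx] := row_neq0_ex y0; exists x => //.
  have : y *m diag_mx d = l%:C *: y.
    have -> : y *m diag_mx d = z *m A *m V.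
      by rewrite [in RHS]AE -/V /y !mulmxA -[_ *m P *m V]mulmxA PV mulmx1.
    by rewrite zA fp -scalemxAl.
  move=> /rowP/(_ x); rewrite mul_mx_diag [LHS]mxE [RHS]mxE [LHS]mulrC.
  by move=> /(mulIf yx) ->.
Qed.

End critical_in_spectrum.

(** * Every torification map has the standard moment map up to an affine map *)

Section torification_rigidity.
Variables (R : realType) (n : nat).
Local Notation C := R[i].
Local Notation E := 'rV[C]_n.
Local Notation Re := (@complex.Re R).
Local Notation Im := (@complex.Im R).
Local Notation I := ('i%C : C).
Variables (Y : 'M[R]_n) (G : E -> cproj R n).
Hypothesis tG : torification_map Y G.
Implicit Types (z : E) (t u v : 'rV[R]_n).

Local Notation F z := (affine_coord ord_max (G z)).

(** The values of G lie in the free locus, so the last chart contains all of them. *)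
Lemma torif_coord_neq0 z j : hcoord (G z) 0 j != 0.
Proof.
have : range G (G z) by exists z.
by rewrite (torif_onto tG) -{1}[G z]plineK => /(free_locusP (hcoord_neq0 _)).
Qed.

Lemma torif_chart z : G z = affine_chart ord_max (F z).
Proof. by rewrite affine_coordK//; exact: torif_coord_neq0. Qed.

Lemma torif_translate t z i :
  F (translate Y t z) 0 i = cis (2 * pi * t 0 i) * F z 0 i.
Proof.
rewrite (torif_equivariant tG) -{1}[G z]plineK torus_act_pline ?hcoord_neq0//.
rewrite affine_coord_pline ?torus_row_neq0 ?hcoord_neq0// !mxE liftK unlift_none /=.
by rewrite mul1r mulrA.
Qed.

Definition cvec u : E := map_mx (real_complex R) u.

(** With u = tY, translation along iu rotates F_i by 2 pi t_i, which gives dF(iu). Complex linearity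
    of dF divides by i. *)
Lemma torif_diff z u i :
  'd (fun x => F x) z (cvec u) 0 i = (2 * pi * (u *m invmx Y) 0 i)%:C * F z 0 i.
Proof.
have [dF _] := (torif_holo_isometric tG).2 _ _ (torif_coord_neq0 z ord_max).
pose t := u *m invmx Y.
have tY : t *m Y = u by rewrite mulmxKV ?(torif_frame tG).
have h1 := differentiable_is_cderive (I *: cvec u) i dF.
have h2 : is_cderive 0 (fun s : R => cis (s * (2 * pi * t 0 i)) * F z 0 i)
    ((0 +i* (2 * pi * t 0 i)) * F z 0 i).
  have d : is_derive (0 : R) (1 : R) (fun s => s * (2 * pi * t 0 i)) (2 * pi * t 0 i).
    apply: (@is_derive_val _ _ _ _ _ (is_deriveMf (is_derive_idf 0)
      (is_deriveCf 0 (2 * pi * t 0 i)))).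
    by rewrite mul1r mulr0 addr0.
  apply: (@is_cderive_val _ _ _ _ _ (is_cderiveM (is_derive_cisf d)
    (is_cderiveC 0 (F z 0 i)))).
  by rewrite mulr0 addr0 mul0r cis0 mulr1.
have e (s : R) : cis (s * (2 * pi * t 0 i)) * F z 0 i =
    F (z + s%:C *: (I *: cvec u)) 0 i.
  have -> : z + s%:C *: (I *: cvec u) = translate Y (s *: t) z.
    congr (_ + _); rewrite -scalemxAl tY; apply/rowP => j; rewrite !mxE.
    by apply: complex_ext; rewrite !ReImE /=; ring.
  by rewrite torif_translate [(s *: t) 0 i]mxE; congr (cis _ * _); ring.
have := is_cderive_uniq h1 (is_cderive_ext e h2).
rewrite linearZ mxE => h.
apply: (mulfI (_ : I != 0)); first by rewrite eq_complex /= oner_eq0 andbF.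
rewrite [LHS]h mulrA; congr (_ * _).
by apply: complex_ext; rewrite !ReImE /=; ring.
Qed.

Local Notation q z i := (sqnc (F z 0 i) / (1 + sqnv (F z))).
Local Notation p z i := (ptheta (re_vec z) (lift ord_max i)).

Lemma re_vecD z (s : R) v : re_vec (z + s%:C *: cvec v) = re_vec z + s *: v.
Proof. by apply/rowP => i; rewrite !mxE ReD ReRM. Qed.

(** By [torif_diff] the image of u has the logarithmic form 2 pi s_i F_i, so isometry equates two
    covariances; the constant is 4 (2 pi)^2. *)
Lemma torif_isometry z u v :
  let s := u *m invmx Y in let t := v *m invmx Y in
  \sum_i p z i * (u 0 i * v 0 i) -
    (\sum_i p z i * u 0 i) * (\sum_i p z i * v 0 i) =
  (4 * pi) ^+ 2 * (\sum_i q z i * (s 0 i * t 0 i) -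
    (\sum_i q z i * s 0 i) * (\sum_i q z i * t 0 i)).
Proof.
move=> s t.
have [dF iso] := (torif_holo_isometric tG).2 _ _ (torif_coord_neq0 z ord_max).
have dE (x : 'rV[R]_n) : 'd (fun x => F x) z (cvec x) =
    \row_i ((cvec ((2 * pi) *: (x *m invmx Y))) 0 i * F z 0 i).
  by apply/rowP => i; rewrite torif_diff !mxE.
have := iso (cvec u) (cvec v).
rewrite [X in fs_metric _ _ X _]dE [X in fs_metric _ _ _ X]dE fs_metric_log.
rewrite dombrowski_metricE /= divr1 => h.
have real2 (P : 'I_n -> R) (a b : 'rV[R]_n) :
    Re (\sum_i (P i)%:C * (cvec a 0 i * conjc (cvec b 0 i)) -
      (\sum_i (P i)%:C * cvec a 0 i) * (\sum_i (P i)%:C * conjc (cvec b 0 i))) =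
    \sum_i P i * (a 0 i * b 0 i) - (\sum_i P i * a 0 i) * (\sum_i P i * b 0 i).
  rewrite -[RHS]/(Re (_)%:C) rmorphB rmorphM !rmorph_sum /=; congr Re.
  congr (_ - _ * _); apply: eq_bigr => i _; rewrite !mxE ?conjc_real -?rmorphM//.
move: h; rewrite !real2 => <-; rewrite -/s -/t.
rewrite (eq_bigr (fun i => (2 * pi) ^+ 2 * (q z i * (s 0 i * t 0 i)))); last first.
  by move=> i _; rewrite !mxE; ring.
rewrite [X in _ - X * _](eq_bigr (fun i => (2 * pi) * (q z i * s 0 i))); last first.
  by move=> i _; rewrite !mxE; ring.
rewrite [X in _ - _ * X](eq_bigr (fun i => (2 * pi) * (q z i * t 0 i))); last first.
  by move=> i _; rewrite !mxE; ring.
by rewrite -!mulr_sumr; ring.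
Qed.

(** The difference of two moment maps for the same action: p, and q transported to the coordinates
    theta by the frame Y. *)
Definition torif_defect (i : 'I_n) z : R :=
  p z i - 4 * pi * \sum_k invmx Y i k * q z k.

(** Along v each |F_k|^2 has logarithmic derivative 4 pi t_k, and q is their normalisation; the
    derivative is q_k times 4 pi t_k minus its mean. *)
Lemma is_derive_torif_q z v k (t := v *m invmx Y) :
  is_derive (0 : R) (1 : R) (fun s : R => q (z + s%:C *: cvec v) k)
    (4 * pi * (q z k * (t 0 k - \sum_l q z l * t 0 l))).
Proof.
have [dF _] := (torif_holo_isometric tG).2 _ _ (torif_coord_neq0 z ord_max).
have dk l : is_derive (0 : R) (1 : R) (fun s : R => sqnc (F (z + s%:C *: cvec v) 0 l))
    (4 * pi * t 0 l * sqnc (F z 0 l)).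
  have h := is_cderive_sqnc (differentiable_is_cderive (cvec v) l dF).
  apply: (is_derive_val h); rewrite [X in Re (X * _)]torif_diff /= scale0r addr0.
  by rewrite -mulrA -sqncE -rmorphM /= -/t; ring.
have P0 x : 1 + sqnv (F x) != 0 by rewrite gt_eqF// ltr_pwDl ?sqnv_ge0.
have dP := is_deriveDf (is_deriveCf 0 1) (is_derive_sumf dk).
have := is_deriveMf (dk k) (@is_deriveVf _ 0
  (fun s : R => 1 + sqnv (F (z + s%:C *: cvec v))) _ (P0 _) dP).
move=> h; apply: (is_derive_val h); rewrite scale0r addr0 add0r.
rewrite (eq_bigr (fun l => (4 * pi * (1 + sqnv (F z))) * (q z l * t 0 l))); last first.
  by move=> l _; field.
rewrite -mulr_sumr; move: (\sum_l _) => S.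
by field.
Qed.

(** The derivative of p_i along v is the covariance of e_i and v under p. That of the other term is
    (4 pi)^2 times the covariance under q of their images under Y^-1, so [torif_isometry] at (e_i,
    v) makes them cancel. *)
Lemma torif_defect_ddir i z v : is_derive (0 : R) (1 : R)
  (along (torif_defect i) z (cvec v)) 0.
Proof.
pose t := v *m invmx Y.
have h1 : is_derive (0 : R) (1 : R) (fun s : R => p (z + s%:C *: cvec v) i)
    (p z i * (v 0 i - \sum_j v 0 j * p z j)).
  apply: (@is_derive_val _ _ _ _ _ (is_derive_ext _
    (is_derive_ptheta (re_vec z) v 0 (lift ord_max i)))).
    by move=> s; rewrite re_vecD.
  rewrite scale0r addr0; congr (_ * (_ - _)).
  rewrite -[RHS](sum_mul_delta (fun j => v 0 j) i); apply: eq_bigr => j _.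
  by rewrite Fstat_lift.
have h2 := is_derive_sumf (fun k => is_deriveMf (is_deriveCf 0 (invmx Y i k))
  (is_derive_torif_q z v k)).
have h3 := is_deriveBf h1 (is_deriveMf (is_deriveCf 0 (4 * pi)) h2).
apply: (is_derive_val h3); rewrite -/t mul0r add0r.
under [X in _ - _ * X]eq_bigr do rewrite mul0r add0r.
have := torif_isometry z (delta_mx 0 i) v.
have dm (a : 'I_n -> R) : \sum_j a j * (delta_mx 0 i : 'rV[R]_n) 0 j = a i.
  rewrite -[RHS](sum_mul_delta a i); apply: eq_bigr => j _.
  by rewrite mxE eqxx /= eq_sym.
have -> : \sum_j p z j * ((delta_mx 0 i : 'rV[R]_n) 0 j * v 0 j) = p z i * v 0 i.
  rewrite -(dm (fun j => p z j * v 0 j)); apply: eq_bigr => j _; ring.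
rewrite dm /= -/t -rowE => iso.
have -> : p z i * (v 0 i - \sum_j v 0 j * p z j) =
    p z i * v 0 i - p z i * \sum_j p z j * v 0 j.
  by rewrite mulrBr; congr (_ - _ * _); apply: eq_bigr => j _; rewrite mulrC.
rewrite iso.
rewrite [X in _ - _ * X](eq_bigr (fun k => 4 * pi * (q z k * (invmx Y i k * t 0 k)) -
  4 * pi * (\sum_l q z l * t 0 l) * (q z k * invmx Y i k))); last first.
  by move=> k _; move: (\sum_l _) => S; ring.
rewrite sumrB -!mulr_sumr.
have rE k : row i (invmx Y) 0 k = invmx Y i k by rewrite mxE.
under [X in _ * (X - _) - _]eq_bigr do rewrite rE.
under [X in _ * (_ - X * _) - _]eq_bigr do rewrite rE.
by ring.
Qed.

Lemma torif_defect_cst i z : torif_defect i z = torif_defect i 0.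
Proof.
have real_shift x v : torif_defect i (x + cvec v) = torif_defect i x.
  have d s : is_derive s (1 : R) (along (torif_defect i) x (cvec v)) 0.
    have da w : derivable (along (torif_defect i) w (cvec v)) 0 1.
      by case: (torif_defect_ddir i w v).
    apply: (is_derive_val (is_derive_along x s da)).
    exact: ddir_eq (torif_defect_ddir _ _ _).
  have := is_derive_0_is_cst 1 0 d.
  by rewrite /along rmorph1 scale1r scale0r addr0.
have imag_shift x t : torif_defect i (translate Y t x) = torif_defect i x.
  have re : re_vec (translate Y t x) = re_vec x.
    by apply/rowP => j; rewrite !mxE ReD /= addr0.
  have sq j : sqnc (F (translate Y t x) 0 j) = sqnc (F x 0 j).
    by rewrite torif_translate sqncM sqnc_cis mul1r.
  rewrite /torif_defect re; congr (_ - _ * _); apply: eq_bigr => k _.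
  rewrite sq; congr (_ * (_ / (1 + _))).
  by apply: eq_bigr => j _; rewrite sq.
(* Any z is reached from 0 by a real shift, where the derivative vanishes, and an imaginary one,
   which acts by rotations and leaves p and q unchanged. *)
have -> : z = translate Y (im_vec z *m invmx Y) (0 + cvec (re_vec z)).
  rewrite /translate mulmxKV ?(torif_frame tG)// add0r.
  apply/rowP => j; rewrite !mxE.
  by apply: complex_ext; rewrite !ReImE /=; ring.
by rewrite imag_shift real_shift.
Qed.

Lemma std_ext_chart (k : 'I_n.+1) (w : E) :
  (forall i, std_ext (affine_chart k w) (lift k i) = sqnc (w 0 i) / (1 + sqnv w)) /\
  std_ext (affine_chart k w) k = (1 + sqnv w)^-1.
Proof.
split=> [i|]; rewrite std_ext_pline ?chart_vec_neq0// -/(chart_vec k w) sqnv_chart_vec.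
  by rewrite chart_vec_lift.
by rewrite chart_vec_diag /sqnc /= expr1n expr0n addr0 mul1r.
Qed.

Lemma sum_std_ext (x : cproj R n) : \sum_y std_ext x y = 1.
Proof. by rewrite -mulr_suml divff// sqnv_eq0 hcoord_neq0. Qed.

Lemma std_ext_ge0 (x : cproj R n) y : 0 <= std_ext x y.
Proof. by rewrite divr_ge0 ?sqnc_ge0 ?sqnv_ge0. Qed.

(* The compatible projections are moment maps for the torus action, hence they
   differ by affine maps. *)
Lemma torif_affine : exists M : 'I_n.+1 -> 'I_n.+1 -> R,
  forall z x, ptheta (re_vec z) x = \sum_y M x y * std_ext (G z) y.
Proof.
(* The constant term becomes linear because the coordinates of [std_ext] sum to 1; the row of
   [ord_max] is then forced by the total mass of p_theta. *)
pose m i y := torif_defect i 0 +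
  oapp (fun k => 4 * pi * invmx Y i k) 0 (unlift ord_max y).
have hm z i : p z i = \sum_y m i y * std_ext (G z) y.
  have := torif_defect_cst i z; rewrite {1}/torif_defect => h.
  rewrite (eq_bigr (fun y => torif_defect i 0 * std_ext (G z) y +
    oapp (fun k => 4 * pi * invmx Y i k) 0 (unlift ord_max y) * std_ext (G z) y));
    last by move=> y _; rewrite mulrDl.
  rewrite big_split /= -mulr_sumr sum_std_ext mulr1 (bigD1_ord ord_max)//=.
  rewrite unlift_none /= mul0r add0r -h -addrA [X in _ + X](_ : _ = 0) ?addr0//.
  rewrite mulr_sumr addrC; apply/eqP; rewrite subr_eq0; apply/eqP.
  apply: eq_bigr => k _; rewrite liftK /= -mulrA; congr (_ * (_ * _)).
  by rewrite [in LHS]torif_chart (std_ext_chart ord_max (F z)).1.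
exists (fun x y => oapp (fun i => m i y) (1 - \sum_i m i y) (unlift ord_max x)).
move=> z x; case: (unliftP ord_max x) => [i|] -> /=; first exact: hm.
have := sum_ptheta (re_vec z); rewrite (bigD1_ord ord_max)//= => /eqP.
rewrite eq_sym -subr_eq => /eqP <-.
rewrite (eq_bigr (fun y => std_ext (G z) y - \sum_i m i y * std_ext (G z) y));
  last by move=> y _; rewrite mulrBl mul1r mulr_suml.
rewrite sumrB sum_std_ext; congr (_ - _); rewrite exchange_big /=.
by apply: eq_bigr => i _; rewrite hm.
Qed.

End torification_rigidity.

(** * The spectrum consists of critical values *)

Section spectrum_in_critical.
Variables (R : realType) (n : nat).
Local Notation C := R[i].
Local Notation Re := (@complex.Re R).

(** A large weight T is put on x, relative to weights 1 on the other points. At the last point,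
    whose parameter is fixed, all the others receive 1/T instead. *)
Lemma ptheta_near1 (x : 'I_n.+1) (m : R) : m < 1 ->
  exists th : 'rV[R]_n, m < ptheta th x.
Proof.
move=> m1; pose a := Num.max m 0.
have a0 : 0 <= a by rewrite le_max lexx orbT.
have a1 : a < 1 by rewrite gt_max m1 ltr01.
have ma : m <= a by rewrite le_max lexx.
have n0 : 0 <= n%:R :> R by rewrite ler0n.
have a10 : 0 < 1 - a by rewrite subr_gt0.
(* This solves T = a (1 + n + T) + 1, so that T / (1 + n + T) > a. *)
pose T := (a * (n%:R + 1) + 1) / (1 - a).
have T0 : 0 < T by rewrite divr_gt0// ltr_wpDl// mulr_ge0// addr_ge0.
have TE : T * (1 - a) = a * (n%:R + 1) + 1 by rewrite divfK// gt_eqF.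
suff [th ath] : exists th : 'rV[R]_n, a < ptheta th x.
  by exists th; exact: le_lt_trans ath.
case: (unliftP ord_max x) => [i|] ->; last first.
  exists (const_mx (- ln T)); rewrite ptheta_max -div1r ltr_pdivlMr ?psum_gt0//.
  rewrite /psum (eq_bigr (fun=> T^-1)); last first.
    by move=> j _; rewrite mxE expRN lnK.
  rewrite sumr_const card_ord -(ltr_pM2r T0) mul1r mulrDr mulr1 mulrDl -mulrA.
  rewrite -mulr_natl -[n%:R * _ * T]mulrA mulVf ?gt_eqF// mulr1.
  by nra.
exists (\row_j (ln T * (i == j)%:R)); rewrite ptheta_lift ltr_pdivlMr ?psum_gt0//.
rewrite mxE eqxx mulr1 lnK//.
have : psum (\row_j (ln T * (i == j)%:R)) <= 1 + (n%:R + T).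
  rewrite /psum lerD2l.
  have -> : n%:R + T = \sum_(j < n) (1 + T * (i == j)%:R).
    by rewrite big_split /= sumr_const card_ord (sum_mul_delta (fun=> T)).
  apply: ler_sum => j _; rewrite mxE; case: eqVneq => [_|_].
    by rewrite !mulr1 lnK// lerDr.
  by rewrite !mulr0 expR0 addr0.
move=> /(ler_wpM2l a0) h; apply: le_lt_trans h _.
by nra.
Qed.

Lemma natural_extension_coord (K : cproj R n -> {ptws 'I_n.+1 -> R}) x :
  continuous K -> continuous (fun p => K p x).
Proof.
move=> cK p; have /cvg_sup/(_ x) h := cK p.
have {}h := h (fmap_filter K (nbhs_filter p)).
move=> A; rewrite nbhsE => -[W [oW Wx] WA].
have : nbhs (K p : initial_topology (fun f : 'I_n.+1 -> R => f x))
    [set g | W (g x)].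
  by apply: open_nbhs_nbhs; split => //; exists W.
by move=> /h; apply: (@filterS _ (nbhs p)) => q /= Wq; exact: WA.
Qed.

Definition vertex (y : 'I_n.+1) : cproj R n := pline (delta_mx 0 y).

Lemma delta_neq0 (y : 'I_n.+1) : delta_mx 0 y != 0 :> 'rV[C]_n.+1.
Proof.
by apply/eqP => /rowP/(_ y)/eqP; rewrite !mxE !eqxx oner_eq0.
Qed.

Lemma std_ext_vertex y x : std_ext (vertex y) x = (x == y)%:R.
Proof.
rewrite std_ext_pline ?delta_neq0// mxE eqxx /=.
have sq (b : bool) : sqnc (b%:R : C) = b%:R.
  by case: b; rewrite /sqnc /= ?expr1n ?expr0n /= addr0.
rewrite sq /sqnv (eq_bigr (fun j => (j == y)%:R)); last first.
  by move=> j _; rewrite mxE eqxx /= sq.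
rewrite (bigD1 y)//= eqxx big1 ?addr0 ?divr1// => j /negbTE ->.
by [].
Qed.

(** Column y of M is K at the vertex e_y, a probability vector by density. If no entry of row x were
    1, their maximum would bound p_theta(x) away from 1. An entry 1 forces the rest of its column to
    be 0. *)
Lemma natural_extension_affine (K : cproj R n -> {ptws 'I_n.+1 -> R}) :
  natural_extension K -> exists2 M : 'I_n.+1 -> 'I_n.+1 -> R,
    forall p x, K p x = \sum_y M x y * std_ext p y &
    forall x, exists y, forall x', M x' y = (x' == x)%:R.
Proof.
move=> [Y [G [tG KG cK _]]].
have [M hM] := torif_affine tG.
have cKx x : continuous (fun p => K p x) by exact: natural_extension_coord.
have onG (z : 'rV[C]_n.+1) : (forall j, z 0 j != 0) -> exists w, G w = pline z.
  move=> zj; have z0 : z != 0 by apply: contraNneq (zj ord0) => ->; rewrite mxE.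
  have : range G (pline z) by rewrite (torif_onto tG); apply/free_locusP.
  by move=> [w _ <-]; exists w.
have KM p x : K p x = \sum_y M x y * std_ext p y.
  apply: (@dense_continuous_eq _ _ (fun p => K p x)
    (fun p => \sum_y M x y * std_ext p y)) => //.
    move=> q; apply: (@cvg_sumf _ _ _ (nbhs q)) => y.
    by apply: (@cvgM _ _ (nbhs q)); [exact: cvg_cst|exact: continuous_std_ext].
  by move=> z /onG[w <-]; rewrite KG hM.
exists M => // x.
have Kge0 p x' : 0 <= K p x'.
  rewrite leNgt; apply/negP => Kp.
  have := cvgr_lt _ (cKx x' p) _ Kp.
  move=> /(_ (nbhs_filter _))/dense_coord_neq0[z /onG[w Gw]] /=.
  by rewrite -Gw KG ltNge ltW ?ptheta_gt0.
have Ksum p : \sum_x' K p x' = 1.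
  apply: (@dense_continuous_eq _ _ (fun p => \sum_x' K p x') (fun=> 1)).
  - by move=> q; apply: (@cvg_sumf _ _ _ (nbhs q)) => y; exact: cKx.
  - by move=> q A; exact: (@cvg_cst _ _ _ (nbhs q)).
  - by move=> z /onG[w <-]; rewrite KG sum_ptheta.
have ME x' y : M x' y = K (vertex y) x'.
  rewrite KM (bigD1 y)//= std_ext_vertex eqxx mulr1 big1 ?addr0// => y' /negbTE h.
  by rewrite std_ext_vertex h mulr0.
have Mle1 x' y : M x' y <= 1.
  by rewrite ME -(Ksum (vertex y)) (bigD1 x')//= lerDl sumr_ge0.
have [y My] : exists y, M x y = 1.
  apply: contrapT => noy.
  have Mlt1 y : M x y < 1.
    by rewrite lt_neqAle Mle1 andbT; apply/eqP => My; apply: noy; exists y.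
  (* Each p_theta(x) is an average of the entries of row x, hence at most the largest one. *)
  pose y0 := [arg max_(y > ord0) M x y]%O.
  have y0max y : M x y <= M x y0 by rewrite /y0; case: arg_maxP => // i _; exact.
  have [th lt_th] := ptheta_near1 x (Mlt1 y0).
  pose w : 'rV[C]_n := cvec th.
  have rw : re_vec w = th by apply/rowP => i; rewrite !mxE.
  move: lt_th; rewrite -rw hM ltNge => /negP; apply.
  rewrite -[X in _ <= X]mulr1 -(sum_std_ext (G w)) mulr_sumr.
  by apply: ler_sum => y _; rewrite ler_wpM2r ?std_ext_ge0.
exists y => x'; have [->//|xx'] := eqVneq x' x.
have := Ksum (vertex y); rewrite (bigD1 x)//= -ME My => /eqP.
rewrite -subr_eq0 addrAC subrr add0r psumr_eq0// => /allP/(_ x').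
by rewrite mem_index_enum xx' /= ME => /(_ isT)/eqP.
Qed.

Lemma spectrum_sub (f : cproj R n -> R) : spectrum f `<=` critical_values f.
Proof.
move=> l [K [phi [X [nK hphi fE [x _ <-]]]]].
have [M KM Mx] := natural_extension_affine nK; have [y My] := Mx x.
have [[psi psiK phiK] hol] : holo_isometries 1 phi.
  exact: connected_component_sub hphi.
pose c y' := \sum_x' X x' * M x' y'.
have fc p : f p = \sum_y' c y' * std_ext (phi p) y'.
  rewrite fE /fin_expectation; under eq_bigr do rewrite KM mulr_sumr.
  rewrite exchange_big /=; apply: eq_bigr => y' _; rewrite mulr_suml.
  by apply: eq_bigr => x' _; rewrite mulrA.
have cy : c y = X x.
  rewrite /c (bigD1 x)//= My eqxx mulr1 big1 ?addr0// => x' /negbTE xx'.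
  by rewrite My xx' mulr0.
pose p := psi (vertex y); have phip : phi p = vertex y := phiK _.
exists p; split.
  rewrite fc phip (bigD1 y)//= std_ext_vertex eqxx mulr1 big1 ?addr0//.
  by move=> y' /negbTE h; rewrite std_ext_vertex h mulr0.
move=> k w wp u; have [cphi hphi'] := hol k.
have chp : in_chart y (phi (affine_chart k w)).
  rewrite wp phip; apply/in_chart_pline; first exact: delta_neq0.
  by rewrite !mxE !eqxx oner_eq0.
have [dF _] := hphi' y w chp.
pose F (t : R) : 'rV[C]_n := affine_coord y (phi (affine_chart k (w + t%:C *: u))).
have F0 i : F 0 0 i = 0.
  rewrite /F scale0r addr0 wp phip affine_coord_pline ?delta_neq0// !mxE eqxx.
  by rewrite eq_sym (negbTE (neq_lift _ _)) mul0r.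
have dFi i := differentiable_is_cderive u i dF.
have dsq i : is_derive (0 : R) (1 : R) (fun t => sqnc (F t 0 i)) 0.
  have h := is_cderive_sqnc (dFi i); apply: (is_derive_val h).
  by rewrite [X in conjc X]F0 conjc0 mulr0 /= mulr0.
(* The function f along the line, written in the chart y centred at e_y. As F(0) = 0, each |F_i|^2
   has derivative 2 Re (F_i' conj F_i) = 0 at t = 0, so g is stationary there. *)
pose g t := (c y + \sum_i c (lift y i) * sqnc (F t 0 i)) * (1 + sqnv (F t))^-1.
have dg : is_derive (0 : R) (1 : R) g 0.
  have P0 : 1 + sqnv (F 0) != 0 by rewrite gt_eqF// ltr_pwDl ?sqnv_ge0.
  have dN := is_deriveDf (is_deriveCf 0 (c y)) (is_derive_sumf (fun i =>
    is_deriveMf (is_deriveCf 0 (c (lift y i))) (dsq i))).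
  have dP := is_deriveDf (is_deriveCf 0 1) (is_derive_sumf dsq).
  have dV := @is_deriveVf _ 0 (fun t => 1 + sqnv (F t)) _ P0 dP.
  apply: (is_derive_val (is_deriveMf dN dV)).
  rewrite [X in 0 + X](_ : _ = 0); last first.
    by rewrite big1// => i _; rewrite mul0r mulr0 addr0.
  by rewrite addr0 mul0r add0r big1_eq addr0 oppr0 mul0r mulr0.
(* The formula g holds only as long as phi stays in the chart y, which continuity of phi ensures for
   small t. *)
apply: ddir_eq; apply: near_eq_is_derive dg.
have path : w + (t : R)%:C *: u @[t --> (0 : R)] --> w.
  have : w + (t : R)%:C *: u @[t --> (0 : R)] --> w + 0%:C *: u.
    apply: cvgD; first exact: cvg_cst.
    apply: cvgZr_tmp; exact: continuous_real_complex.
  by rewrite scale0r addr0.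
have := cvg_comp _ _ path (cphi w) => /(_ _ (near_in_chart chp)).
apply: (@filterS _ (nbhs (0 : R))) => t ch; rewrite /along /= fc (bigD1_ord y)//=.
have -> : phi (affine_chart k (w + t%:C *: u)) = affine_chart y (F t).
  by rewrite affine_coordK.
have [e1 e2] := std_ext_chart y (F t); rewrite e2 /g mulrDl mulr_suml.
by congr (_ + _); apply: eq_bigr => i _; rewrite e1 mulrA.
Qed.

End spectrum_in_critical.

Theorem proposition7p7 (R : realType) (n : nat) (f : cproj R n -> R)
  (hf : kahler_function 1%R f) :
  critical_values f = spectrum f.
Proof.
by apply/seteqP; split; [exact: critical_values_sub|exact: spectrum_sub].
Qed.
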